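(* Let $(u_h,\mathbf{q}_h)^T$, with $u_h(\cdot,t)\in\mathbb{S}_{h,k}$ and $\mathbf{q}_h(\cdot,t)\in\boldsymbol{\Sigma}_{h,k}$ for $t\in[0,T]$, be a solution of the semi-discrete (continuous in time) LDG scheme described in the context for the surface convection-diffusion equation $u_t+\nabla_\Gamma\cdot(\boldsymbol{w}u)=\nabla_\Gamma\cdot(a(u)\nabla_\Gamma u)$ on $(0,T)\times\Gamma$, $u(t=0)=u_0$, with initial value $u_h(\mathbf{x},t=0)$ given by the $L^2$ projection of $u_0$. Let $(u_h^l,\mathbf{q}_h^l)^T$ be its lift onto $\Gamma$. Then $$\frac12\int_\Gamma\frac{1}{\delta_h}(u_h^l)^2(\mathbf{x},T)\,d\mathbf{x}+\int_0^T\!\!\int_\Gamma\frac1{\delta_h}|\mathbf{q}_h^l(\mathbf{x},t)|^2\,d\mathbf{x}\,dt+\Theta_{T,C}([\mathcal{W}_h^l])\le\frac12\int_\Gamma\frac1{\delta_h}(u_0)^2(\mathbf{x})\,d\mathbf{x},$$ where $\mathcal{W}_h^l=(u_h^l,\mathbf{q}_h^l)^T$ and $$\Theta_{T,C}([\mathcal{W}_h^l])=\int_0^T\sum_{e^l\in\mathcal{E}^l}\int_{e^l}\frac1{\delta_e}\Big(C_{11}+\frac{\alpha}{2}\Big)[\![u_h^l]\!]^2\,ds\,dt.$$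
   Context: **Surface and triangulation.** $\Gamma\subset\mathbb{R}^3$ is a closed, oriented, two-dimensional parameterizable $C^k$-surface. There is a sufficiently thin open neighbourhood $\mathcal{N}\subset\mathbb{R}^3$ of $\Gamma$ such that for every $\mathbf{x}\in\mathcal{N}$ there is a unique $\boldsymbol{\zeta}(\mathbf{x})\in\Gamma$ with $\mathbf{x}=\boldsymbol{\zeta}(\mathbf{x})+d(\mathbf{x})\boldsymbol{\nu}_\Gamma(\boldsymbol{\zeta}(\mathbf{x}))$, where $d$ is the signed distance function to $\Gamma$ and $\boldsymbol{\nu}_\Gamma$ is the outward unit normal. $\Gamma_h=\bigcup_{\mathbf{K}_h\in\mathcal{T}_h}\mathbf{K}_h\subset\mathcal{N}$ is a closed triangulated surface made of planar triangles $\mathbf{K}_h$ with vertices on $\Gamma$, where $\mathcal{T}_h$ is an admissible triangulation, and $\mathbf{x}\mapsto\boldsymbol{\zeta}(\mathbf{x})$ is one-to-one from $\Gamma_h$ onto $\Gamma$. $\mathcal{E}$ is the set of edges of $\mathcal{T}_h$, and $h_e$ is the length of $e\in\mathcal{E}$. Each triangle has an integer index $N_{\mathbf{K}_h}$ (distinct triangles have distinct indices). For each $e\in\mathcal{E}$, $\mathbf{K}_h^{e,+}$ and $\mathbf{K}_h^{e,-}$ are the two triangles sharing $e$, and $\mathbf{n}_h^{+},\mathbf{n}_h^{-}$ are their unit outward conormals on $e$ ($\mathbf{n}_h^\pm$ lies in the plane of $\mathbf{K}_h^{e,\pm}$, is normal to $e$ and points out of $\mathbf{K}_h^{e,\pm}$).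 In general $\mathbf{n}_h^+\ne-\mathbf{n}_h^-$. On $\partial\mathbf{K}_h$, $\mathbf{n}_h$ denotes the outward conormal of $\mathbf{K}_h$. $\nabla_{\Gamma_h}$ and $\nabla_{\Gamma_h}\cdot$ are the tangential gradient and divergence on $\Gamma_h$, taken triangle by triangle. **Spaces.** With $\mathbb{P}_k(D)$ the polynomials of degree at most $k$ on a planar domain $D$, $\mathbb{S}_{h,k}=\{\chi\in L^2(\Gamma_h):\chi|_{\mathbf{K}_h}\in\mathbb{P}_k(\mathbf{K}_h)\ \forall\mathbf{K}_h\in\mathcal{T}_h\}$ and $\boldsymbol{\Sigma}_{h,k}=\{\boldsymbol{\varphi}\in[L^2(\Gamma_h)]^3:\boldsymbol{\varphi}|_{\mathbf{K}_h}\in[\mathbb{P}_k(\mathbf{K}_h)]^3\ \forall\mathbf{K}_h\in\mathcal{T}_h\}$. Superscripts $\pm$ denote traces on $e$ from $\mathbf{K}_h^{e,\pm}$. **Lift and measures.** The lift of a function $v_h$ on $\Gamma_h$ is $v_h^l(\boldsymbol{\zeta})=v_h(\mathbf{x}(\boldsymbol{\zeta}))$, $\boldsymbol{\zeta}\in\Gamma$, where $\mathbf{x}(\boldsymbol\zeta)\in\Gamma_h$ is the unique point with $\boldsymbol\zeta(\mathbf{x})=\boldsymbol\zeta$; for vector functions it is defined in the same way. $e^l=\boldsymbol{\zeta}(e)$ and $\mathcal{E}^l=\{e^l:e\in\mathcal{E}\}$. $\delta_h$ is the quotient of surface measures, $\delta_h\,dA_h=dA$ ($dA_h$ on $\Gamma_h$,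 $dA$ on $\Gamma$), and $\delta_e$ is the quotient of line measures, $\delta_e\,ds_h=ds$ ($ds_h$ on $e$, $ds$ on $e^l$). The $L^2$ projection of $u_0$ is the $L^2(\Gamma_h)$-projection onto $\mathbb{S}_{h,k}$ of $u_0$ transferred to $\Gamma_h$ via $\mathbf{x}\mapsto u_0(\boldsymbol{\zeta}(\mathbf{x}))$. **Traces.** On $e$: for scalars, $\{v\}=\frac12(v^-+v^+)$ and $[\![v]\!]=v^+-v^-$. For vectors, $\{\boldsymbol{\varphi},\mathbf{n}_h\}=\frac12(\boldsymbol{\varphi}^+\cdot\mathbf{n}_h^+-\boldsymbol{\varphi}^-\cdot\mathbf{n}_h^-)$ and $[\![\boldsymbol{\varphi},\mathbf{n}_h]\!]=\boldsymbol{\varphi}^-\cdot\mathbf{n}_h^-+\boldsymbol{\varphi}^+\cdot\mathbf{n}_h^+$. **Data.** $a(\cdot)>0$; $\boldsymbol{w}$ is a velocity field tangent to $\Gamma$; $g(u)=\int^u\sqrt{a(s)}\,ds$. $\boldsymbol{w}_h$ is a surface Raviart–Thomas interpolant of $\boldsymbol{w}$ on $\Gamma_h$ (tangential on each triangle) whose normal jumps vanish: $\boldsymbol{w}_h^-\cdot\mathbf{n}_h^-+\boldsymbol{w}_h^+\cdot\mathbf{n}_h^+=0$ on every edge. Further, $\beta_h=0$ where $\nabla_{\Gamma_h}\cdot\boldsymbol{w}_h\ge0$ and $\beta_h=-\frac12\nabla_{\Gamma_h}\cdot\boldsymbol{w}_h$ where $\nabla_{\Gamma_h}\cdot\boldsymbol{w}_h<0$.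 **LDG scheme.** Find $u_h\in\mathbb{S}_{h,k}$, $\mathbf{q}_h\in\boldsymbol{\Sigma}_{h,k}$ such that for all $v_h\in\mathbb{S}_{h,k}$, $\mathbf{r}_h\in\boldsymbol{\Sigma}_{h,k}$ and every $\mathbf{K}_h\in\mathcal{T}_h$, $$\int_{\mathbf{K}_h}(u_h)_tv_h\,d\mathbf{x}-\int_{\mathbf{K}_h}\big(u_h\boldsymbol{w}_h-\sqrt{a(u_h)}\,\mathbf{q}_h\big)\cdot\nabla_{\Gamma_h}v_h\,d\mathbf{x}+\int_{\mathbf{K}_h}\beta_hu_hv_h\,d\mathbf{x}+\int_{\partial\mathbf{K}_h}\widehat{u_h\boldsymbol{w}_h}\cdot\mathbf{n}_hv_h\,ds-\int_{\partial\mathbf{K}_h}\widehat{\sqrt a\,\mathbf{q}}\cdot\mathbf{n}_hv_h\,ds=0,$$ $$\int_{\mathbf{K}_h}\mathbf{q}_h\cdot\mathbf{r}_h\,d\mathbf{x}=-\int_{\mathbf{K}_h}g(u_h)\nabla_{\Gamma_h}\cdot\mathbf{r}_h\,d\mathbf{x}+\int_{\partial\mathbf{K}_h}\widehat g\,\mathbf{n}_h\cdot\mathbf{r}_h\,ds.$$ The numerical fluxes on $e$, as seen from $\mathbf{K}_h^{e,+}$ and $\mathbf{K}_h^{e,-}$ respectively, are $$\widehat{u_h\boldsymbol{w}_h}^{\pm}=\pm\Big(\{u_h\boldsymbol{w}_h,\mathbf{n}_h\}+\frac{\alpha}{2}[\![u_h]\!]\Big)\mathbf{n}_h^{\pm},\qquad\alpha=\max|\mathbf{n}_h\cdot\boldsymbol{w}_h|,$$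 $$\widehat{\sqrt a\,\mathbf{q}}^{\pm}=\pm\Big(\frac{[\![g(u_h)]\!]}{[\![u_h]\!]}\{\mathbf{q}_h,\mathbf{n}_h\}-C_{11}[\![u_h]\!]+\boldsymbol{C}_{12}\cdot\mathbf{n}_h^+[\![\mathbf{q}_h,\mathbf{n}_h]\!]\Big)\mathbf{n}_h^{\pm},$$ $$\widehat g^{\,+}=\widehat g^{\,-}=\{g(u_h)\}-\boldsymbol{C}_{12}\cdot\mathbf{n}_h^+[\![u_h]\!],$$ where the quotient $[\![g(u_h)]\!]/[\![u_h]\!]$ is read as its limiting value $\sqrt{a(u_h)}$ where $[\![u_h]\!]=0$, and $$C_{11}=\frac1{h_e},\qquad\boldsymbol{C}_{12}=\frac12\Big(S^{\mathbf{K}_h^{e,-}}_{\mathbf{K}_h^{e,+}}\mathbf{n}_h^++S^{\mathbf{K}_h^{e,+}}_{\mathbf{K}_h^{e,-}}\mathbf{n}_h^-\Big),$$ with $S^{\mathbf{K}'}_{\mathbf{K}}=1$ if $N_{\mathbf{K}}>N_{\mathbf{K}'}$ and $0$ otherwise. *)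

(* Defs.v *)
From HB Require Import structures.
From mathcomp Require Import all_boot all_order all_algebra.
From mathcomp Require Import all_classical all_reals all_analysis.
Set Implicit Arguments.
Unset Strict Implicit.
Unset Printing Implicit Defensive.
Import Order.TTheory GRing.Theory Num.Theory.
Import numFieldNormedType.Exports.
Local Open Scope classical_set_scope.
Local Open Scope ring_scope.

(* R^3 with its Borel sigma-algebra.  The library norm of 'rV[R]_3 is the sup
   norm; lengths below always use the Euclidean [enorm]. *)
Definition borel3 (R : realType) := g_sigma_algebraType (@open 'rV[R]_3).

Section Euclidean.
Variable R : realType.
Implicit Types u v : 'rV[R]_3.

Definition dot u v : R := (u *m v^T) 0 0.
Definition enorm u : R := Num.sqrt (dot u u).
Definition unitv u : 'rV[R]_3 := (enorm u)^-1 *: u.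
Definition orth_part u v := v - dot v (unitv u) *: unitv u.

(* |u x v|, by Lagrange's identity. *)
Definition area_elt u v : R := Num.sqrt (dot u u * dot v v - dot u v ^+ 2).

(* The Borel structure of R * R is the product one, so that lebesgue2 is a
   measure on the type carrying the topology used for differentiation. *)
Definition lebesgue2 := (@lebesgue_measure R \x @lebesgue_measure R)%E.

Definition d1 (X : R * R -> 'rV[R]_3) (p : R * R) := 'D_((1, 0) : R * R) X p.
Definition d2 (X : R * R -> 'rV[R]_3) (p : R * R) := 'D_((0, 1) : R * R) X p.

Fixpoint Cm (m : nat) (U : set (R * R)) (X : R * R -> 'rV[R]_3) : Prop :=
  (forall p, U p -> {for p, continuous X}) /\
  if m is m'.+1 then
    [/\ forall p, U p -> derivable X p ((1, 0) : R * R),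
        forall p, U p -> derivable X p ((0, 1) : R * R),
        Cm m' U (d1 X) & Cm m' U (d2 X)]
  else True.

(* Regular C^m local parametrization of G; the last clause says that X is a
   homeomorphism onto a relatively open part of G. *)
Definition chart (m : nat) (G : set 'rV[R]_3) (U : set (R * R))
    (X : R * R -> 'rV[R]_3) : Prop :=
  [/\ open U, Cm m U X, {in U &, injective X},
      forall p, U p -> area_elt (d1 X p) (d2 X p) != 0
    & forall V, open V -> V `<=` U ->
        exists W, open W /\ X @` V = G `&` W].

(* The surface measure of G (as a Borel measure on R^3 concentrated on G),
   characterised by dA = |d1 X x d2 X| ds dt in every chart X. *)
Definition is_surface_measure (m : nat) (G : set 'rV[R]_3)
    (dA : {measure set (borel3 R) -> \bar R}) : Prop :=
  dA (~` G) = 0%E /\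
  forall U X, chart m G U X -> forall E : set (R * R), measurable E -> E `<=` U ->
    dA (X @` E) = (\int[lebesgue2]_(p in E) (area_elt (d1 X p) (d2 X p))%:E)%E.

(* The line measure of a curve C, characterised by ds = |c'(r)| dr along
   every regular C^1 simple arc c with values in C. *)
Definition is_line_measure (C : set 'rV[R]_3)
    (ds : {measure set (borel3 R) -> \bar R}) : Prop :=
  [/\ ds (~` C) = 0%E, forall x : 'rV[R]_3, ds [set x] = 0%E &
  forall (a b : R) (c : R -> 'rV[R]_3), a < b ->
    {in `]a, b[, forall r, derivable c r 1} ->
    {in `]a, b[, forall r, {for r, continuous (fun r' => 'D_1 c r')}} ->
    {in `]a, b[, forall r, 'D_1 c r != 0} ->
    {in `]a, b[ &, injective c} ->
    (forall r, r \in `]a, b[ -> C (c r)) ->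
    forall E : set R, measurable E -> E `<=` `]a, b[%classic ->
      ds (c @` E) =
        (\int[@lebesgue_measure R]_(r in E) (enorm ('D_1 c r))%:E)%E].

(* Trace at x, from the side of D, of a function defined on D. *)
Definition trace (V : ptopologicalType) (D : set 'rV[R]_3)
    (v : 'rV[R]_3 -> V) (x : 'rV[R]_3) : V := lim (v @ within D (nbhs x)).

End Euclidean.

Section Surface.
Variable R : realType.
Local Notation R3 := ('rV[R]_3).

Record surface := Surface {
  pts : set R3;
  inside : set R3;    (* the region enclosed by the surface *)
  normal : R3 -> R3   (* meaningful on pts only *)
}.

Definition closed_oriented_surface (m : nat) (G : surface) : Prop :=
  [/\ compact (pts G) /\ pts G !=set0,
      open (inside G) /\ pts G = closure (inside G) `\` inside G,
      bounded_set (inside G),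
      forall y, pts G y -> exists U X,
        [/\ chart m (pts G) U X, (X @` U) y &
            forall p, U p -> dot (normal G (X p)) (d1 X p) = 0 /\
                             dot (normal G (X p)) (d2 X p) = 0]
    & {within pts G, continuous (normal G)} /\
      forall y, pts G y -> enorm (normal G y) = 1 /\
        \forall e \near 0^'+, inside G (y - e *: normal G y) /\
                            ~ closure (inside G) (y + e *: normal G y)].

Definition sdist (G : surface) (x : R3) : R :=
  let dist := inf [set enorm (x - y) | y in pts G] in
  if `[< inside G x >] then - dist else dist.

Definition foot (G : surface) (x y : R3) : Prop :=
  pts G y /\ x = y + sdist G x *: normal G y.

Definition tubular_nbhd (G : surface) (N : set R3) : Prop :=
  [/\ open N, pts G `<=` N & forall x, N x -> exists! y, foot G x y].

Definition zeta (G : surface) (x : R3) : R3 := xget 0 [set y | foot G x y].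

Definition tangent_field (G : surface) (w : R3 -> R3) : Prop :=
  forall y, pts G y -> dot (w y) (normal G y) = 0.

End Surface.

Section Mesh.
Variable R : realType.
Local Notation R3 := ('rV[R]_3).

(* Side i of a triangle is the one opposite to its vertex i.
   [adj e true] is the triangle K^{e,+} together with the number of the side
   of K^{e,+} that is e; [adj e false] is the same for K^{e,-}. *)
Record mesh := Mesh {
  tria : finType;
  edge : finType;
  vtx : tria -> 'I_3 -> R3;
  adj : edge -> bool -> tria * 'I_3
}.

Variable T : mesh.
Implicit Types (K : tria T) (e : edge T) (s : bool).

Definition base K : R3 := vtx K ord0.
Definition leg1 K : R3 := vtx K (ordS ord0) - base K.
Definition leg2 K : R3 := vtx K (ordS (ordS ord0)) - base K.
Definition area2 K : R := area_elt (leg1 K) (leg2 K).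

(* affine parametrization of (the plane of) K *)
Definition tpt K (p : R * R) : R3 := base K + p.1 *: leg1 K + p.2 *: leg2 K.

Definition ref_tri : set (R * R) := [set p | [/\ 0 < p.1, 0 < p.2 & p.1 + p.2 < 1]].
Definition cref_tri : set (R * R) := [set p | [/\ 0 <= p.1, 0 <= p.2 & p.1 + p.2 <= 1]].
Definition itri K : set R3 := tpt K @` ref_tri.   (* relative interior *)
Definition ctri K : set R3 := tpt K @` cref_tri.

Definition side_src (f : tria T * 'I_3) : R3 := vtx f.1 (ordS f.2).
Definition side_tgt (f : tria T * 'I_3) : R3 := vtx f.1 (ordS (ordS f.2)).
Definition side (f : tria T * 'I_3) : set R3 :=
  [set side_src f + r *: (side_tgt f - side_src f) | r in `[0, 1]%classic].

Definition ept e (r : R) : R3 :=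
  side_src (adj e true) + r *: (side_tgt (adj e true) - side_src (adj e true)).
Definition eset e : set R3 := ept e @` `[0, 1]%classic.
Definition elen e : R := enorm (side_tgt (adj e true) - side_src (adj e true)).

Definition Gh : set R3 := \bigcup_K ctri K.

(* Conforming triangulation without boundary, [edge T] being its set of edges:
   each edge lies in exactly the two triangles listed by [adj]. *)
Definition admissible : Prop :=
  [/\ forall K, area2 K != 0,
      forall K K', K != K' ->
        [\/ ctri K `&` ctri K' = set0,
            exists i i', vtx K i = vtx K' i' /\
              ctri K `&` ctri K' = [set vtx K i]
          | exists i i', side (K, i) = side (K', i') /\
              ctri K `&` ctri K' = side (K, i)],
      forall f, exists! e, side f = eset e,
      forall e f, side f = eset e <-> exists s, f = adj e s
    & forall e, (adj e true).1 != (adj e false).1].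

Definition conormal (f : tria T * 'I_3) : R3 :=
  - unitv (orth_part (side_tgt f - side_src f) (vtx f.1 f.2 - side_src f)).

(* n_h^+ for s = true, n_h^- for s = false *)
Definition ncon e s : R3 := conormal (adj e s).

(* Integrals over K with respect to dA_h and over e with respect to ds_h.
   The boundary of K, a null set, is left out: elements of the discrete spaces
   are only determined on the open triangles. *)
Definition tint K (f : R3 -> R) : R :=
  area2 K * \int[@lebesgue2 R]_(p in ref_tri) f (tpt K p).
Definition tinte K (f : R3 -> \bar R) : \bar R :=
  ((area2 K)%:E * \int[@lebesgue2 R]_(p in ref_tri) f (tpt K p))%E.
Definition eint e (f : R3 -> R) : R :=
  elen e * \int[@lebesgue_measure R]_(r in `[0, 1]%classic) f (ept e r).
Definition einte e (f : R3 -> \bar R) : \bar R :=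
  ((elen e)%:E * \int[@lebesgue_measure R]_(r in `[0%R, 1%R]%classic) f (ept e r))%E.

(* Integral over the boundary of K, where F e s is the integrand on e as seen
   from the triangle on side s of e. *)
Definition bint K (F : edge T -> bool -> R3 -> R) : R :=
  \sum_e \sum_(s : bool | (adj e s).1 == K) eint e (F e s).

(* orthonormal basis of the plane of K *)
Definition tau1 K : R3 := unitv (leg1 K).
Definition tau2 K : R3 := unitv (orth_part (leg1 K) (leg2 K)).

Definition tgrad K (v : R3 -> R) (x : R3) : R3 :=
  'D_(tau1 K) v x *: tau1 K + 'D_(tau2 K) v x *: tau2 K.
Definition tdiv K (phi : R3 -> R3) (x : R3) : R :=
  dot ('D_(tau1 K) phi x) (tau1 K) + dot ('D_(tau2 K) phi x) (tau2 K).

Definition is_poly (k : nat) K (v : R3 -> R) : Prop :=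
  exists c : nat -> nat -> R, forall p, ref_tri p ->
    v (tpt K p) =
      \sum_(i < k.+1) \sum_(j < (k - i).+1) c i j * p.1 ^+ i * p.2 ^+ j.

(* Square integrability follows from measurability and piecewise
   polynomiality.  The values on the edges are irrelevant. *)
Definition Sh (k : nat) (v : R3 -> R) : Prop :=
  measurable_fun (Gh : set (borel3 R)) (v : borel3 R -> R) /\
  forall K, is_poly k K v.
Definition Sigmah (k : nat) (phi : R3 -> R3) : Prop :=
  forall i : 'I_3, Sh k (fun x => phi x 0 i).

Definition etrace (V : ptopologicalType) e s (v : R3 -> V) (x : R3) : V :=
  trace (itri (adj e s).1) v x.

Definition avg e (v : R3 -> R) x : R :=
  2^-1 * (etrace e false v x + etrace e true v x).
Definition jump e (v : R3 -> R) x : R :=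
  etrace e true v x - etrace e false v x.
Definition navg e (phi : R3 -> R3) x : R :=
  2^-1 * (dot (etrace e true phi x) (ncon e true)
          - dot (etrace e false phi x) (ncon e false)).
Definition njump e (phi : R3 -> R3) x : R :=
  dot (etrace e false phi x) (ncon e false)
  + dot (etrace e true phi x) (ncon e true).

(* Surface Raviart-Thomas space of order r: on each triangle
   [P_r]^2 + (x - base) P_r (tangential), with vanishing normal jumps. *)
Definition RTh (r : nat) (w : R3 -> R3) : Prop :=
  (forall K, exists p1 p2 p3 : R3 -> R,
     [/\ is_poly r K p1, is_poly r K p2, is_poly r K p3 &
       forall x, itri K x ->
         w x = p1 x *: leg1 K + p2 x *: leg2 K + p3 x *: (x - base K)]) /\
  forall e x, eset e x -> njump e w x = 0.

(* A linear operator sending tangent fields of G to the surface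
   Raviart-Thomas space; no choice of degrees of freedom is imposed. *)
Definition RT_interpolation (G : surface R) (r : nat)
    (Ih : (R3 -> R3) -> (R3 -> R3)) : Prop :=
  (forall w, tangent_field G w -> RTh r (Ih w)) /\
  (forall c w1 w2 w3, tangent_field G w1 -> tangent_field G w2 ->
     (forall y, pts G y -> w3 y = c *: w1 y + w2 y) ->
     forall K x, itri K x -> Ih w3 x = c *: Ih w1 x + Ih w2 x).

End Mesh.

Section Scheme.
Variables (R : realType) (T : mesh R).
Local Notation R3 := ('rV[R]_3).
Variables (a g : R -> R) (wh : R3 -> R3) (N : tria T -> int).
Implicit Types (K : tria T) (e : edge T) (s : bool).

Definition betah K (x : R3) : R :=
  if 0 <= tdiv K wh x then 0 else - 2^-1 * tdiv K wh x.

(* The normal jumps of wh vanish, so both sides of e give the same maximum. *)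
Definition alpha e : R :=
  sup [set `|dot (ncon e true) (etrace e true wh x)| | x in eset e].

Definition C11 e : R := (elen e)^-1.

Definition switch K' K : R := if (N K' < N K)%R then 1 else 0.
Definition C12 e : R3 :=
  let Kp := (adj e true).1 in let Km := (adj e false).1 in
  2^-1 *: (switch Km Kp *: ncon e true + switch Kp Km *: ncon e false).

Definition sgnb s : R := if s then 1 else -1.

Definition diffquot e (u : R3 -> R) x : R :=
  if jump e u x == 0 then Num.sqrt (a (etrace e true u x))
  else jump e (g \o u) x / jump e u x.

Definition flux_uw (u : R3 -> R) e s x : R3 :=
  (sgnb s * (navg e (fun z => u z *: wh z) x + alpha e / 2 * jump e u x))
    *: ncon e s.
Definition flux_aq (u : R3 -> R) (q : R3 -> R3) e s x : R3 :=
  (sgnb s * (diffquot e u x * navg e q x - C11 e * jump e u x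
             + dot (C12 e) (ncon e true) * njump e q x)) *: ncon e s.
Definition flux_g (u : R3 -> R) e x : R :=
  avg e (g \o u) x - dot (C12 e) (ncon e true) * jump e u x.

Definition LDG_eq_u (u ut : R3 -> R) (q : R3 -> R3) K (v : R3 -> R) : Prop :=
  tint K (fun x => ut x * v x)
  - tint K (fun x => dot (u x *: wh x - Num.sqrt (a (u x)) *: q x) (tgrad K v x))
  + tint K (fun x => betah K x * u x * v x)
  + bint K (fun e s x => dot (flux_uw u e s x) (ncon e s) * etrace e s v x)
  - bint K (fun e s x => dot (flux_aq u q e s x) (ncon e s) * etrace e s v x)
  = 0.

Definition LDG_eq_q (u : R3 -> R) (q : R3 -> R3) K (r : R3 -> R3) : Prop :=
  tint K (fun x => dot (q x) (r x)) =
  - tint K (fun x => g (u x) * tdiv K r x)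
  + bint K (fun e s x => flux_g u e x * dot (ncon e s) (etrace e s r x)).

(* Classical solution in time: at every point of the open triangles u is
   continuous on [0, tf] and differentiable on ]0, tf[. *)
Definition LDG_solution (k : nat) (tf : R) (u : R -> R3 -> R)
    (q : R -> R3 -> R3) : Prop :=
  [/\ forall t, t \in `[0, tf] -> Sh T k (u t) /\ Sigmah T k (q t),
      forall K x, itri K x ->
        {within `[0, tf]%classic, continuous (fun t => u t x)},
      forall K x, itri K x -> {in `]0, tf[, forall t, derivable (u^~ x) t 1},
      forall t, t \in `]0, tf[ -> forall v, Sh T k v -> forall K,
        LDG_eq_u (u t) (fun x => derive1 (u^~ x) t) (q t) K v
    & forall t, t \in `]0, tf[ -> forall r, Sigmah T k r -> forall K,
        LDG_eq_q (u t) (q t) K r].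

End Scheme.

Section Lift.
Variables (R : realType) (G : surface R) (T : mesh R).
Local Notation R3 := ('rV[R]_3).
Implicit Types (K : tria T) (e : edge T) (s : bool).

Definition unlift_pt (y : R3) : R3 := xget 0 [set x | Gh T x /\ zeta G x = y].
Definition glift (V : Type) (v : R3 -> V) (y : R3) : V := v (unlift_pt y).

Definition elift e : set R3 := zeta G @` eset e.

(* Jump on e^l of a function on G, with traces from the lifted triangles. *)
Definition jumpl e (v : R3 -> R) (y : R3) : R :=
  trace (zeta G @` itri (adj e true).1) v y
  - trace (zeta G @` itri (adj e false).1) v y.

(* delta dA_h = dA, the points of Gh and G being identified by zeta *)
Definition surface_quotient (dA : {measure set (borel3 R) -> \bar R})
    (delta : R3 -> R) : Prop :=
  [/\ measurable_fun (Gh T : set (borel3 R)) (delta : borel3 R -> R),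
      forall x, Gh T x -> 0 < delta x
    & forall B : set (borel3 R), measurable B ->
        dA B = (\sum_(K : tria T) tinte K (fun x => (delta x * \1_B (zeta G x))%:E))%E].

(* delta ds_h = ds on e *)
Definition line_quotient e (ds : {measure set (borel3 R) -> \bar R})
    (delta : R3 -> R) : Prop :=
  [/\ measurable_fun (eset e : set (borel3 R)) (delta : borel3 R -> R),
      forall x, eset e x -> 0 < delta x
    & forall B : set (borel3 R), measurable B ->
        ds B = einte e (fun x => (delta x * \1_B (zeta G x))%:E)].

(* The second clause is what makes the projection meaningful. *)
Definition is_L2_projection (k : nat) (u0 uh0 : R3 -> R) : Prop :=
  [/\ measurable_fun (pts G : set (borel3 R)) (u0 : borel3 R -> R),
      (\sum_(K : tria T) tinte K (fun x => (u0 (zeta G x) ^+ 2)%:E) < +oo)%E,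
      Sh T k uh0
    & forall v, Sh T k v ->
        \sum_(K : tria T) tint K (fun x => uh0 x * v x) =
        \sum_(K : tria T) tint K (fun x => u0 (zeta G x) * v x)].

Definition Theta (wh : R3 -> R3) (ds : edge T -> {measure set (borel3 R) -> \bar R})
    (deltae : edge T -> R3 -> R) (tf : R) (ul : R -> R3 -> R) : \bar R :=
  (\int[@lebesgue_measure R]_(t in `[0%R, tf]%classic)
    \sum_e \int[ds e]_(y in elift e)
      ((glift (deltae e) y)^-1 * (C11 e + alpha wh e / 2)
        * jumpl e (ul t) y ^+ 2)%:E)%E.

End Lift.

(* Main.v *)
Require Import Defs.
From HB Require Import structures.
From mathcomp Require Import all_boot all_order all_algebra.
From mathcomp Require Import all_classical all_reals all_analysis measurable_realfun.
From mathcomp Require Import qpoly ring lra.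
Set Implicit Arguments.
Unset Strict Implicit.
Unset Printing Implicit Defensive.
Import Order.TTheory GRing.Theory Num.Theory.
Import numFieldNormedType.Exports.
Local Open Scope classical_set_scope.
Local Open Scope ring_scope.

(** The estimate is the energy identity of the scheme, integrated in time.

At a fixed time the first equation is tested with u_h and the second one with
q_h, and both are summed over the triangles.  On every triangle the divergence
theorem is used twice, since u w . grad u = w . grad (u^2 / 2) and
sqrt(a(u)) q . grad u = q . grad (g(u)).  The volume terms that survive are
u_t u, |q|^2 and (div w / 2 + beta) u^2, and the last one is nonnegative by
the choice of beta ([tri_balance]).  The boundary terms are regrouped by edges.
There the two conormals n^+ and n^- enter only through the numbers q^+ . n^+,
q^- . n^- and w^+ . n^+ = - w^- . n^-; the last equality is the absence of
normal jumps of w_h.  Because the difference quotient multiplied by the jump of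
u_h is the jump of g(u_h), all terms cancel except
(C_11 + alpha / 2) [u_h]^2 ([edge_balance]).  Hence E' + Q + Theta <= 0
([energy_balance]), with E half the squared norm of u_h, Q the squared norm of
q_h and Theta the jump terms.

To integrate this inequality, E is written as a quadratic form in the values
of u_h at finitely many points of the open triangles, so that pointwise
differentiability of u_h in time suffices ([energy_derive]).  Neither
continuity of E' nor measurability of q_h in time is available: the integral
of - E' is bounded by applying Fatou's lemma to difference quotients
([int_derivative_le]), and Q and Theta are added by superadditivity of lower
integrals ([ge0_integral_superadditive]).  The energy at time 0 is at most that
of u_0, as for every orthogonal projection ([L2_projection_le]).

It remains to pull the integrals over the smooth surface back to the
triangles.  The graph of the closest point map is compact and this map is
one-to-one, so it is a homeomorphism between the triangulated and the smooth
surface ([continuous_zeta], [continuous_unlift]).  Therefore the weights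
1 / delta_h and 1 / delta_e undo the change of measure
([ge0_integral_transfer]), and traces of lifted functions are traces of the
original ones ([trace_lift]). *)

(** * Euclidean geometry of space *)

Section DotProduct.
Variable R : realType.
Implicit Types (u v w : 'rV[R]_3) (c d : R).

Lemma dotE u v : dot u v = \sum_i u 0 i * v 0 i.
Proof. by rewrite /dot mxE; apply: eq_bigr => i _; rewrite mxE. Qed.

Lemma dotC u v : dot u v = dot v u.
Proof. by rewrite !dotE; apply: eq_bigr => i _; rewrite mulrC. Qed.

Lemma dotDl u v w : dot (u + v) w = dot u w + dot v w.
Proof. by rewrite /dot mulmxDl mxE. Qed.

Lemma dotDr u v w : dot w (u + v) = dot w u + dot w v.
Proof. by rewrite dotC dotDl !(dotC w). Qed.

Lemma dotZl c u w : dot (c *: u) w = c * dot u w.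
Proof. by rewrite /dot -scalemxAl mxE. Qed.

Lemma dotZr c u w : dot w (c *: u) = c * dot w u.
Proof. by rewrite dotC dotZl dotC. Qed.

Lemma dotNl u w : dot (- u) w = - dot u w.
Proof. by rewrite -scaleN1r dotZl mulN1r. Qed.

Lemma dotNr u w : dot w (- u) = - dot w u.
Proof. by rewrite dotC dotNl dotC. Qed.

Lemma dot0l w : dot 0 w = 0.
Proof. by rewrite -(scale0r w) dotZl mul0r. Qed.

Definition dotL := (dotDl, dotDr, dotZl, dotZr, dotNl, dotNr).

Lemma dot_ge0 u : 0 <= dot u u.
Proof. by rewrite dotE; apply: sumr_ge0 => i _; rewrite -expr2 sqr_ge0. Qed.

Lemma dot_eq0 u : (dot u u == 0) = (u == 0).
Proof.
apply/eqP/eqP => [|->]; last by rewrite dot0l.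
rewrite dotE => /psumr_eq0P u0; apply/rowP => i; rewrite mxE.
by apply/eqP; rewrite -sqrf_eq0 expr2 u0 // => j _; rewrite -expr2 sqr_ge0.
Qed.

Lemma dot_gt0 u : (0 < dot u u) = (u != 0).
Proof. by rewrite lt_neqAle dot_ge0 andbT eq_sym dot_eq0. Qed.

Lemma enorm_gt0 u : (0 < enorm u) = (u != 0).
Proof. by rewrite /enorm sqrtr_gt0 dot_gt0. Qed.

Lemma sqr_enorm u : enorm u ^+ 2 = dot u u.
Proof. by rewrite /enorm sqr_sqrtr // dot_ge0. Qed.

Lemma enorm_unitv u : enorm u *: unitv u = u.
Proof.
rewrite /unitv scalerA; have [->|u0] := eqVneq u 0; first by rewrite scaler0.
by rewrite divff ?scale1r// gt_eqF// enorm_gt0.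
Qed.

Lemma unitv_dot u : u != 0 -> dot (unitv u) (unitv u) = 1.
Proof.
move=> u0; rewrite /unitv dotZl dotZr -sqr_enorm.
by field; rewrite gt_eqF// enorm_gt0.
Qed.

(** The square of the area element is the Gram determinant; it is nonnegative
because, after multiplication by the squared length of the first vector, it is
the squared length of a vector orthogonal to that one. *)
Lemma gram_ge0 u v : 0 <= dot u u * dot v v - dot u v ^+ 2.
Proof.
have [->|u0] := eqVneq u 0; first by rewrite !dot0l mul0r expr0n subr0.
have du : 0 < dot u u by rewrite dot_gt0.
have := dot_ge0 (dot u u *: v - dot u v *: u).
rewrite !dotL (dotC v u) => H; rewrite -(pmulr_rge0 _ du).
by apply: le_trans H _; rewrite le_eqVlt; apply/orP; left; apply/eqP; ring.
Qed.

Lemma sqr_area_elt u v : area_elt u v ^+ 2 = dot u u * dot v v - dot u v ^+ 2.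
Proof. by rewrite /area_elt sqr_sqrtr // gram_ge0. Qed.

Lemma area_elt_ge0 u v : 0 <= area_elt u v.
Proof. exact: sqrtr_ge0. Qed.

Lemma area_elt_neq0l u v : area_elt u v != 0 -> u != 0.
Proof.
apply: contra => /eqP ->; rewrite -sqrf_eq0 sqr_area_elt !dot0l.
by rewrite mul0r expr0n subr0.
Qed.

Lemma orth_part_dot u v : u != 0 -> dot (orth_part u v) u = 0.
Proof.
move=> u0; rewrite /orth_part /unitv !dotL -sqr_enorm.
by field; rewrite gt_eqF// enorm_gt0.
Qed.

Lemma orth_part_dotu u v : u != 0 -> dot (orth_part u v) (unitv u) = 0.
Proof. by move=> u0; rewrite /unitv dotZr orth_part_dot// mulr0. Qed.

(** Height times base is the area of the parallelogram. *)
Lemma orth_part_norm u v : u != 0 -> enorm u * enorm (orth_part u v) = area_elt u v.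
Proof.
move=> u0; apply/esym; rewrite /area_elt.
rewrite (_ : _ - _ = (enorm u * enorm (orth_part u v)) ^+ 2); last first.
  rewrite exprMn !sqr_enorm.
  have -> : dot (orth_part u v) (orth_part u v) = dot v (orth_part u v).
    rewrite {1}/orth_part dotDl dotNl dotZl.
    by rewrite (dotC (unitv u)) orth_part_dotu// mulr0 subr0.
  rewrite /orth_part dotDr dotNr dotZr /unitv !dotZr (dotC v u) -sqr_enorm.
  by field; rewrite gt_eqF// enorm_gt0.
by rewrite sqrtr_sqr ger0_norm// mulr_ge0// sqrtr_ge0.
Qed.

Lemma orth_part_neq0 u v : area_elt u v != 0 -> orth_part u v != 0.
Proof.
move=> a0; apply: contra a0 => /eqP o0; have [u0|u0] := eqVneq u 0.
  by rewrite -sqrf_eq0 sqr_area_elt u0 !dot0l mul0r expr0n subr0.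
by rewrite -orth_part_norm// o0 /enorm dot0l sqrtr0 mulr0.
Qed.

Lemma dot_unit_orth u v : u != 0 -> orth_part u v != 0 ->
  dot (unitv (orth_part u v)) v = enorm (orth_part u v).
Proof.
move=> u0 o0; rewrite /unitv dotZl.
have -> : dot (orth_part u v) v = dot (orth_part u v) (orth_part u v).
  by rewrite [in RHS]/orth_part dotDr dotNr dotZr orth_part_dotu// mulr0 subr0.
by rewrite -sqr_enorm; field; rewrite gt_eqF// enorm_gt0.
Qed.

End DotProduct.

Section DualBasis.
Variable R : realType.

Definition gram (l1 l2 : 'rV[R]_3) : R := dot l1 l1 * dot l2 l2 - dot l1 l2 ^+ 2.
Definition dual1 (l1 l2 : 'rV[R]_3) : 'rV[R]_3 :=
  (gram l1 l2)^-1 *: (dot l2 l2 *: l1 - dot l1 l2 *: l2).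
Definition dual2 (l1 l2 : 'rV[R]_3) : 'rV[R]_3 :=
  (gram l1 l2)^-1 *: (dot l1 l1 *: l2 - dot l1 l2 *: l1).

Variables l1 l2 : 'rV[R]_3.
Hypothesis a0 : area_elt l1 l2 != 0.

Lemma gram_neq0 : gram l1 l2 != 0.
Proof. by rewrite /gram -sqr_area_elt sqrf_eq0. Qed.

Lemma dual11 : dot l1 (dual1 l1 l2) = 1.
Proof.
by have := gram_neq0; rewrite /dual1 !dotL /gram => g0; field.
Qed.
Lemma dual12 : dot l1 (dual2 l1 l2) = 0.
Proof.
by have := gram_neq0; rewrite /dual2 !dotL /gram => g0; field.
Qed.
Lemma dual21 : dot l2 (dual1 l1 l2) = 0.
Proof.
have := gram_neq0; rewrite /dual1 !dotL (dotC l2 l1) /gram => g0; field.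
by [].
Qed.
Lemma dual22 : dot l2 (dual2 l1 l2) = 1.
Proof.
have := gram_neq0; rewrite /dual2 !dotL (dotC l2 l1) /gram => g0; field.
by [].
Qed.

Definition dualE := (dual11, dual12, dual21, dual22).

(** Orthonormalising the legs gives two vectors of their plane, so that
projecting on them is the identity on that plane. *)
Lemma gram_schmidt_span (t1 := unitv l1) (t2 := unitv (orth_part l1 l2)) b1 b2 v :
  v = b1 *: l1 + b2 *: l2 -> dot t1 v *: t1 + dot t2 v *: t2 = v.
Proof.
have u0 := area_elt_neq0l a0; have o0 := orth_part_neq0 a0.
have t11 : dot t1 t1 = 1 by apply: unitv_dot.
have t22 : dot t2 t2 = 1 by apply: unitv_dot.
have t21 : dot t2 t1 = 0.
  by rewrite /t2 {1}/unitv dotZl orth_part_dotu// mulr0.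
have L1 : l1 = enorm l1 *: t1 by rewrite enorm_unitv.
have L2 : l2 = enorm (orth_part l1 l2) *: t2 + dot l2 t1 *: t1.
  by rewrite /t2 enorm_unitv /orth_part -/t1 subrK.
clearbody t1 t2 => vE.
have -> : v = (b1 * enorm l1 + b2 * dot l2 t1) *: t1 + (b2 * enorm (orth_part l1 l2)) *: t2.
  rewrite vE; transitivity (b1 *: (enorm l1 *: t1) +
    b2 *: (enorm (orth_part l1 l2) *: t2 + dot l2 t1 *: t1)).
    by rewrite -L1 -L2.
  by rewrite scalerDr !scalerA scalerDl addrA addrAC.
set c1 := b1 * _ + _; set c2 := b2 * _.
by rewrite !dotL t11 t22 t21 (dotC t1) t21 !mulr1 !mulr0 addr0 add0r.
Qed.

Lemma tau1_span : unitv l1 = dot (unitv l1) (dual1 l1 l2) *: l1 +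
                             dot (unitv l1) (dual2 l1 l2) *: l2.
Proof. by rewrite /unitv !dotZl dual11 dual12 mulr0 scale0r addr0 mulr1. Qed.

(** The dual basis reads off the coordinates of a vector of the plane. *)
Lemma span_dual v c1 c2 : v = c1 *: l1 + c2 *: l2 ->
  v = dot v (dual1 l1 l2) *: l1 + dot v (dual2 l1 l2) *: l2.
Proof.
by move=> ->; rewrite !(dotDl, dotZl) !dualE !mulr1 !mulr0 addr0 add0r.
Qed.

Lemma tau2_span : unitv (orth_part l1 l2) =
  dot (unitv (orth_part l1 l2)) (dual1 l1 l2) *: l1 +
  dot (unitv (orth_part l1 l2)) (dual2 l1 l2) *: l2.
Proof.
set o := orth_part l1 l2.
apply: (@span_dual _ (- ((enorm o)^-1 * dot l2 (unitv l1) * (enorm l1)^-1)) (enorm o)^-1).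
by rewrite {1}/unitv {2}/o /orth_part -/o scalerBr /unitv !scalerA addrC scaleNr.
Qed.

Lemma dot_span v w c1 c2 : v = c1 *: l1 + c2 *: l2 ->
  dot v w = dot v (dot w (dual1 l1 l2) *: l1 + dot w (dual2 l1 l2) *: l2).
Proof.
move=> ->; have g0 := gram_neq0.
rewrite /dual1 /dual2 !dotL (dotC w l1) (dotC w l2) (dotC l2 l1).
move: g0; rewrite /gram => g0.
by field.
Qed.

End DualBasis.

(** * Affine coordinates and conormals of a triangle *)

Section TriangleGeometry.
Variables (R : realType) (T : mesh R).
Implicit Types (K : tria T) (i : 'I_3) (p A : R * R) (r : R).

Definition cob1 K := dual1 (leg1 K) (leg2 K).
Definition cob2 K := dual2 (leg1 K) (leg2 K).

(** Affine coordinates of the orthogonal projection of a point on the plane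
of K: a left inverse of [tpt K] which is defined, and continuous, on all of
the space.  Functions given by polynomials on open triangles thereby extend
continuously, and their traces become values of the extension. *)
Definition coord K (x : 'rV[R]_3) : R * R :=
  (dot (x - base K) (cob1 K), dot (x - base K) (cob2 K)).

(** Side i of the reference triangle, in the direction of [side]. *)
Definition side_param i r : R * R :=
  if i == ord0 then (1 - r, r) else if i == ordS ord0 then (0, 1 - r) else (r, 0).

(** Up to the length of the side, the outward flux through side i of the
reference triangle. *)
Definition refflux i A : R :=
  if i == ord0 then A.1 + A.2 else if i == ordS ord0 then - A.1 else - A.2.

Lemma ord3P i : [\/ i = ord0, i = ordS ord0 | i = ordS (ordS ord0)].
Proof.
case: i => -[|[|[|//]]] h; [constructor 1|constructor 2|constructor 3]; exact/val_inj.
Qed.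

Lemma ordS3 : ordS (ordS (ordS ord0)) = ord0 :> 'I_3.
Proof. exact/val_inj. Qed.

Lemma coordK K p : area2 K != 0 -> coord K (tpt K p) = p.
Proof.
move=> a0; rewrite /coord /tpt; set x := _ - _.
have xE : x = p.1 *: leg1 K + p.2 *: leg2 K by rewrite /x -(addrA (base K)) [LHS]addrC addKr.
rewrite /cob1 /cob2; move: a0; rewrite /area2 => a0; rewrite {x}xE.
move: (leg1 K) (leg2 K) a0 => l l' a0.
rewrite !(dotDl, dotZl) !dualE//.
by rewrite !mulr1 !mulr0 addr0 add0r; case: p.
Qed.

Lemma side_tpt K i r : side_src (K, i) + r *: (side_tgt (K, i) - side_src (K, i))
  = tpt K (side_param i r).
Proof.
rewrite /side_src /side_tgt /tpt /side_param /= /leg1 /leg2 /base.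
case: (ord3P i) => -> /=; rewrite ?ordS3;
 move: (vtx K ord0) (vtx K (ordS ord0)) (vtx K (ordS (ordS ord0))) => v0 v1 v2;
 by apply/rowP => j; rewrite !mxE; ring.
Qed.

(** The first summand is tangent to the side S and carries no flux; the second
one has the height of the triangle as its component along the normal. *)
Lemma orth_flux (S V : 'rV[R]_3) a b : area_elt S V != 0 ->
  enorm S * dot (- unitv (orth_part S V)) (a *: S + b *: V) = - (area_elt S V * b).
Proof.
move=> a0; have S0 := area_elt_neq0l a0; have o0 := orth_part_neq0 a0.
rewrite dotNl dotDr !dotZr dot_unit_orth// {1}/unitv dotZl orth_part_dot//.
by rewrite -orth_part_norm//; ring.
Qed.

Lemma side_area K i : area_elt (side_tgt (K, i) - side_src (K, i))
    (vtx K i - side_src (K, i)) = area2 K.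
Proof.
rewrite /area2 /area_elt; congr Num.sqrt.
rewrite /leg1 /leg2 /base /side_tgt /side_src /=.
move: (ord3P i) => [] -> /=; rewrite ?ordS3;
 move: (vtx K ord0) (vtx K (ordS ord0)) (vtx K (ordS (ordS ord0))) => v0 v1 v2;
 by rewrite !dotL ?(dotC v1 v0) ?(dotC v2 v0) ?(dotC v2 v1); ring.
Qed.

Lemma conormal_flux K i A : area2 K != 0 ->
  enorm (side_tgt (K, i) - side_src (K, i)) *
    dot (conormal (K, i)) (A.1 *: leg1 K + A.2 *: leg2 K) = area2 K * refflux i A.
Proof.
move=> a0; set S := side_tgt _ - _; set V := vtx K i - side_src (K, i).
have aSV : area_elt S V != 0 by rewrite side_area.
have [a [b [E1 E2]]] : exists a b : R,
    A.1 *: leg1 K + A.2 *: leg2 K = a *: S + b *: V /\ refflux i A = - b.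
  rewrite /S /V /refflux /side_tgt /side_src /leg1 /leg2 /base /=.
  case: (ord3P i) => -> /=; rewrite ?ordS3.
  - exists A.2, (- (A.1 + A.2)); split; last by rewrite opprK.
    by apply/rowP => j; rewrite !mxE; ring.
  - exists (- A.1 - A.2), A.1; split => //.
    by apply/rowP => j; rewrite !mxE; ring.
  - by exists A.1, A.2.
by rewrite E1 E2 /conormal orth_flux// side_area mulrN.
Qed.

Lemma side_neq0 K i : area2 K != 0 -> side_tgt (K, i) - side_src (K, i) != 0.
Proof. by rewrite -(side_area K i) => /area_elt_neq0l. Qed.

Lemma conormal_unit K i : area2 K != 0 ->
  dot (conormal (K, i)) (conormal (K, i)) = 1.
Proof.
move=> a0; rewrite /conormal dotNl dotNr opprK unitv_dot// orth_part_neq0//.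
by rewrite side_area.
Qed.

Lemma conormal_span K i : area2 K != 0 ->
  exists c1 c2, conormal (K, i) = c1 *: leg1 K + c2 *: leg2 K.
Proof.
move=> a0; rewrite /conormal /orth_part /unitv.
set S := side_tgt _ - _; set V := vtx K i - side_src (K, i) => /=.
set c := (enorm (_ - _))^-1.
have E : - (c *: (V - dot V ((enorm S)^-1 *: S) *: ((enorm S)^-1 *: S))) =
  (- c) *: V + (c * dot V ((enorm S)^-1 *: S) * (enorm S)^-1) *: S.
  by rewrite scalerBr !scalerA opprB addrC scaleNr addrC.
rewrite E; move: (- c) (c * _ * _) => a b {E c}.
rewrite /S /V /leg1 /leg2 /base /side_tgt /side_src /=.
case: (ord3P i) => -> /=; rewrite ?ordS3.
- exists (- a - b), b; apply/rowP => j; rewrite !mxE; ring.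
- exists a, (- a - b); apply/rowP => j; rewrite !mxE; ring.
- exists b, a; apply/rowP => j; rewrite !mxE; ring.
Qed.

(** The conormal lies in the plane of K, so only the contravariant
coordinates of a vector contribute to its flux. *)
Lemma side_flux K i (v : 'rV[R]_3) : area2 K != 0 ->
  enorm (side_tgt (K, i) - side_src (K, i)) * dot (conormal (K, i)) v =
  area2 K * refflux i (dot v (cob1 K), dot v (cob2 K)).
Proof.
move=> a0; have [c1 [c2 E]] := conormal_span i a0.
by rewrite -conormal_flux//= (dot_span a0 v E).
Qed.

Lemma refflux_lin i (f : R) A : refflux i (f * A.1, f * A.2) = f * refflux i A.
Proof. by rewrite /refflux; case: ifP => _ /=; [ring|case: ifP => _; ring]. Qed.

(** [tgrad] and [tdiv] only use that (tau1, tau2) is an orthonormal basis of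
the plane of K, so they have the usual expressions in affine coordinates. *)
Lemma grad_dual K (d1 d2 : R) : area2 K != 0 ->
  (dot (tau1 K) (cob1 K) * d1 + dot (tau1 K) (cob2 K) * d2) *: tau1 K +
  (dot (tau2 K) (cob1 K) * d1 + dot (tau2 K) (cob2 K) * d2) *: tau2 K =
  d1 *: cob1 K + d2 *: cob2 K.
Proof.
move=> a0.
have E1 := @gram_schmidt_span R (leg1 K) (leg2 K) a0
  (dot (leg2 K) (leg2 K) / gram (leg1 K) (leg2 K))
  (- dot (leg1 K) (leg2 K) / gram (leg1 K) (leg2 K)) (cob1 K).
have E2 := @gram_schmidt_span R (leg1 K) (leg2 K) a0
  (- dot (leg1 K) (leg2 K) / gram (leg1 K) (leg2 K))
  (dot (leg1 K) (leg1 K) / gram (leg1 K) (leg2 K)) (cob2 K).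
rewrite -[in RHS]E1; last first.
  rewrite /cob1 /dual1 scalerBr !scalerA -scaleNr; congr (_ *: _ + _ *: _); ring.
rewrite -[in RHS]E2; last first.
  rewrite /cob2 /dual2 scalerBr !scalerA -scaleNr addrC; congr (_ *: _ + _ *: _); ring.
rewrite -/(tau1 K) -/(tau2 K) !scalerDr !scalerDl !scalerA addrACA.
by congr (_ *: _ + _ *: _ + (_ *: _ + _ *: _)); ring.
Qed.

Lemma tau1_coord K : area2 K != 0 ->
  tau1 K = dot (tau1 K) (cob1 K) *: leg1 K + dot (tau1 K) (cob2 K) *: leg2 K.
Proof. by move=> a0; exact: tau1_span. Qed.

Lemma tau2_coord K : area2 K != 0 ->
  tau2 K = dot (tau2 K) (cob1 K) *: leg1 K + dot (tau2 K) (cob2 K) *: leg2 K.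
Proof. by move=> a0; exact: tau2_span. Qed.

End TriangleGeometry.

(** * Continuously differentiable functions of two variables *)

Section C1Functions.
Variable R : realType.
Implicit Types (f g : R * R -> R) (p v : R * R).

(** The partial derivatives are arguments, so that integrals can name them; a
total differential, rather than the two partial derivatives alone, makes the
class stable under composition. *)
Definition C1 f d1f d2f :=
  [/\ forall p, is_diff p f (fun v => v.1 * d1f p + v.2 * d2f p),
      continuous d1f & continuous d2f].

Lemma C1_continuous f d1f d2f : C1 f d1f d2f -> continuous f.
Proof.
by move=> [df _ _] p; apply: differentiable_continuous; case: (df p).
Qed.

Lemma C1_is_derive f d1f d2f : C1 f d1f d2f ->
  forall p v, is_derive p v f (v.1 * d1f p + v.2 * d2f p).
Proof.
move=> [df _ _] p v; have [dfp dE] := df p.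
have := diff_derivable (v := v) dfp => /derivableP; rewrite deriveE// dE.
by [].
Qed.

Lemma C1_eq f d1f d2f g1 g2 : C1 f d1f d2f -> g1 = d1f -> g2 = d2f -> C1 f g1 g2.
Proof. by move=> H -> ->. Qed.

Lemma C1_cst (c : R) : C1 (fun=> c) (fun=> 0) (fun=> 0).
Proof.
split; [move=> p|exact: cst_continuous|exact: cst_continuous].
apply: (is_diff_eq (is_diff_cst c p)).
by apply/funext => v /=; rewrite !mulr0 addr0.
Qed.

Lemma continuous_fst : continuous (fst : R * R -> R).
Proof. by move=> p; exact: cvg_fst. Qed.
Lemma continuous_snd : continuous (snd : R * R -> R).
Proof. by move=> p; exact: cvg_snd. Qed.

Lemma C1_fst : C1 fst (fun=> 1) (fun=> 0).
Proof.
split; [move=> p|exact: cst_continuous|exact: cst_continuous].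
apply: (is_diff_eq (f' := fst)); last first.
  by apply/funext => v /=; rewrite mulr0 addr0 mulr1.
apply: DiffDef.
  exact: (@linear_differentiable _ _ _ (@fst R R) p continuous_fst).
exact: (@diff_lin _ _ _ (@fst R R) p continuous_fst).
Qed.

Lemma C1_snd : C1 snd (fun=> 0) (fun=> 1).
Proof.
split; [move=> p|exact: cst_continuous|exact: cst_continuous].
apply: (is_diff_eq (f' := snd)); last first.
  by apply/funext => v /=; rewrite mulr0 add0r mulr1.
apply: DiffDef.
  exact: (@linear_differentiable _ _ _ (@snd R R) p continuous_snd).
exact: (@diff_lin _ _ _ (@snd R R) p continuous_snd).
Qed.

Lemma C1_add f d1f d2f g d1g d2g : C1 f d1f d2f -> C1 g d1g d2g ->
  C1 (fun p => f p + g p) (fun p => d1f p + d1g p) (fun p => d2f p + d2g p).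
Proof.
move=> [df c1 c2] [dg e1 e2]; split.
- move=> p; have Hf := df p; have Hg := dg p.
  apply: (is_diff_eq (f := f + g)).
  by apply/funext => v /=; rewrite !fctE; ring.
- by move=> p; apply: cvgD; [exact: c1|exact: e1].
- by move=> p; apply: cvgD; [exact: c2|exact: e2].
Qed.

Lemma C1_mul f d1f d2f g d1g d2g : C1 f d1f d2f -> C1 g d1g d2g ->
  C1 (fun p => f p * g p) (fun p => d1f p * g p + f p * d1g p)
     (fun p => d2f p * g p + f p * d2g p).
Proof.
move=> Cf Cg; have cf := C1_continuous Cf; have cg := C1_continuous Cg.
move: Cf Cg => [df c1 c2] [dg e1 e2]; split.
- move=> p; have Hf := df p; have Hg := dg p.
  apply: (is_diff_eq (f := f * g)).
  by apply/funext => v /=; rewrite !fctE /GRing.scale/=; ring.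
- by move=> p; apply: cvgD; apply: cvgM; [exact: c1|exact: cg|exact: cf|exact: e1].
- by move=> p; apply: cvgD; apply: cvgM; [exact: c2|exact: cg|exact: cf|exact: e2].
Qed.

Lemma C1_comp f d1f d2f (G G' : R -> R) : C1 f d1f d2f ->
  (forall x : R, is_derive x 1 G (G' x)) -> continuous G' ->
  C1 (fun p => G (f p)) (fun p => G' (f p) * d1f p) (fun p => G' (f p) * d2f p).
Proof.
move=> Cf dG cG; have cf := C1_continuous Cf; have [df c1 c2] := Cf.
have cGf : continuous (fun p => G' (f p)).
  by move=> p; apply: continuous_comp; [exact: cf|exact: cG].
split; [|by move=> p; apply: cvgM; [exact: cGf|exact: c1]
        |by move=> p; apply: cvgM; [exact: cGf|exact: c2]].
move=> p; have Hf := df p; have [dGp GE] := dG (f p).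
have HG : is_diff (f p) G ( *:%R^~ (G' (f p))).
  apply: DiffDef; first exact/derivable1_diffP.
  by rewrite deriv1E// derive1E GE.
apply: (is_diff_eq (f := G \o f)).
by apply/funext => v /=; rewrite /GRing.scale/=; ring.
Qed.

Lemma C1_sum (I : Type) (s : seq I) (P : pred I) (f d1f d2f : I -> R * R -> R) :
  (forall i, C1 (f i) (d1f i) (d2f i)) ->
  C1 (fun p => \sum_(i <- s | P i) f i p) (fun p => \sum_(i <- s | P i) d1f i p)
     (fun p => \sum_(i <- s | P i) d2f i p).
Proof.
move=> H; elim: s => [|i s IH].
  have E (h : I -> R * R -> R) : (fun p => \sum_(i <- [::] | P i) h i p) = fun=> 0.
    by apply/funext => p; exact: big_nil.
  by rewrite !E; exact: C1_cst.
have E (h : I -> R * R -> R) : (fun p => \sum_(j <- i :: s | P j) h j p) =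
    (fun p => (if P i then h i p else 0) + \sum_(j <- s | P j) h j p).
  apply/funext => p; apply: (etrans (big_cons _ _ _ _ _ _)).
  by case: ifP; rewrite ?add0r.
rewrite !E.
by apply: C1_add IH; case: (P i); [exact: H|exact: C1_cst].
Qed.

Lemma C1_exp f d1f d2f n : C1 f d1f d2f -> exists d1 d2, C1 (fun p => f p ^+ n) d1 d2.
Proof.
move=> Cf; elim: n => [|n [d1 [d2 IH]]].
  by exists (fun=> 0), (fun=> 0); exact: (C1_cst 1).
do 2 eexists; have := C1_mul Cf IH.
have -> : (fun p => f p * f p ^+ n) = (fun p => f p ^+ n.+1).
  by apply/funext => p; rewrite exprS.
exact.
Qed.

Lemma C1_lin (a b c : R) :
  C1 (fun p => a + p.1 * b + p.2 * c) (fun=> b) (fun=> c).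
Proof.
apply: (C1_eq (C1_add (C1_add (C1_cst a) (C1_mul C1_fst (C1_cst b)))
  (C1_mul C1_snd (C1_cst c)))); apply/funext => p; ring.
Qed.

(** Directional derivatives along the axes, in the form used to integrate
along rows and columns. *)
Lemma C1_partial1 f d1f d2f y : C1 f d1f d2f ->
  forall x : R, is_derive x 1 (fun x => f (x, y)) (d1f (x, y)).
Proof.
move=> Cf x; have [Df DE] := C1_is_derive Cf (x, y) (1, 0).
have E : (fun h : R => h^-1 *: (f (h *: (1, 0) + (x, y)) - f (x, y))) =
  (fun h : R => h^-1 *: (f (h *: 1 + x, y) - f (x, y))).
  apply/funext => h; congr (_ *: (f _ - _)).
  by rewrite (_ : _ + _ = (h *: 1 + x, h *: 0 + y))// scaler0 add0r.
split; first by move: Df; rewrite /derivable E.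
by move: DE; rewrite /derive E /= mul1r mul0r addr0.
Qed.

Lemma C1_partial2 f d1f d2f x : C1 f d1f d2f ->
  forall y : R, is_derive y 1 (fun y => f (x, y)) (d2f (x, y)).
Proof.
move=> Cf y; have [Df DE] := C1_is_derive Cf (x, y) (0, 1).
have E : (fun h : R => h^-1 *: (f (h *: (0, 1) + (x, y)) - f (x, y))) =
  (fun h : R => h^-1 *: (f (x, h *: 1 + y) - f (x, y))).
  apply/funext => h; congr (_ *: (f _ - _)).
  by rewrite (_ : _ + _ = (h *: 0 + x, h *: 1 + y))// scaler0 add0r.
split; first by move: Df; rewrite /derivable E.
by move: DE; rewrite /derive E /= mul1r mul0r add0r.
Qed.

(** The polynomial extends from the open reference triangle to the whole
plane. *)
Lemma is_poly_C1 (T : mesh R) k (K : tria T) u : is_poly k K u ->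
  exists P d1 d2, C1 P d1 d2 /\ forall p, ref_tri p -> u (tpt K p) = P p.
Proof.
move=> [c cE].
pose P p : R := \sum_(i < k.+1) \sum_(j < (k - i).+1) c i j * p.1 ^+ i * p.2 ^+ j.
suff [d1 [d2 CP]] : exists d1 d2, C1 P d1 d2 by exists P, d1, d2.
have mono i j : exists d : (R * R -> R) * (R * R -> R),
    C1 (fun p => c i j * p.1 ^+ i * p.2 ^+ j) d.1 d.2.
  have [a1 [a2 A]] := C1_exp i C1_fst; have [b1 [b2 B]] := C1_exp j C1_snd.
  by eexists (_, _); exact: C1_mul (C1_mul (C1_cst (c i j)) A) B.
have [D DE] := choice (fun ij : nat * nat => mono ij.1 ij.2).
do 2 eexists; apply: C1_sum => i; apply: C1_sum => j; exact: (DE (i : nat, j : nat)).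
Qed.

End C1Functions.

(** * Integration on the reference triangle *)

Section ContinuousAlgebra.
Variables (R : realType) (X : topologicalType).
Implicit Types f g : X -> R.

(** The continuity lemmas are stated for whole functions, so that continuity of
a long expression is a proof term which mirrors that expression. *)
Lemma contC (c : R) : continuous (fun _ : X => c).
Proof. by move=> x; exact: cvg_cst. Qed.

Lemma contD f g : continuous f -> continuous g -> continuous (fun x => f x + g x).
Proof. by move=> cf cg x; exact: cvgD (cf x) (cg x). Qed.

Lemma contB f g : continuous f -> continuous g -> continuous (fun x => f x - g x).
Proof. by move=> cf cg x; exact: cvgB (cf x) (cg x). Qed.

Lemma contN f : continuous f -> continuous (fun x => - f x).
Proof. by move=> cf x; exact: cvgN (cf x). Qed.

Lemma contM f g : continuous f -> continuous g -> continuous (fun x => f x * g x).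
Proof. by move=> cf cg x; exact: cvgM (cf x) (cg x). Qed.

Lemma cont_comp (Y Z : topologicalType) (f : Y -> Z) (g : X -> Y) :
  continuous f -> continuous g -> continuous (fun x => f (g x)).
Proof. by move=> cf cg x; apply: continuous_comp; [exact: cg|exact: cf]. Qed.

Lemma cont_sum (I : Type) (s : seq I) (P : pred I) (f : I -> X -> R) :
  (forall i, continuous (f i)) -> continuous (fun x => \sum_(i <- s | P i) f i x).
Proof.
move=> cf; elim: s => [|i s IH].
  rewrite (_ : (fun _ => _) = (fun=> 0)); first exact: contC.
  by apply/funext => x; exact: big_nil.
rewrite (_ : (fun _ => _) = (fun x => (if P i then f i x else 0) +
  \sum_(j <- s | P j) f j x)).
  by apply: contD IH; case: (P i); [exact: cf|exact: contC].
apply/funext => x; apply: (etrans (big_cons _ _ _ _ _ _)).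
by case: ifP; rewrite ?add0r.
Qed.

End ContinuousAlgebra.
Arguments contC {R X} c x.
Arguments contD {R X f g} cf cg x.
Arguments contB {R X f g} cf cg x.
Arguments contN {R X f} cf x.
Arguments contM {R X f g} cf cg x.
Arguments cont_comp {X Y Z f g} cf cg x.
Arguments cont_sum {R X I s P f} cf x.

Lemma cont_id (X : topologicalType) : continuous (fun x : X => x).
Proof. by move=> x; exact: cvg_id. Qed.
Arguments cont_id {X} x.

Section PlaneMeasure.
Variable R : realType.
Local Notation mu := (@lebesgue_measure R).
Local Notation RR := (measurableTypeR R * measurableTypeR R)%type.

(** An open set of the plane is a countable union of open boxes with rational
sides, hence it belongs to the product sigma-algebra. *)
Lemma open_measurable2 (U : set (R * R)) : open U -> measurable (U : set RR).
Proof.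
move=> oU.
pose box (a b c d : rat) : set (R * R) :=
  `]ratr a, ratr b[%classic `*` `]ratr c, ratr d[%classic.
pose F a b c d := if `[< box a b c d `<=` U >] then box a b c d else set0.
have -> : U = \bigcup_a \bigcup_b \bigcup_c \bigcup_d F a b c d.
  apply/seteqP; split; last first.
    move=> p [a _ [b _ [c _ [d _]]]]; rewrite /F.
    by case: ifPn => // /asboolP; exact.
  move=> [x y] Uxy; have := oU _ Uxy => /nbhs_ballP[e /= e0 eU].
  have /rat_in_itvoo[a] : x - e < x by rewrite ltrBlDr ltrDl.
  have /rat_in_itvoo[b] : x < x + e by rewrite ltrDl.
  have /rat_in_itvoo[c] : y - e < y by rewrite ltrBlDr ltrDl.
  have /rat_in_itvoo[d] : y < y + e by rewrite ltrDl.
  rewrite !in_itv/= => /andP[d1 d2] /andP[c1 c2] /andP[b1 b2] /andP[a1 a2].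
  exists a => //; exists b => //; exists c => //; exists d => //.
  rewrite /F ifT; first by split; rewrite /= in_itv/=; apply/andP.
  apply/asboolP => -[x' y'] [/=]; rewrite !in_itv/= => /andP[x1 x2] /andP[y1 y2].
  apply: eU; split => /=; rewrite /ball/= ltr_distlC; apply/andP; split; lra.
do 4 (apply: bigcupT_measurable_rat => ?).
by rewrite /F; case: ifP => // _; apply: measurableX; exact: measurable_itv.
Qed.

Lemma continuous_measurable2 (f : R * R -> R) :
  continuous f -> measurable_fun setT (f : RR -> R).
Proof.
move=> /continuousP cf; apply: (measurability _ (measurable_realfun.RGenOpens.measurableE R)).
move=> _ [_ [a [b ->] <-]]; rewrite setTI; apply: open_measurable2.
exact/cf/interval_open.
Qed.

Lemma open_ref_tri : open (@ref_tri R).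
Proof.
have -> : @ref_tri R = [set p | 0 < p.1] `&` [set p | 0 < p.2] `&`
    [set p | p.1 + p.2 < 1].
  by apply/seteqP; split => [p [? ? ?]|p [[? ?] ?]].
apply: openI; [apply: openI|].
- by apply: (@open_comp _ _ fst [set x : R | 0 < x]); [move=> p _; exact: cvg_fst|exact: open_gt].
- by apply: (@open_comp _ _ snd [set x : R | 0 < x]); [move=> p _; exact: cvg_snd|exact: open_gt].
- apply: (@open_comp _ _ (fun p : R * R => p.1 + p.2) [set x : R | x < 1]); last exact: open_lt.
  by move=> p _; apply: cvgD; [exact: cvg_fst|exact: cvg_snd].
Qed.

Lemma measurable_ref_tri : measurable (@ref_tri R : set RR).
Proof. by apply: open_measurable2; exact: open_ref_tri. Qed.

Lemma ref_tri_unit : @ref_tri R `<=` `[0, 1]%classic `*` `[0, 1]%classic.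
Proof. by move=> [x y] [/= *]; split; rewrite /= in_itv/=; apply/andP; split; lra. Qed.

Lemma lebesgue2_ref_tri : (lebesgue2 (@ref_tri R) < +oo)%E.
Proof.
apply: (@le_lt_trans _ _ (lebesgue2 (`[0%R, 1%R]%classic `*` `[0%R, 1%R]%classic))).
  apply: le_measure; rewrite ?inE; [exact: measurable_ref_tri| |exact: ref_tri_unit].
  by apply: measurableX; exact: measurable_itv.
rewrite /lebesgue2 product_measure1E; [|exact: measurable_itv|exact: measurable_itv].
change (mu `[0%R, 1%R]%classic * mu `[0%R, 1%R]%classic < +oo)%E.
by rewrite lebesgue_measure_itv/= lte01 oppr0 adde0 mule1 ltry.
Qed.

Lemma continuous_bounded_ref (f : R * R -> R) : continuous f ->
  exists M, forall p, @ref_tri R p -> `|f p| <= M.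
Proof.
move=> cf.
have cpt : compact (`[0 : R, 1]%classic `*` `[0 : R, 1]%classic).
  by apply: compact_setX; exact: segment_compact.
have /compact_bounded[M [_ HM]] := @continuous_compact _ _ f _
  (continuous_subspaceT cf) cpt.
exists (M + 1) => p rp; apply: HM; first by rewrite ltrDl.
by exists p => //; exact: ref_tri_unit.
Qed.

Lemma bounded_integrable_ref (f : R * R -> R) M :
  measurable_fun (@ref_tri R : set RR) (f : RR -> R) -> (forall p, @ref_tri R p -> `|f p| <= M) ->
  (@lebesgue2 R).-integrable (@ref_tri R) (EFin \o f).
Proof.
move=> mf fM; apply: measurable_bounded_integrable.
- exact: measurable_ref_tri.
- exact: lebesgue2_ref_tri.
- exact: mf.
- exists M; split; first exact: num_real.
  by move=> x Mx p rp; apply: le_trans (fM _ rp) (ltW Mx).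
Qed.

Lemma continuous_integrable_ref (f : R * R -> R) : continuous f ->
  (@lebesgue2 R).-integrable (@ref_tri R) (EFin \o f).
Proof.
move=> cf; have [M fM] := continuous_bounded_ref cf.
apply: (bounded_integrable_ref (M := M)) => //.
by apply: measurable_funTS; exact: continuous_measurable2.
Qed.

Lemma continuous_int01 (f : R -> R) : continuous f ->
  mu.-integrable `[0, 1]%classic (EFin \o f).
Proof.
move=> cf; apply: continuous_compact_integrable; first exact: segment_compact.
exact: continuous_subspaceT.
Qed.

Lemma C1_FTC (F f : R -> R) (a b : R) : a <= b ->
  (forall x : R, is_derive x 1 F (f x)) -> continuous f ->
  (\int[mu]_(x in `]a, b[) (f x)%:E = (F b - F a)%:E)%E.
Proof.
rewrite le_eqVlt => /predU1P[<-|ab] dF cf.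
  by rewrite set_itvE integral_set0 subrr.
rewrite -(@integral_itv_bndoo _ _ _ _ true false); last first.
  by apply/measurable_EFinP; apply: measurable_funTS; exact: continuous_measurable_fun.
have cF : continuous F.
  by move=> x; apply: differentiable_continuous; apply/derivable1_diffP; case: (dF x).
rewrite (@continuous_FTC2 _ f F) ?EFinB//.
- exact: continuous_subspaceT.
- split; first by move=> x _; case: (dF x).
  + by apply: cvg_at_right_filter; exact: cF.
  + by apply: cvg_at_left_filter; exact: cF.
- by move=> x _; rewrite derive1E; case: (dF x).
Qed.

(** Both orders of integration are used: each integrates one of the two partial
derivatives exactly. *)
Lemma fubini_ref1 (f : R * R -> R) : continuous f ->
  (\int[@lebesgue2 R]_(p in @ref_tri R) (f p)%:E =
   \int[mu]_(x in `]0%R, 1%R[) \int[mu]_(y in `]0%R, (1 - x)%R[) (f (x, y))%:E)%E.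
Proof.
move=> cf; rewrite integral_mkcond.
have If := (integrable_mkcond _ measurable_ref_tri).1 (continuous_integrable_ref cf).
rewrite -(integral12_prod_meas1 If) [RHS]integral_mkcond.
apply: eq_integral => x _; rewrite /fubini_F patchE; case: ifPn => [|x01].
  rewrite inE/= in_itv/= => /andP[x0 x1]; rewrite [RHS]integral_mkcond.
  apply: eq_integral => y _; rewrite !patchE; congr (if _ then _ else _).
  apply/idP/idP; rewrite !inE/= in_itv/=.
    by move=> [/= *]; apply/andP; split; lra.
  by move=> /andP[? ?]; split => /=; lra.
apply: integral0_eq => y _; rewrite patchE; case: ifPn => //.
rewrite inE => -[/= ? ? ?]; move: x01; rewrite notin_setE/= in_itv/= => -[].
by apply/andP; split; lra.
Qed.

Lemma fubini_ref2 (f : R * R -> R) : continuous f ->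
  (\int[@lebesgue2 R]_(p in @ref_tri R) (f p)%:E =
   \int[mu]_(y in `]0%R, 1%R[) \int[mu]_(x in `]0%R, (1 - y)%R[) (f (x, y))%:E)%E.
Proof.
move=> cf; rewrite integral_mkcond.
have If := (integrable_mkcond _ measurable_ref_tri).1 (continuous_integrable_ref cf).
rewrite -(integral21_prod_meas1 If) [RHS]integral_mkcond.
apply: eq_integral => y _; rewrite /fubini_G patchE; case: ifPn => [|y01].
  rewrite inE/= in_itv/= => /andP[y0 y1]; rewrite [RHS]integral_mkcond.
  apply: eq_integral => x _; rewrite !patchE; congr (if _ then _ else _).
  apply/idP/idP; rewrite !inE/= in_itv/=.
    by move=> [/= *]; apply/andP; split; lra.
  by move=> /andP[? ?]; split => /=; lra.
apply: integral0_eq => x _; rewrite patchE; case: ifPn => //.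
rewrite inE => -[/= ? ? ?]; move: y01; rewrite notin_setE/= in_itv/= => -[].
by apply/andP; split; lra.
Qed.

Lemma Rintegral_oo01 (f : R -> R) : continuous f ->
  \int[mu]_(x in `]0, 1[) f x = \int[mu]_(x in `[0, 1]) f x.
Proof.
move=> cf; rewrite /Rintegral -(@integral_itv_bndoo _ 0 1 (EFin \o f) true false)//.
by apply/measurable_EFinP; apply: measurable_funTS; exact: continuous_measurable_fun.
Qed.

Lemma continuous_line (F : R * R -> R) (x0 x1 y0 y1 : R) : continuous F ->
  continuous (fun s : R => F (x0 + x1 * s, y0 + y1 * s)).
Proof.
move=> cF s; apply: (@continuous_comp _ _ _ (fun s => (x0 + x1 * s, y0 + y1 * s))); last exact: cF.
apply: (@cvg_pair _ _ _ (nbhs s) (nbhs (x0 + x1 * s)) (nbhs (y0 + y1 * s))).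
- exact: (contD (contC x0) (contM (contC x1) cont_id)).
- exact: (contD (contC y0) (contM (contC y1) cont_id)).
Qed.

Lemma continuous_hypotenuse (F : R * R -> R) : continuous F ->
  continuous (fun s : R => F (1 - s, s)).
Proof.
move=> cF; rewrite (_ : (fun _ => _) = (fun s => F (1 + (-1) * s, 0 + 1 * s))).
  exact: continuous_line.
by apply/funext => s; congr (F (_, _)); ring.
Qed.

Lemma continuous_hypotenuse_rev (F : R * R -> R) : continuous F ->
  continuous (fun s : R => F (s, 1 - s)).
Proof.
move=> cF; rewrite (_ : (fun _ => _) = (fun s => F (0 + 1 * s, 1 + (-1) * s))).
  exact: continuous_line.
by apply/funext => s; congr (F (_, _)); ring.
Qed.

Lemma continuous_row (F : R * R -> R) (y : R) : continuous F ->
  continuous (fun x : R => F (x, y)).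
Proof.
move=> cF; rewrite (_ : (fun _ => _) = (fun s => F (0 + 1 * s, y + 0 * s))).
  exact: continuous_line.
by apply/funext => s; congr (F (_, _)); ring.
Qed.

Lemma continuous_col (F : R * R -> R) (x : R) : continuous F ->
  continuous (fun y : R => F (x, y)).
Proof.
move=> cF; rewrite (_ : (fun _ => _) = (fun s => F (x + 0 * s, 0 + 1 * s))).
  exact: continuous_line.
by apply/funext => s; congr (F (_, _)); ring.
Qed.

Lemma continuous_onem (f : R -> R) : continuous f ->
  continuous (fun s : R => f (1 - s)).
Proof. by move=> cf; exact: (cont_comp cf (contB (contC 1) cont_id)). Qed.

(** The two triangles sharing an edge may traverse it in opposite directions. *)
Lemma Rintegral_onem (f : R -> R) : continuous f ->
  \int[mu]_(x in `[0, 1]) f (1 - x) = \int[mu]_(x in `[0, 1]) f x.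
Proof.
move=> cf; rewrite [RHS]Rintegration_by_substitution_onem ?lexx ?ler01//.
  by rewrite /unstable.onem subrr.
exact: continuous_subspaceT.
Qed.

Lemma ref_int_d1 F d1 d2 : C1 F d1 d2 ->
  \int[@lebesgue2 R]_(p in @ref_tri R) d1 p =
  \int[mu]_(s in `[0, 1]) (F (1 - s, s) - F (0, s)).
Proof.
move=> CF; have [_ c1 _] := CF; have cF := C1_continuous CF.
rewrite -Rintegral_oo01; last first.
  move=> s; exact: (contB (continuous_hypotenuse cF) (continuous_col (x := 0) cF)).
rewrite /Rintegral fubini_ref2//; congr fine; apply: eq_integral => y.
rewrite inE/= in_itv/= => /andP[y0 y1].
have y1' : 0 <= 1 - y by lra.
exact: (C1_FTC y1' (C1_partial1 y CF) (@continuous_row _ y c1)).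
Qed.

Lemma ref_int_d2 F d1 d2 : C1 F d1 d2 ->
  \int[@lebesgue2 R]_(p in @ref_tri R) d2 p =
  \int[mu]_(s in `[0, 1]) (F (s, 1 - s) - F (s, 0)).
Proof.
move=> CF; have [_ _ c2] := CF; have cF := C1_continuous CF.
rewrite -Rintegral_oo01; last first.
  move=> s; exact: (contB (continuous_hypotenuse_rev cF) (continuous_row (y := 0) cF)).
rewrite /Rintegral fubini_ref1//; congr fine; apply: eq_integral => x.
rewrite inE/= in_itv/= => /andP[x0 x1].
have x1' : 0 <= 1 - x by lra.
exact: (C1_FTC x1' (C1_partial2 x CF) (@continuous_col _ x c2)).
Qed.

Lemma continuous_side_param i (F : R * R -> R) : continuous F ->
  continuous (fun s : R => F (side_param i s)).
Proof.
move=> cF; rewrite /side_param; case: (i == ord0); first exact: continuous_hypotenuse.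
case: (i == ordS ord0); last exact: continuous_row.
exact: (@continuous_onem (fun s => F (0, s)) (continuous_col cF)).
Qed.

Lemma Rintegral01D (f g : R -> R) : continuous f -> continuous g ->
  \int[mu]_(x in `[0, 1]) (f x + g x) =
  \int[mu]_(x in `[0, 1]) f x + \int[mu]_(x in `[0, 1]) g x.
Proof.
by move=> cf cg; rewrite RintegralD//; exact: continuous_int01.
Qed.

Lemma Rintegral01B (f g : R -> R) : continuous f -> continuous g ->
  \int[mu]_(x in `[0, 1]) (f x - g x) =
  \int[mu]_(x in `[0, 1]) f x - \int[mu]_(x in `[0, 1]) g x.
Proof.
by move=> cf cg; rewrite RintegralB//; exact: continuous_int01.
Qed.

Lemma Rintegral01Z (c : R) (f : R -> R) : continuous f ->
  \int[mu]_(x in `[0, 1]) (c * f x) = c * \int[mu]_(x in `[0, 1]) f x.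
Proof.
by move=> cf; rewrite RintegralZl//; exact: continuous_int01.
Qed.

Lemma Rintegral_refD (f g : R * R -> R) : continuous f -> continuous g ->
  \int[@lebesgue2 R]_(p in @ref_tri R) (f p + g p) =
  \int[@lebesgue2 R]_(p in @ref_tri R) f p + \int[@lebesgue2 R]_(p in @ref_tri R) g p.
Proof.
move=> cf cg; rewrite RintegralD//; first exact: measurable_ref_tri.
  exact: continuous_integrable_ref.
exact: continuous_integrable_ref.
Qed.

Lemma Rintegral_refZ (c : R) (f : R * R -> R) : continuous f ->
  \int[@lebesgue2 R]_(p in @ref_tri R) (c * f p) =
  c * \int[@lebesgue2 R]_(p in @ref_tri R) f p.
Proof.
move=> cf; rewrite RintegralZl//; first exact: measurable_ref_tri.
exact: continuous_integrable_ref.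
Qed.

(** Each partial derivative is integrated along the lines of its variable; the
hypotenuse receives both components.  The parametrization of a leg may run
backwards, which does not change the integral. *)
Lemma divergence_ref F G a1 a2 b1 b2 : C1 F a1 a2 -> C1 G b1 b2 ->
  \int[@lebesgue2 R]_(p in @ref_tri R) (a1 p + b2 p) =
  \sum_(i : 'I_3) \int[mu]_(s in `[0, 1]) refflux i (F (side_param i s), G (side_param i s)).
Proof.
move=> C1F C1G; have cF := C1_continuous C1F; have cG := C1_continuous C1G.
have [_ ca1 _] := C1F; have [_ _ cb2] := C1G.
rewrite Rintegral_refD// (ref_int_d1 C1F) (ref_int_d2 C1G).
rewrite Rintegral01B; [|exact: continuous_hypotenuse|exact: continuous_col].
rewrite Rintegral01B; [|exact: continuous_hypotenuse_rev|exact: continuous_row].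
rewrite !big_ord_recl big_ord0 addr0 /refflux /side_param /=.
rewrite Rintegral01D; [|exact: continuous_hypotenuse|exact: continuous_hypotenuse].
have E (f : R -> R) : continuous f ->
    \int[mu]_(x in `[0, 1]) - f x = - \int[mu]_(x in `[0, 1]) f x.
  by move=> cf; rewrite -mulN1r -Rintegral01Z//; apply: eq_Rintegral => x _; rewrite mulN1r.
rewrite !E; [|exact: continuous_row|exact: (continuous_onem (continuous_col cF))].
rewrite (Rintegral_onem (continuous_col cF)).
rewrite -(Rintegral_onem (continuous_hypotenuse cG)).
have -> : \int[mu]_(x in `[0, 1]) G (1 - (1 - x), 1 - x) =
  \int[mu]_(x in `[0, 1]) G (x, 1 - x).
  by apply: eq_Rintegral => x _; rewrite subKr.
by ring.
Qed.

End PlaneMeasure.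

(** * Traces, gradients and the divergence theorem on a triangle *)

Section AffineCoordinates.
Variables (R : realType) (T : mesh R).
Implicit Types (K : tria T) (i : 'I_3) (p t : R * R) (x : 'rV[R]_3).

Lemma cont_dot (X : topologicalType) (f : X -> 'rV[R]_3) (b : 'rV[R]_3) :
  (forall j, continuous (fun x : X => f x 0 j)) -> continuous (fun x : X => dot (f x) b).
Proof.
move=> cf; rewrite (_ : (fun _ => _) = (fun x : X => \sum_j f x 0 j * b 0 j)).
  by apply: cont_sum => j; exact: (contM (cf j) (contC (b 0 j))).
by apply/funext => x; rewrite dotE.
Qed.

Lemma cont_coordinate (j : 'I_3) : continuous (fun x : 'rV[R]_3 => x 0 j).
Proof. exact: coord_continuous. Qed.
Arguments cont_coordinate : clear implicits.

(** The topology of row vectors is the product topology. *)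
Lemma cont_rV (X : topologicalType) (f : X -> 'rV[R]_3) :
  (forall j, continuous (fun x : X => f x 0 j)) -> continuous f.
Proof.
move=> cf x; apply/cvgrPdist_le => /= e e0; near=> y.
rewrite [leLHS]/Num.Def.normr/= mx_normrE (bigmax_le _ (ltW e0))//= => -[i j] _.
rewrite !mxE/= (ord1 i); move: j; near: y; apply: filter_forall => j.
exact: ((cvgrPdist_le _ _).1 (cf j x)).
Unshelve. all: by end_near. Qed.

Lemma continuous_coord K : continuous (coord K).
Proof.
have c b : continuous (fun x => dot (x - base K) b).
  apply: cont_dot => j; rewrite (_ : (fun _ => _) = (fun x : 'rV[R]_3 => x 0 j - base K 0 j)).
    exact: (contB (cont_coordinate j) (contC _)).
  by apply/funext => x; rewrite !mxE.
by move=> x; exact: cvg_pair (c (cob1 K) x) (c (cob2 K) x).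
Qed.

Lemma continuous_tpt K : continuous (tpt K).
Proof.
apply: cont_rV => j.
rewrite (_ : (fun _ => _) = (fun p : R * R => base K 0 j + p.1 * leg1 K 0 j + p.2 * leg2 K 0 j)).
  exact: (contD (contD (contC _) (contM (@continuous_fst R) (contC _)))
    (contM (@continuous_snd R) (contC _))).
by apply/funext => p; rewrite /tpt !mxE.
Qed.

(** A move in the plane of K is the same move in affine coordinates; the
derivatives of a function on K reduce to those of its coordinate expression. *)
Lemma tpt_shift K h t p :
  tpt K (h *: t + p) = h *: (t.1 *: leg1 K + t.2 *: leg2 K) + tpt K p.
Proof.
rewrite (_ : h *: t + p = (h * t.1 + p.1, h * t.2 + p.2)); last by case: t; case: p.
rewrite /tpt; move: (base K) (leg1 K) (leg2 K) => b l1 l2 /=.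
by apply/rowP => j; rewrite !mxE; ring.
Qed.

Lemma itri_coord K x : area2 K != 0 -> itri K x ->
  ref_tri (coord K x) /\ tpt K (coord K x) = x.
Proof. by move=> a0 [p rp <-]; rewrite coordK. Qed.

Lemma side_param_cref i (r : R) : r \in `[0, 1] -> cref_tri (side_param i r).
Proof.
rewrite in_itv/= /side_param => /andP[r0 r1].
by case: ifP => _; [|case: ifP => _]; split => /=; lra.
Qed.

Lemma itri_ctri K : itri K `<=` ctri K.
Proof. by move=> _ [p [p1 p2 p3] <-]; exists p => //; split; exact: ltW. Qed.

Lemma closure_itri K : ctri K `<=` closure (itri K).
Proof.
move=> _ [p [p1 p2 p3] <-] B nB.
(* the segment from p to the barycentre lies in the open triangle *)
pose path (e : R) : R * R := (p.1 + e * (3^-1 - p.1), p.2 + e * (3^-1 - p.2)).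
have cpath : continuous path.
  have c (a b : R) : continuous (fun e : R => a + e * b).
    exact: (contD (contC a) (contM cont_id (contC b))).
  by move=> e; exact: cvg_pair (c p.1 (3^-1 - p.1) e) (c p.2 (3^-1 - p.2) e).
have path0 : path 0 = p by rewrite /path !mul0r !addr0; case: (p).
have c0 := cont_comp (@continuous_tpt K) cpath (0 : R).
have nB' : nbhs (tpt K (path 0)) B by rewrite path0.
have /nbhs_ballP[e /= e0 eB] := c0 _ nB'.
pose d := Num.min (e / 2) (1 / 2).
have d0 : 0 < d by rewrite lt_min; apply/andP; split; lra.
have de : d < e by rewrite gt_min; apply/orP; left; lra.
have d1 : d < 1 by rewrite gt_min; apply/orP; right; lra.
exists (tpt K (path d)); split; last first.
  by apply: eB; rewrite /ball/= sub0r normrN gtr0_norm.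
exists (path d) => //; move: d d0 d1 {de eB c0 nB' cpath path0} => d d0 d1.
by rewrite /path; split => /=; nra.
Qed.

(** The trace only sees D, where v agrees with a function which is continuous
at x. *)
Lemma trace_ext (V : ptopologicalType) (D : set 'rV[R]_3) (v w : 'rV[R]_3 -> V) x :
  hausdorff_space V -> {in D, v =1 w} -> {for x, continuous w} -> closure D x ->
  trace D v x = w x.
Proof.
move=> hV vw cw cD; have P : ProperFilter (within D (nbhs x)) by exact: within_nbhs_proper.
apply: cvg_lim => //; apply: cvg_trans (cvg_within_filter _ cw).
by apply: near_eq_cvg; rewrite near_withinE; near=> y => Dy; rewrite vw// inE.
Unshelve. all: by end_near. Qed.

(** Near a point of the open triangle, a move along tau stays in the open
triangle, so u may be replaced by its coordinate expression. *)
Lemma is_derive_tri K u (P d1 d2 : R * R -> R) p t (tau : 'rV[R]_3) :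
  C1 P d1 d2 -> (forall p, ref_tri p -> u (tpt K p) = P p) -> ref_tri p ->
  tau = t.1 *: leg1 K + t.2 *: leg2 K ->
  is_derive (tpt K p) tau u (t.1 * d1 p + t.2 * d2 p).
Proof.
move=> CP uP rp tauE; have [Dp DE] := C1_is_derive CP p t.
have cvP : (fun h : R => h^-1 *: (P (h *: t + p) - P p)) h @[h --> 0^'] -->
    t.1 * d1 p + t.2 * d2 p by rewrite -DE; exact: Dp.
have E : \forall h \near (0 : R)^', h^-1 *: (P (h *: t + p) - P p) =
    h^-1 *: (u (h *: tau + tpt K p) - u (tpt K p)).
  have cl : continuous (fun h : R => h *: t + p).
    move=> h; have c (a b : R) : continuous (fun h : R => h * a + b).
      exact: (contD (contM cont_id (contC a)) (contC b)).
    rewrite (_ : (fun h : R => h *: t + p) = (fun h => (h * t.1 + p.1, h * t.2 + p.2))).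
      exact: cvg_pair (c t.1 p.1 h) (c t.2 p.2 h).
    by apply/funext => h'; case: (t); case: (p).
  have near0 : \forall h \near (0 : R), ref_tri (h *: t + p).
    have n0 : nbhs ((0 : R) *: t + p) (@ref_tri R).
      rewrite (_ : _ + _ = p); last by rewrite scale0r add0r.
      exact: (open_nbhs_nbhs (conj (@open_ref_tri R) rp)).
    exact: cl (0 : R) _ n0.
  apply: nbhs_dnbhs; near=> h.
  have rh : ref_tri (h *: t + p) by near: h.
  by rewrite -uP// -uP// tpt_shift tauE.
have cvu : (fun h : R => h^-1 *: (u (h *: tau + tpt K p) - u (tpt K p))) h @[h --> 0^'] -->
    t.1 * d1 p + t.2 * d2 p by apply: cvg_trans cvP; exact: near_eq_cvg.
by split; [apply/cvg_ex; eexists; exact: cvu|exact: cvg_lim cvu].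
Unshelve. all: by end_near. Qed.

(** In coordinates, the gradient is the differential expressed in the dual
basis. *)
Lemma tgrad_tri K u (P d1 d2 : R * R -> R) p : area2 K != 0 ->
  C1 P d1 d2 -> (forall p, ref_tri p -> u (tpt K p) = P p) -> ref_tri p ->
  tgrad K u (tpt K p) = d1 p *: cob1 K + d2 p *: cob2 K.
Proof.
move=> a0 CP uP rp; rewrite /tgrad.
have [_ ->] := @is_derive_tri K u P d1 d2 p
  (dot (tau1 K) (cob1 K), dot (tau1 K) (cob2 K)) _ CP uP rp (tau1_coord a0).
have [_ ->] := @is_derive_tri K u P d1 d2 p
  (dot (tau2 K) (cob1 K), dot (tau2 K) (cob2 K)) _ CP uP rp (tau2_coord a0).
exact: grad_dual.
Qed.

Definition C1v (F d1 d2 : R * R -> 'rV[R]_3) :=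
  forall j, C1 (fun p => F p 0 j) (fun p => d1 p 0 j) (fun p => d2 p 0 j).

Lemma C1v_dot F d1 d2 (b : 'rV[R]_3) : C1v F d1 d2 ->
  C1 (fun p => dot (F p) b) (fun p => dot (d1 p) b) (fun p => dot (d2 p) b).
Proof.
move=> CF.
have E (h : R * R -> 'rV[R]_3) : (fun p => dot (h p) b) = (fun p => \sum_j h p 0 j * b 0 j).
  by apply/funext => p; rewrite dotE.
rewrite !E; apply: C1_sum => j.
apply: (C1_eq (C1_mul (CF j) (C1_cst (b 0 j)))); apply/funext => p; ring.
Qed.

(** The divergence of a field on K, tangential or not, is the divergence of its
contravariant coordinates: the normal of K is constant. *)
Lemma tdiv_tri K phi F d1 d2 p : area2 K != 0 ->
  C1v F d1 d2 -> (forall p, ref_tri p -> phi (tpt K p) = F p) -> ref_tri p ->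
  tdiv K phi (tpt K p) = dot (d1 p) (cob1 K) + dot (d2 p) (cob2 K).
Proof.
move=> a0 CF phiF rp.
have D tau (t : R * R) : tau = t.1 *: leg1 K + t.2 *: leg2 K ->
    'D_tau phi (tpt K p) = t.1 *: d1 p + t.2 *: d2 p.
  move=> tauE.
  have Dj (i : 'I_1) (j : 'I_3) : is_derive (tpt K p) tau (fun x => phi x i j)
      (t.1 * d1 p 0 j + t.2 * d2 p 0 j).
    rewrite (ord1 i); apply: (is_derive_tri (CF j)) tauE => // p' rp'.
    by rewrite phiF.
  rewrite derive_mx; last by apply/derivable_mxP => i' j; case: (Dj i' j).
  apply/matrixP => i' j; rewrite mxE; have [_ ->] := Dj i' j.
  by rewrite (ord1 i') !mxE.
rewrite /tdiv (D _ (_, _) (tau1_coord a0)) (D _ (_, _) (tau2_coord a0)) /=.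
have G1 := grad_dual 1 0 a0; have G2 := grad_dual 0 1 a0.
move: G1 G2; rewrite !(mulr1, mulr0, addr0, add0r, scale1r, scale0r) => G1 G2.
rewrite -[in RHS]G1 -[in RHS]G2.
rewrite !(dotDl, dotZl) !(dotDr, dotZr).
ring.
Qed.

Lemma is_poly_C1v k K (phi : 'rV[R]_3 -> 'rV[R]_3) :
  (forall j, is_poly k K (fun x => phi x 0 j)) ->
  exists F d1 d2, C1v F d1 d2 /\ forall p, ref_tri p -> phi (tpt K p) = F p.
Proof.
move=> pj.
have /choice[D DE] : forall j, exists D : (R * R -> R) * (R * R -> R) * (R * R -> R),
    C1 D.1.1 D.1.2 D.2 /\ forall p, ref_tri p -> phi (tpt K p) 0 j = D.1.1 p.
  by move=> j; have [P [d1 [d2 H]]] := is_poly_C1 (pj j); exists (P, d1, d2).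
exists (fun p => \row_j (D j).1.1 p), (fun p => \row_j (D j).1.2 p),
  (fun p => \row_j (D j).2 p); split.
  move=> j; have [C _] := DE j; move: C.
  by congr (C1 _ _ _); apply/funext => p; rewrite mxE.
by move=> p rp; apply/rowP => j; rewrite mxE; have [_ ->] := DE j.
Qed.

(** The divergence theorem on the reference triangle, transported to K:
[side_flux] turns the reference fluxes into conormal ones.  Both integrations
by parts of the scheme have the form G(P) F, with G(s) = s^2 / 2 and with G a
primitive of sqrt(a). *)
Lemma divergence_tri K (G G' : R -> R) P d1 d2 F e1 e2 : area2 K != 0 ->
  (forall z : R, is_derive z 1 G (G' z)) -> continuous G' ->
  C1 P d1 d2 -> C1v F e1 e2 ->
  area2 K * \int[@lebesgue2 R]_(p in @ref_tri R)
    (G' (P p) * (d1 p * dot (F p) (cob1 K) + d2 p * dot (F p) (cob2 K)) +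
     G (P p) * (dot (e1 p) (cob1 K) + dot (e2 p) (cob2 K))) =
  \sum_(i : 'I_3) enorm (side_tgt (K, i) - side_src (K, i)) *
    \int[@lebesgue_measure R]_(s in `[0, 1])
      (G (P (side_param i s)) * dot (conormal (K, i)) (F (side_param i s))).
Proof.
move=> a0 dG cG' CP CF.
have CG := C1_comp CP dG cG'.
have C1F := C1_mul CG (C1v_dot (cob1 K) CF).
have C2F := C1_mul CG (C1v_dot (cob2 K) CF).
have DR := divergence_ref C1F C2F.
rewrite [X in _ * X](_ : _ = \sum_(i : 'I_3) \int[@lebesgue_measure R]_(s in `[0, 1])
  refflux i (G (P (side_param i s)) * dot (F (side_param i s)) (cob1 K),
             G (P (side_param i s)) * dot (F (side_param i s)) (cob2 K))); last first.
  by rewrite -DR; apply: eq_Rintegral => p _; ring.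
rewrite mulr_sumr; apply: eq_bigr => i _.
have cGP := C1_continuous CG.
have cF j : continuous (fun p => F p 0 j) by exact: C1_continuous (CF j).
rewrite -Rintegral01Z; last first.
  apply: (@continuous_side_param R i (fun p => refflux i (G (P p) * dot (F p) (cob1 K), G (P p) * dot (F p) (cob2 K)))).
  rewrite (_ : (fun _ => _) = fun p => G (P p) * refflux i (dot (F p) (cob1 K), dot (F p) (cob2 K))).
    apply: contM => //; rewrite /refflux; case: (i == ord0) => /=.
      by apply: contD; exact: cont_dot.
    by case: (i == ordS ord0); apply: contN; exact: cont_dot.
  by apply/funext => p; rewrite -refflux_lin.
rewrite -Rintegral01Z; last first.
  apply: (@continuous_side_param R i (fun p => G (P p) * dot (conormal (K, i)) (F p))).
  apply: contM => //; rewrite (_ : (fun _ => _) = fun p => dot (F p) (conormal (K, i))).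
    exact: cont_dot.
  by apply/funext => p; rewrite dotC.
apply: eq_Rintegral => s _.
rewrite mulrCA side_flux// (refflux_lin i (G (P (side_param i s))) (_, _)); ring.
Qed.

End AffineCoordinates.

(** * The difference quotient in the diffusive flux *)

Section DifferenceQuotient.
Variable R : realType.

Definition dquot (g g' : R -> R) (p : R * R) : R :=
  if p.1 - p.2 == 0 then g' p.1 else (g p.1 - g p.2) / (p.1 - p.2).

Lemma dquotE g g' p : g p.1 - g p.2 = dquot g g' p * (p.1 - p.2).
Proof.
rewrite /dquot; case: eqP => [/subr0_eq ->|/eqP p0]; first by rewrite !subrr mulr0.
by rewrite divfK.
Qed.

(** The quotient is always a value of g' between its two arguments. *)
Lemma dquot_MVT g g' (p : R * R) : (forall z : R, is_derive z 1 g (g' z)) ->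
  exists2 z, `|z - p.1| <= `|p.2 - p.1| & dquot g g' p = g' z.
Proof.
move=> dg.
have cg : continuous g.
  by move=> z; apply: differentiable_continuous; apply/derivable1_diffP; case: (dg z).
rewrite /dquot; case: p => x y /=.
have [xy|xy|->] := ltgtP x y.
- have [z zxy E] := MVT xy (fun z _ => dg z) (continuous_subspaceT cg).
  move: zxy; rewrite in_itv/= => /andP[z1 z2].
  exists z; first by rewrite !gtr0_norm; lra.
  rewrite ifF; last by rewrite subr_eq0 lt_eqF.
  rewrite (_ : g x - g y = g' z * (x - y)); first by rewrite mulfK// subr_eq0 lt_eqF.
  by rewrite -[LHS]opprB E -mulrN opprB.
- have [z zxy E] := MVT xy (fun z _ => dg z) (continuous_subspaceT cg).
  move: zxy; rewrite in_itv/= => /andP[z1 z2].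
  exists z; first by rewrite !ltr0_norm; lra.
  rewrite ifF; last by rewrite subr_eq0 gt_eqF.
  by rewrite E mulfK// subr_eq0 gt_eqF.
- by exists y; rewrite ?subrr ?normr0 ?eqxx.
Qed.

(** The quotient of the jumps of g(u) and u depends continuously on the two
traces; at equal traces this is where continuity of g' is needed. *)
Lemma continuous_dquot g g' : (forall z : R, is_derive z 1 g (g' z)) ->
  continuous g' -> continuous (dquot g g').
Proof.
move=> dg cg' [x y].
have cg : continuous g.
  by move=> z; apply: differentiable_continuous; apply/derivable1_diffP; case: (dg z).
have cD : continuous (fun p : R * R => p.1 - p.2).
  exact: (contB (@continuous_fst R) (@continuous_snd R)).
have [->|xy] := eqVneq x y; last first.
  have xy0 : x - y != 0 by rewrite subr_eq0.
  pose f (p : R * R) := (g p.1 - g p.2) / (p.1 - p.2).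
  have cf : {for (x, y), continuous f}.
    apply: (@cvgM _ _ _ _ (fun p : R * R => g p.1 - g p.2) (fun p => (p.1 - p.2)^-1)).
      exact: (contB (cont_comp cg (@continuous_fst R)) (cont_comp cg (@continuous_snd R))).
    by apply: cvgV => //; exact: cD.
  have E : dquot g g' (x, y) = f (x, y) by rewrite /dquot ifF//=; exact/negbTE.
  rewrite /continuous_at E; apply: cvg_trans cf; apply: near_eq_cvg.
  have : \forall p \near (x, y), p.1 - p.2 != 0.
    exact: (cD (x, y) _ (open_nbhs_nbhs (conj (@open_neq R 0) xy0))).
  by apply: filterS => p p0; rewrite /dquot/f ifF//; exact/negbTE.
have E : dquot g g' (y, y) = g' y by rewrite /dquot/= subrr eqxx.
apply/cvgrPdist_lt => /= e e0; rewrite E.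
have /cvgrPdist_lt/(_ _ e0)/nbhs_ballP[d /= d0 dg'] := cg' y.
exists (ball y (d / 3), ball y (d / 3)).
  by split; apply: nbhsx_ballx; rewrite divr_gt0.
move=> [x' y'] [/=]; rewrite /ball/= => h1 h2.
have [z zx ->] := @dquot_MVT g g' (x', y') dg; apply: dg'; rewrite /ball/=.
move: zx => /= zx; move: h1 h2 zx; rewrite !ltr_distl !ler_distl.
rewrite -[y' - x']/(y' - x') => /andP[? ?] /andP[? ?].
have [?|?] := ger0P (y' - x'); move=> /andP[? ?]; apply/andP; split; lra.
Qed.

End DifferenceQuotient.

(** * Edges of the triangulation *)

Section Edges.
Variables (R : realType) (T : mesh R).
Hypothesis hT : admissible T.
Implicit Types (K : tria T) (e : edge T) (s : bool).

Lemma area2_neq0 K : area2 K != 0.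
Proof. by case: hT. Qed.
Hint Resolve area2_neq0 : core.

Lemma segment_eq (a b c d : 'rV[R]_3) : c != d ->
  [set a + r *: (b - a) | r in `[0, 1]%classic] =
  [set c + r *: (d - c) | r in `[0, 1]%classic] ->
  (a = c /\ b = d) \/ (a = d /\ b = c).
Proof.
move=> cd E.
have i0 : `[0 : R, 1]%classic 0 by rewrite /= in_itv/= lexx ler01.
have i1 : `[0 : R, 1]%classic 1 by rewrite /= in_itv/= lexx ler01.
have [s] : [set c + r *: (d - c) | r in `[0, 1]%classic] a.
  by rewrite -E; exists 0 => //; rewrite scale0r addr0.
rewrite /= in_itv/= => /andP[s0 s1] aE.
have [t] : [set c + r *: (d - c) | r in `[0, 1]%classic] b.
  by rewrite -E; exists 1 => //; rewrite scale1r addrC subrK.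
rewrite /= in_itv/= => /andP[t0 t1] bE.
have [s'] : [set a + r *: (b - a) | r in `[0, 1]%classic] c.
  by rewrite E; exists 0 => //; rewrite scale0r addr0.
rewrite /= in_itv/= => /andP[s'0 s'1] cE.
have [t'] : [set a + r *: (b - a) | r in `[0, 1]%classic] d.
  by rewrite E; exists 1 => //; rewrite scale1r addrC subrK.
rewrite /= in_itv/= => /andP[t'0 t'1] dE.
have lin (x y : R) : x *: (d - c) = y *: (d - c) -> x = y.
  move=> /eqP; rewrite -subr_eq0 -scalerBl scaler_eq0 !subr_eq0.
  by rewrite (eq_sym d) (negbTE cd) orbF => /eqP.
have E1 : s + s' * (t - s) = 0.
  apply: lin; rewrite scale0r; apply: (addrI c).
  rewrite addr0 -[in RHS]cE -aE -bE.
  by apply/rowP => j; rewrite !mxE; ring.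
have E2 : s + t' * (t - s) = 1.
  apply: lin; rewrite scale1r; apply: (addrI c).
  rewrite [in RHS]addrC subrK -[in RHS]dE -aE -bE.
  by apply/rowP => j; rewrite !mxE; ring.
have [s00|s00] := eqVneq s 0.
  left; have tE : t = 1 by rewrite s00 in E2 *; nra.
  by rewrite -aE -bE s00 tE scale0r addr0 scale1r addrC subrK.
right; have sE : s = 1 by nra.
have tE : t = 0 by rewrite sE in E1 E2 *; nra.
by rewrite -aE -bE sE tE scale0r addr0 scale1r addrC subrK.
Qed.

Lemma adj_side e s : side (adj e s) = eset e.
Proof. by case: hT => _ _ _ H _; apply/H; exists s. Qed.

(** The side is, as a set, the same segment for both triangles; only its
direction may differ. *)
Lemma adj_param e s : exists dir : bool,
  (forall r, ept e r = tpt (adj e s).1 (side_param (adj e s).2 (if dir then r else 1 - r))) /\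
  elen e = enorm (side_tgt (adj e s) - side_src (adj e s)).
Proof.
have := adj_side e s; have E := side_tpt (adj e s).1 (adj e s).2.
rewrite -surjective_pairing in E.
rewrite /side /eset /ept /elen => /esym /segment_eq.
rewrite eq_sym -subr_eq0 {1}(surjective_pairing (adj e s)) side_neq0// => /(_ isT).
case=> -[Es Et]; [exists true|exists false]; rewrite Es Et; split => // [r|].
  by rewrite -E; apply/rowP => j; rewrite !mxE; ring.
by rewrite /enorm -opprB dotNl dotNr opprK.
Qed.

Lemma adj_inj e s e' s' : adj e s = adj e' s' -> e = e' /\ s = s'.
Proof.
move=> E; have [_ _ H _ N] := hT.
have [e0 [_ U]] := H (adj e s).
have ee' : e = e'.
  by rewrite -(U e) ?adj_side// -(U e')// E adj_side.
rewrite -{e'}ee' in E *; split => //; clear U.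
by case: s s' E => -[]// /(congr1 fst) /eqP; rewrite ?(negbTE (N e))// eq_sym (negbTE (N e)).
Qed.

(** In a closed triangulation, the pairs of an edge and one of its two sides
enumerate the sides of all triangles exactly once. *)
Lemma sum_adj (F : tria T * 'I_3 -> R) :
  \sum_K \sum_i F (K, i) = \sum_e (F (adj e true) + F (adj e false)).
Proof.
have /choice[h hE] : forall f : tria T * 'I_3, exists es, adj es.1 es.2 = f.
  move=> f; have [_ _ H H' _] := hT.
  have [e0 [fe _]] := H f; have [s ->] := (H' e0 f).1 fe.
  by exists (e0, s).
rewrite pair_big/= (reindex (fun es : edge T * bool => adj es.1 es.2))/=; last first.
  exists h => [[e s] _|f _]; last exact: hE.
  by have /adj_inj[] := hE (adj e s); case: (h _) => ? ? /= -> ->.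
rewrite (eq_bigr (fun es : edge T * bool => F (adj es.1 es.2))); last first.
  by move=> es _; case: adj.
rewrite -(pair_bigA _ (fun e s => F (adj e s)))/=.
by apply: eq_bigr => e _; rewrite big_bool.
Qed.

Lemma sum_bint (F : edge T -> bool -> 'rV[R]_3 -> R) :
  \sum_K bint K F = \sum_e (eint e (F e true) + eint e (F e false)).
Proof.
rewrite /bint exchange_big; apply: eq_bigr => e _.
under eq_bigr do rewrite big_mkcond.
rewrite exchange_big big_bool /=; congr (_ + _);
  by rewrite -big_mkcond/= (big_pred1 _ (fun K => eq_sym _ _)).
Qed.

Lemma continuous_ept e : continuous (ept e).
Proof.
apply: cont_rV => j; rewrite /ept.
set a := side_src _; set b := side_tgt _.
rewrite (_ : (fun _ => _) = (fun r => a 0 j + r * (b 0 j - a 0 j))).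
  exact: (contD (contC _) (contM cont_id (contC _))).
by apply/funext => r; rewrite !mxE.
Qed.

Definition ecoord e s (r : R) : R * R := coord (adj e s).1 (ept e r).

Lemma continuous_ecoord e s : continuous (ecoord e s).
Proof. exact: (cont_comp (@continuous_coord _ _ _) (@continuous_ept e)). Qed.

Lemma ept_ctri e s r : r \in `[0, 1] -> ctri (adj e s).1 (ept e r).
Proof.
move=> r01; have [dir [E _]] := adj_param e s.
rewrite {}E; eexists; last by [].
apply: side_param_cref; case: dir => //.
by move: r01; rewrite !in_itv/= => /andP[? ?]; apply/andP; split; lra.
Qed.

(** Edge points lie in the closed triangle, and the coordinate expression P is
continuous up to the boundary. *)
Lemma etrace_ept (V : ptopologicalType) e s (v : 'rV[R]_3 -> V) (P : R * R -> V) r :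
  hausdorff_space V -> continuous P ->
  (forall p, ref_tri p -> v (tpt (adj e s).1 p) = P p) -> r \in `[0, 1] ->
  etrace e s v (ept e r) = P (ecoord e s r).
Proof.
move=> hV cP vP r01.
apply: (@trace_ext _ V _ v (fun x => P (coord (adj e s).1 x))) => //.
- move=> x; rewrite inE => ix; have [rx xE] := itri_coord (area2_neq0 _) ix.
  by rewrite -{1}xE vP.
- exact: (cont_comp cP (@continuous_coord _ _ _)).
- exact/closure_itri/ept_ctri.
Qed.

Lemma side_int_eint e s (H : R * R -> R) : continuous H ->
  enorm (side_tgt (adj e s) - side_src (adj e s)) *
    \int[@lebesgue_measure R]_(r in `[0, 1]) H (side_param (adj e s).2 r) =
  elen e * \int[@lebesgue_measure R]_(r in `[0, 1]) H (ecoord e s r).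
Proof.
move=> cH; have [dir [E ->]] := adj_param e s; congr (_ * _).
have -> : \int[@lebesgue_measure R]_(r in `[0, 1]) H (ecoord e s r) =
    \int[@lebesgue_measure R]_(r in `[0, 1]) H (side_param (adj e s).2 (if dir then r else 1 - r)).
  by apply: eq_Rintegral => r _; rewrite /ecoord E coordK.
case: dir {E} => //; rewrite (Rintegral_onem (f := fun r => H (side_param (adj e s).2 r)))//.
exact: continuous_side_param.
Qed.

Lemma ncon_unit e s : dot (ncon e s) (ncon e s) = 1.
Proof. by rewrite /ncon; case E: (adj e s) => [K i]; rewrite conormal_unit. Qed.

Lemma elen_gt0 e : 0 < elen e.
Proof.
have [dir [_ ->]] := adj_param e true.
by rewrite enorm_gt0 {1}(surjective_pairing (adj e true)) side_neq0.
Qed.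

End Edges.

(** * The energy balance at a fixed time *)

Section EnergyBalance.
Variables (R : realType) (T : mesh R).
Hypothesis hT : admissible T.
Variables (a g : R -> R) (hac : continuous a).
Hypothesis hg : forall z : R, is_derive z 1 g (Num.sqrt (a z)).
Variables (wh : 'rV[R]_3 -> 'rV[R]_3) (N : tria T -> int).
Hypothesis hjump : forall e x, eset (T := T) e x -> njump e wh x = 0.
Variables (u ut : 'rV[R]_3 -> R) (q : 'rV[R]_3 -> 'rV[R]_3).
Variables (P d1 d2 : tria T -> R * R -> R).
Variables (F e1 e2 W w1 w2 : tria T -> R * R -> 'rV[R]_3).
Hypothesis CP : forall K, C1 (P K) (d1 K) (d2 K).
Hypothesis CF : forall K, C1v (F K) (e1 K) (e2 K).
Hypothesis CW : forall K, C1v (W K) (w1 K) (w2 K).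
Hypothesis uP : forall K p, ref_tri p -> u (tpt K p) = P K p.
Hypothesis qF : forall K p, ref_tri p -> q (tpt K p) = F K p.
Hypothesis wW : forall K p, ref_tri p -> wh (tpt K p) = W K p.
Hypothesis equ : forall K, LDG_eq_u a g wh N u ut q K u.
Hypothesis eqq : forall K, LDG_eq_q g N u q K q.
Implicit Types (K : tria T) (e : edge T) (s : bool) (r : R).

Local Notation mu := (@lebesgue_measure R).
Local Notation "'refint' f" := (\int[@lebesgue2 R]_(p in @ref_tri R) f p) (at level 10, f at level 8).
Local Notation "'oneint' f" := (\int[mu]_(r in `[0, 1]) f r) (at level 10, f at level 8).

Let a0 K : area2 K != 0. Proof. exact: area2_neq0. Qed.
Let cP K : continuous (P K). Proof. exact: C1_continuous (CP K). Qed.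
Let cF K j : continuous (fun p => F K p 0 j).
Proof. exact: C1_continuous (CF K j). Qed.
Let cW K j : continuous (fun p => W K p 0 j).
Proof. exact: C1_continuous (CW K j). Qed.
Let cg : continuous g.
Proof.
by move=> z; apply: differentiable_continuous; apply/derivable1_diffP; case: (hg z).
Qed.
Let csa : continuous (fun z => Num.sqrt (a z)).
Proof. exact: (cont_comp (@sqrt_continuous R) hac). Qed.

Lemma tint_ref K (f : 'rV[R]_3 -> R) (h : R * R -> R) :
  (forall p, ref_tri p -> f (tpt K p) = h p) -> tint K f = area2 K * refint h.
Proof.
by move=> fh; rewrite /tint; congr (_ * _); apply: eq_Rintegral => p; rewrite inE => /fh.
Qed.

Let divW K p : R := dot (w1 K p) (cob1 K) + dot (w2 K p) (cob2 K).
Let divF K p : R := dot (e1 K p) (cob1 K) + dot (e2 K p) (cob2 K).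
Let dirW K p : R := d1 K p * dot (W K p) (cob1 K) + d2 K p * dot (W K p) (cob2 K).
Let dirF K p : R := d1 K p * dot (F K p) (cob1 K) + d2 K p * dot (F K p) (cob2 K).

Let cd1 K : continuous (d1 K). Proof. by case: (CP K). Qed.
Let cd2 K : continuous (d2 K). Proof. by case: (CP K). Qed.

Let cdotF K b : continuous (fun p => dot (F K p) b).
Proof. exact: cont_dot. Qed.
Let cdotW K b : continuous (fun p => dot (W K p) b).
Proof. exact: cont_dot. Qed.

Let cdivW K : continuous (divW K).
Proof. by apply: contD; apply: cont_dot => j; case: (CW K j). Qed.
Let cdivF K : continuous (divF K).
Proof. by apply: contD; apply: cont_dot => j; case: (CF K j). Qed.
Let cdirW K : continuous (dirW K).
Proof. exact: (contD (contM (@cd1 K) (@cdotW K _)) (contM (@cd2 K) (@cdotW K _))). Qed.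
Let cdirF K : continuous (dirF K).
Proof. exact: (contD (contM (@cd1 K) (@cdotF K _)) (contM (@cd2 K) (@cdotF K _))). Qed.

(* a formula for betah which is visibly continuous *)
Let betar K p : R := (`|divW K p| - divW K p) / 4.

Let cbetar K : continuous (betar K).
Proof.
apply: (contM _ (contC _)); apply: (contB _ (@cdivW K)).
by apply: cont_comp (@cdivW K); exact: norm_continuous.
Qed.

Lemma betahE K p : ref_tri p -> betah wh K (tpt K p) = betar K p.
Proof.
move=> rp; rewrite /betah (tdiv_tri (a0 K) (CW K) (@wW K) rp) -/(divW K p).
rewrite /betar; have [d0|d0] := leP 0 (divW K p).
  by rewrite ger0_norm// subrr mul0r.
by rewrite ltr0_norm//; field.
Qed.

(* a boundary integral over one side, on the reference triangle *)
Let bnd (f : tria T * 'I_3 -> R * R -> R) (Ki : tria T * 'I_3) : R :=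
  enorm (side_tgt Ki - side_src Ki) * oneint (fun r => f Ki (side_param Ki.2 r)).
Let f1 (Ki : tria T * 'I_3) p : R :=
  2^-1 * P Ki.1 p ^+ 2 * dot (conormal Ki) (W Ki.1 p).
Let f2 (Ki : tria T * 'I_3) p : R := g (P Ki.1 p) * dot (conormal Ki) (F Ki.1 p).

Let fuw e s x := dot (flux_uw wh u e s x) (ncon e s) * etrace e s u x.
Let faq e s x := dot (flux_aq a g N u q e s x) (ncon e s) * etrace e s u x.
Let fgq e s x := flux_g g N u e x * dot (ncon e s) (etrace e s q x).

(** Integration by parts of the convective term, as u grad u = grad (u^2 / 2). *)
Lemma green_uw K : area2 K * refint (fun p => P K p * dirW K p) +
    area2 K * refint (fun p => 2^-1 * P K p ^+ 2 * divW K p) =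
  \sum_i bnd f1 (K, i).
Proof.
have dG : forall z : R, is_derive z 1 (fun z : R => 2^-1 * z ^+ 2) z.
  move=> z; apply: is_derive_eq; rewrite /GRing.scale/=; lra.
rewrite -(divergence_tri (a0 K) dG cont_id (CP K) (CW K)) -mulrDr -Rintegral_refD//.
- exact: contM (@cdirW K).
- rewrite (_ : (fun _ => _) = (fun p => 2^-1 * (P K p * P K p) * divW K p)).
    exact: (contM (contM (contC _) (contM (@cP K) (@cP K))) (@cdivW K)).
  by apply/funext => p; rewrite expr2.
Qed.

(** Integration by parts of the diffusive term, as g' = sqrt(a). *)
Lemma green_aq K : area2 K * refint (fun p => Num.sqrt (a (P K p)) * dirF K p) +
    area2 K * refint (fun p => g (P K p) * divF K p) =
  \sum_i bnd f2 (K, i).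
Proof.
rewrite -(divergence_tri (a0 K) hg csa (CP K) (CF K)) -mulrDr -Rintegral_refD//.
- exact: (contM (cont_comp csa (@cP K)) (@cdirF K)).
- exact: (contM (cont_comp cg (@cP K)) (@cdivF K)).
Qed.

(** Both equations tested with the solution, after integration by parts.  The
inequality drops (div w / 2 + beta) u^2, in which div w / 2 + beta is half the
positive part of div w. *)
Lemma tri_balance K :
  tint K (fun x => ut x * u x) + tint K (fun x => dot (q x) (q x)) <=
  \sum_i bnd f1 (K, i) - \sum_i bnd f2 (K, i) + bint K fgq
  - bint K fuw + bint K faq.
Proof.
have := eqq K; rewrite /LDG_eq_q -/fgq => ->.
rewrite [tint K (fun x => g _ * _)](tint_ref (h := fun p => g (P K p) * divF K p)); last first.
  by move=> p rp; rewrite uP// (tdiv_tri (a0 K) (CF K) (@qF K) rp).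
have := equ K; rewrite /LDG_eq_u -/fuw -/faq.
rewrite [tint K (fun x => dot (_ - _) _)](tint_ref
  (h := fun p => P K p * dirW K p - Num.sqrt (a (P K p)) * dirF K p)); last first.
  move=> p rp; rewrite (tgrad_tri (a0 K) (CP K) (@uP K) rp).
  rewrite uP// qF// wW// /dirW /dirF; move: (cob1 K) (cob2 K) => b b'.
  by rewrite !(dotDl, dotZl, dotNl) !(dotDr, dotZr); ring.
rewrite (_ : refint (fun p => P K p * dirW K p - Num.sqrt (a (P K p)) * dirF K p) =
  refint (fun p => P K p * dirW K p) - refint (fun p => Num.sqrt (a (P K p)) * dirF K p)); last first.
  have c1 := contM (@cP K) (@cdirW K).
  have c2 := contM (cont_comp csa (@cP K)) (@cdirF K).
  rewrite -[X in _ = _ - X]mul1r -mulNr -Rintegral_refZ// -Rintegral_refD//; last exact: (contM (contC _) c2).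
  by apply: eq_Rintegral => p _; rewrite mulN1r.
rewrite [tint K (fun x => betah _ _ _ * _ * _)](tint_ref
  (h := fun p => betar K p * P K p * P K p)); last first.
  by move=> p rp; rewrite betahE// uP.
have G1 := green_uw K; have G2 := green_aq K.
have pos : 0 <= area2 K * refint (fun p => 2^-1 * P K p ^+ 2 * divW K p) +
    area2 K * refint (fun p => betar K p * P K p * P K p).
  rewrite -mulrDr -Rintegral_refD//.
  - apply: mulr_ge0; first exact: area_elt_ge0.
    apply: Rintegral_ge0 => p _; rewrite /betar.
    rewrite (_ : _ + _ = P K p ^+ 2 * ((divW K p + `|divW K p|) / 4)); last by field.
    apply: mulr_ge0; first exact: sqr_ge0.
    apply: divr_ge0 => //; rewrite -lerBlDl sub0r.
    by rewrite -normrN ler_norm.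
  - rewrite (_ : (fun _ => _) = (fun p => 2^-1 * (P K p * P K p) * divW K p)).
      exact: (contM (contM (contC _) (contM (@cP K) (@cP K))) (@cdivW K)).
    by apply/funext => p; rewrite expr2.
  - exact: (contM (contM (@cbetar K) (@cP K)) (@cP K)).
move: G1 G2 pos; rewrite mulrBr.
set A := area2 K * _; set B := area2 K * _; set C := area2 K * _; set D := area2 K * _.
move: (\sum_i _) (\sum_i _) => S1 S2.
set E := area2 K * _; move: (bint _ _) (bint _ _) (bint _ _) (tint _ _) => *; lra.
Qed.

Let ue e s r : R := P (adj e s).1 (ecoord e s r).
Let qn e s r : R := dot (ncon e s) (F (adj e s).1 (ecoord e s r)).
Let wn e s r : R := dot (ncon e s) (W (adj e s).1 (ecoord e s r)).

Let cue e s : continuous (ue e s).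
Proof. exact: (cont_comp (@cP _) (@continuous_ecoord _ _ e s)). Qed.
Let cqn e s : continuous (qn e s).
Proof.
rewrite (_ : qn e s = fun r => dot (F (adj e s).1 (ecoord e s r)) (ncon e s)).
  exact: (cont_comp (@cdotF _ _) (@continuous_ecoord _ _ e s)).
by apply/funext => r; rewrite /qn dotC.
Qed.
Let cwn e s : continuous (wn e s).
Proof.
rewrite (_ : wn e s = fun r => dot (W (adj e s).1 (ecoord e s r)) (ncon e s)).
  exact: (cont_comp (@cdotW _ _) (@continuous_ecoord _ _ e s)).
by apply/funext => r; rewrite /wn dotC.
Qed.

Let hausR : hausdorff_space R. Proof. exact: Rhausdorff. Qed.
Let haus3 : hausdorff_space 'rV[R]_3. Proof. exact: norm_hausdorff. Qed.

Lemma etrace_u e s r : r \in `[0, 1] -> etrace e s u (ept e r) = ue e s r.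
Proof. by move=> r01; rewrite (etrace_ept hT hausR (@cP (adj e s).1))// => p; exact: uP. Qed.

Lemma etrace_gu e s r : r \in `[0, 1] -> etrace e s (g \o u) (ept e r) = g (ue e s r).
Proof.
move=> r01; rewrite (etrace_ept (P := fun p => g (P (adj e s).1 p)) hT hausR)//.
  exact: (cont_comp cg (@cP _)).
by move=> p rp /=; rewrite uP.
Qed.

Lemma etrace_q e s r : r \in `[0, 1] ->
  etrace e s q (ept e r) = F (adj e s).1 (ecoord e s r).
Proof.
move=> r01; rewrite (etrace_ept (P := F (adj e s).1) hT haus3)//.
  exact: cont_rV.
by move=> p rp /=; rewrite qF.
Qed.

Lemma etrace_w e s r : r \in `[0, 1] ->
  etrace e s wh (ept e r) = W (adj e s).1 (ecoord e s r).
Proof.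
move=> r01; rewrite (etrace_ept (P := W (adj e s).1) hT haus3)//.
  exact: cont_rV.
by move=> p rp /=; rewrite wW.
Qed.

Lemma etrace_uw e s r : r \in `[0, 1] ->
  etrace e s (fun z => u z *: wh z) (ept e r) = ue e s r *: W (adj e s).1 (ecoord e s r).
Proof.
move=> r01; rewrite (etrace_ept (P := fun p => P (adj e s).1 p *: W (adj e s).1 p) hT haus3)//.
  apply: cont_rV => j; rewrite (_ : (fun _ => _) = (fun p => P (adj e s).1 p * W (adj e s).1 p 0 j)).
    exact: (contM (@cP _) (@cW _ _)).
  by apply/funext => p; rewrite mxE.
by move=> p rp /=; rewrite wW// uP.
Qed.

Let jmp e r : R := ue e true r - ue e false r.
Let c12 e : R := dot (C12 N e) (ncon e true).
Let h1 e s r : R := 2^-1 * ue e s r ^+ 2 * wn e s r.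
Let h2 e s r : R := g (ue e s r) * qn e s r.
Let hG e s r : R :=
  (2^-1 * (g (ue e false r) + g (ue e true r)) - c12 e * jmp e r) * qn e s r.
Let hD e s r : R := sgnb R s *
  (2^-1 * (ue e true r * wn e true r - ue e false r * wn e false r) +
   alpha wh e / 2 * jmp e r) * ue e s r.
Let dq e r : R := dquot g (fun z => Num.sqrt (a z)) (ue e true r, ue e false r).
Let hE e s r : R := sgnb R s *
  (dq e r * (2^-1 * (qn e true r - qn e false r)) - C11 e * jmp e r
   + c12 e * (qn e false r + qn e true r)) * ue e s r.

Let cjmp e : continuous (jmp e).
Proof. exact: contB. Qed.
Let cgu e s : continuous (fun r => g (ue e s r)).
Proof. exact: cont_comp. Qed.
Let ch1 e s : continuous (h1 e s).
Proof.
rewrite (_ : h1 e s = fun r => 2^-1 * (ue e s r * ue e s r) * wn e s r).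
  exact: (contM (contM (contC _) (contM (@cue e s) (@cue e s))) (@cwn e s)).
by apply/funext => r; rewrite /h1 expr2.
Qed.
Let ch2 e s : continuous (h2 e s).
Proof. exact: (contM (@cgu e s) (@cqn e s)). Qed.
Let chG e s : continuous (hG e s).
Proof.
exact: (contM (contB (contM (contC _) (contD (@cgu e false) (@cgu e true)))
  (contM (contC _) (@cjmp e))) (@cqn e s)).
Qed.
Let chD e s : continuous (hD e s).
Proof.
exact: (contM (contM (contC _) (contD (contM (contC _) (contB
  (contM (@cue e true) (@cwn e true)) (contM (@cue e false) (@cwn e false))))
  (contM (contC _) (@cjmp e)))) (@cue e s)).
Qed.
Let cdq e : continuous (dq e).
Proof.
apply: (cont_comp (continuous_dquot hg csa)) => r.
exact: cvg_pair (@cue e true r) (@cue e false r).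
Qed.
Let chE e s : continuous (hE e s).
Proof.
exact: (contM (contM (contC _) (contD (contB (contM (@cdq e) (contM (contC _)
  (contB (@cqn e true) (@cqn e false)))) (contM (contC _) (@cjmp e)))
  (contM (contC _) (contD (@cqn e false) (@cqn e true))))) (@cue e s)).
Qed.

Lemma eint_param e (f : 'rV[R]_3 -> R) (h : R -> R) :
  (forall r, r \in `[0, 1] -> f (ept e r) = h r) -> eint e f = elen e * oneint h.
Proof.
by move=> fh; rewrite /eint; congr (_ * _); apply: eq_Rintegral => r; rewrite inE => /fh.
Qed.

Lemma bnd_f1 e s : bnd f1 (adj e s) = elen e * oneint (h1 e s).
Proof.
rewrite /bnd (@side_int_eint _ _ hT e s (f1 (adj e s)))//.
rewrite (_ : f1 (adj e s) = fun p => 2^-1 * (P (adj e s).1 p * P (adj e s).1 p) *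
  dot (W (adj e s).1 p) (conormal (adj e s))).
  exact: (contM (contM (contC _) (contM (@cP _) (@cP _))) (@cdotW _ _)).
by apply/funext => p; rewrite /f1 expr2 dotC.
Qed.

Lemma bnd_f2 e s : bnd f2 (adj e s) = elen e * oneint (h2 e s).
Proof.
rewrite /bnd (@side_int_eint _ _ hT e s (f2 (adj e s)))//.
rewrite (_ : f2 (adj e s) = fun p => g (P (adj e s).1 p) *
  dot (F (adj e s).1 p) (conormal (adj e s))).
  exact: (contM (cont_comp cg (@cP _)) (@cdotF _ _)).
by apply/funext => p; rewrite /f2 dotC.
Qed.

Lemma eint_fgq e s : eint e (fgq e s) = elen e * oneint (hG e s).
Proof.
apply: eint_param => r r01.
by rewrite /fgq /flux_g /avg /jump !etrace_gu// !etrace_u// etrace_q.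
Qed.

Lemma eint_fuw e s : eint e (fuw e s) = elen e * oneint (hD e s).
Proof.
apply: eint_param => r r01; rewrite /fuw /flux_uw /navg /jump dotZl ncon_unit// mulr1.
by rewrite !etrace_u// !etrace_uw// !dotZl !(dotC (W _ _)).
Qed.

Lemma eint_faq e s : eint e (faq e s) = elen e * oneint (hE e s).
Proof.
apply: eint_param => r r01; rewrite /faq /flux_aq /navg /njump dotZl ncon_unit// mulr1.
rewrite /diffquot /jump !etrace_u// !etrace_gu// !etrace_q// !(dotC (F _ _)).
by [].
Qed.

(** The convective flux cancels with the averages of u^2 / 2 because w has no
normal jump; the diffusive flux cancels with the flux of g because the
quotient times the jump of u is the jump of g(u); the terms in C_12 are
opposite.  The upwind and penalty terms remain. *)
Lemma edge_balance e :
  (bnd f1 (adj e true) + bnd f1 (adj e false)) -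
  (bnd f2 (adj e true) + bnd f2 (adj e false)) +
  (eint e (fgq e true) + eint e (fgq e false)) -
  (eint e (fuw e true) + eint e (fuw e false)) +
  (eint e (faq e true) + eint e (faq e false)) =
  - eint e (fun x => (C11 e + alpha wh e / 2) * jump e u x ^+ 2).
Proof.
rewrite (bnd_f1 e true) (bnd_f1 e false) (bnd_f2 e true) (bnd_f2 e false).
rewrite (eint_fgq e true) (eint_fgq e false) (eint_fuw e true) (eint_fuw e false).
rewrite (eint_faq e true) (eint_faq e false).
rewrite (eint_param (h := fun r => (C11 e + alpha wh e / 2) * (jmp e r * jmp e r))); last first.
  by move=> r r01; rewrite /jump !etrace_u// expr2.
rewrite -!mulrDr -!mulrBr -!mulrDr -!mulrBr -!mulrDr -mulrN; congr (_ * _).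
rewrite -!Rintegral01D// -Rintegral01B; [|exact: contD|exact: contD].
rewrite -Rintegral01D; [|exact: (contB (contD (@ch1 e true) (@ch1 e false)) (contD (@ch2 e true) (@ch2 e false)))|exact: contD].
rewrite -Rintegral01B; [|exact: (contD (contB (contD (@ch1 e true) (@ch1 e false)) (contD (@ch2 e true) (@ch2 e false))) (contD (@chG e true) (@chG e false)))|exact: contD].
rewrite -Rintegral01D; [|exact: (contB (contD (contB (contD (@ch1 e true) (@ch1 e false)) (contD (@ch2 e true) (@ch2 e false))) (contD (@chG e true) (@chG e false))) (contD (@chD e true) (@chD e false)))|exact: contD].
rewrite -[RHS]mulN1r -Rintegral01Z; last exact: (contM (contC _) (contM (@cjmp e) (@cjmp e))).
apply: eq_Rintegral => r; rewrite inE => r01.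
have wj : wn e true r = - wn e false r.
  have /hjump : eset e (ept e r) by exists r.
  rewrite /njump !etrace_w// !(dotC (W _ _)) addrC => /eqP.
  by rewrite addr_eq0 => /eqP.
have gj : g (ue e true r) = g (ue e false r) + dq e r * jmp e r.
  have := dquotE g (fun z => Num.sqrt (a z)) (ue e true r, ue e false r).
  by rewrite /= -/(dq e r) -/(jmp e r) => <-; rewrite addrC subrK.
rewrite /h1 /h2 /hG /hD /hE /sgnb wj gj /jmp.
move: (g (ue e false r)) (dq e r) (ue e true r) (ue e false r) (qn e true r)
  (qn e false r) (wn e false r) (c12 e) (C11 e) (alpha wh e).
by move=> *; field.
Qed.

Lemma energy_balance_rep :
  \sum_(K : tria T) tint K (fun x => ut x * u x) + \sum_(K : tria T) tint K (fun x => dot (q x) (q x)) +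
  \sum_(e : edge T) eint e (fun x => (C11 e + alpha wh e / 2) * jump e u x ^+ 2) <= 0.
Proof.
rewrite -big_split/= -lerBrDr sub0r.
apply: (@le_trans _ _ (\sum_(K : tria T) (\sum_i bnd f1 (K, i) - \sum_i bnd f2 (K, i) +
  bint K fgq - bint K fuw + bint K faq))).
  by apply: ler_sum => K _; exact: tri_balance.
rewrite !(big_split, sumrN)/=.
rewrite (sum_adj hT (bnd f1)) (sum_adj hT (bnd f2)) !sum_bint.
rewrite -!sumrN -!big_split/=; apply: ler_sum => e _.
by rewrite -edge_balance lexx.
Qed.

End EnergyBalance.

Section EnergyBalanceDiscrete.
Variables (R : realType) (T : mesh R).

(** The coordinate expressions used above exist for discrete functions; the
Raviart-Thomas field has polynomial coordinates of one degree more. *)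
Lemma energy_balance (a g : R -> R) (wh : 'rV[R]_3 -> 'rV[R]_3) (N : tria T -> int)
    (k l : nat) (u ut : 'rV[R]_3 -> R) (q : 'rV[R]_3 -> 'rV[R]_3) :
  admissible T -> continuous a ->
  (forall z : R, is_derive z 1 g (Num.sqrt (a z))) ->
  RTh T l wh -> Sh T k u -> Sigmah T k q ->
  (forall K, LDG_eq_u a g wh N u ut q K u) ->
  (forall K, LDG_eq_q g N u q K q) ->
  \sum_(K : tria T) tint K (fun x => ut x * u x) +
  \sum_(K : tria T) tint K (fun x => dot (q x) (q x)) +
  \sum_(e : edge T) eint e (fun x => (C11 e + alpha wh e / 2) * jump e u x ^+ 2) <= 0.
Proof.
move=> hT hac hg [hw hj] [_ hu] hq equ eqq.
have /choice[P HP] : forall K : tria T, exists D : (R * R -> R) * (R * R -> R) * (R * R -> R),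
    C1 D.1.1 D.1.2 D.2 /\ forall p, ref_tri p -> u (tpt K p) = D.1.1 p.
  by move=> K; have [P [d1 [d2 H]]] := is_poly_C1 (hu K); exists (P, d1, d2).
pose VV := R * R -> 'rV[R]_3.
have /choice[F HF] : forall K : tria T, exists D : VV * VV * VV,
    C1v D.1.1 D.1.2 D.2 /\ forall p, ref_tri p -> q (tpt K p) = D.1.1 p.
  move=> K; have qj j : is_poly k K (fun x => q x 0 j) by case: (hq j).
  by have [P' [d1 [d2 H]]] := is_poly_C1v qj; exists (P', d1, d2).
have /choice[W HW] : forall K : tria T, exists D : VV * VV * VV,
    C1v D.1.1 D.1.2 D.2 /\ forall p, ref_tri p -> wh (tpt K p) = D.1.1 p.
  move=> K; have [p1 [p2 [p3 [h1 h2 h3 E]]]] := hw K.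
  have [P1 [a1 [b1 [C1' E1]]]] := is_poly_C1 h1.
  have [P2 [a2 [b2 [C2' E2]]]] := is_poly_C1 h2.
  have [P3 [a3 [b3 [C3' E3]]]] := is_poly_C1 h3.
  pose X p := P1 p *: leg1 K + P2 p *: leg2 K + P3 p *: (p.1 *: leg1 K + p.2 *: leg2 K).
  have XE p : ref_tri p -> wh (tpt K p) = X p.
    move=> rp; rewrite E; last by exists p.
    rewrite E1// E2// E3// /X /tpt; congr (_ + _ *: _).
    by rewrite -(addrA (base K)) [LHS]addrC addKr.
  have /choice[D HD] : forall j, exists D : (R * R -> R) * (R * R -> R),
      C1 (fun p => X p 0 j) D.1 D.2.
    move=> j; have C := C1_add (C1_add (C1_mul C1' (C1_cst (leg1 K 0 j)))
      (C1_mul C2' (C1_cst (leg2 K 0 j)))) (C1_mul C3' (C1_lin 0 (leg1 K 0 j) (leg2 K 0 j))).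
    eexists (_, _); rewrite (_ : (fun p => X p 0 j) = fun p =>
      P1 p * leg1 K 0 j + P2 p * leg2 K 0 j +
      P3 p * (0 + p.1 * leg1 K 0 j + p.2 * leg2 K 0 j)); first exact: C.
    by apply/funext => p; rewrite /X !mxE add0r.
  exists (X, (fun p => \row_j (D j).1 p), (fun p => \row_j (D j).2 p)); split => //= j.
  by move: (HD j); congr (C1 _ _ _); apply/funext => p; rewrite mxE.
apply: (@energy_balance_rep R T hT a g hac hg wh N hj u ut q
  (fun K => (P K).1.1) (fun K => (P K).1.2) (fun K => (P K).2)
  (fun K => (F K).1.1) (fun K => (F K).1.2) (fun K => (F K).2)
  (fun K => (W K).1.1) (fun K => (W K).1.2) (fun K => (W K).2)) => //.
all: try by move=> K; case: (HP K).
all: try by move=> K; case: (HF K).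
all: try by move=> K; case: (HW K).
Qed.

End EnergyBalanceDiscrete.

(** * Integrating a dissipation inequality in time *)

Section LowerIntegral.
Local Open Scope ereal_scope.
Context d (X : measurableType d) (R : realType).
Variable mu : {measure set X -> \bar R}.
Import HBNNSimple.

Lemma ge0_le_integral_nomeas (D : set X) (f g : X -> \bar R) :
  (forall x, D x -> 0 <= f x) -> (forall x, D x -> f x <= g x) ->
  \int[mu]_(x in D) f x <= \int[mu]_(x in D) g x.
Proof.
move=> f0 fg; rewrite !ge0_integralE//; last by move=> x Dx; exact: le_trans (f0 _ Dx) (fg _ Dx).
apply: ereal_sup_le => _ [h hf <-]; exists h => // x.
apply: le_trans (hf x) _; rewrite !patchE; case: ifPn => // xD.
by apply: fg; rewrite inE in xD.
Qed.

Lemma ereal_sup_add_le (A B : set \bar R) (c : \bar R) : A 0 -> B 0 ->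
  (forall x y, A x -> B y -> 0 <= x -> 0 <= y -> x + y <= c) ->
  (forall x, A x -> 0 <= x) -> (forall x, B x -> 0 <= x) ->
  ereal_sup A + ereal_sup B <= c.
Proof.
move=> A0 B0 H Ap Bp; have c0 : 0 <= c by rewrite -(adde0 0); exact: H.
have [->|cy] := eqVneq c +oo; first exact: leey.
have cf : c \is a fin_num by rewrite ge0_fin_numE// ltey.
have Ac : ereal_sup A <= c.
  by apply: ge_ereal_sup => x Ax; rewrite -(adde0 x); apply: H => //; exact: Ap.
have Bc : ereal_sup B <= c.
  by apply: ge_ereal_sup => x Bx; rewrite -(add0e x); apply: H => //; exact: Bp.
have fin x : 0 <= x -> x <= c -> x \is a fin_num.
  by move=> x0 xc; rewrite ge0_fin_numE// (le_lt_trans xc)// ltey.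
have sB0 : 0 <= ereal_sup B by exact: ereal_sup_ubound.
have sBf := fin _ sB0 Bc.
rewrite -leeBrDr//; apply: ge_ereal_sup => x Ax; have x0 := Ap _ Ax.
have xf : x \is a fin_num.
  by apply: fin => //; apply: le_trans Ac; exact: ereal_sup_ubound.
rewrite leeBrDr// addeC -leeBrDr//; apply: ge_ereal_sup => y By.
by rewrite leeBrDr// addeC; apply: H => //; exact: Bp.
Qed.

(** The integral of a nonnegative function is a supremum over simple minorants,
and minorants of f and g add up to minorants of f + g.  This serves for the
integrals in time, whose integrands are not known to be measurable. *)
Lemma ge0_integral_superadditive (D : set X) (f g : X -> \bar R) :
  (forall x, D x -> 0 <= f x) -> (forall x, D x -> 0 <= g x) ->
  \int[mu]_(x in D) f x + \int[mu]_(x in D) g x <= \int[mu]_(x in D) (f x + g x).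
Proof.
move=> f0 g0; rewrite !ge0_integralE//; last first.
  by move=> x Dx; rewrite adde_ge0// ?f0 ?g0.
have p0 (h : X -> \bar R) : (forall x, D x -> 0 <= h x) -> forall x, 0 <= (h \_ D) x.
  by move=> h0 x; rewrite patchE; case: ifPn => // xD; apply: h0; rewrite inE in xD.
apply: ereal_sup_add_le.
- by exists nnsfun0; [move=> x; exact: p0|exact: sintegral0].
- by exists nnsfun0; [move=> x; exact: p0|exact: sintegral0].
- move=> _ _ [h hf <-] [k kg <-] _ _.
  rewrite -sintegralD; apply: ereal_sup_ubound => /=.
  exists (add_nnsfun h k) => // x.
  move: (hf x) (kg x); rewrite !patchE; case: ifP => _ hfx kgx.
    by rewrite EFinD leeD.
  by rewrite EFinD; apply: le_trans (leeD hfx kgx) _; rewrite adde0.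
- by move=> _ [h _ <-]; exact: sintegral_ge0.
- by move=> _ [h _ <-]; exact: sintegral_ge0.
Qed.

End LowerIntegral.

Section MonotoneDerivative.
Variable R : realType.
Local Notation mu := (@lebesgue_measure R).

(** The base point -1 makes the primitive differentiable at 0 and beyond. *)
Lemma continuous_primitive (f : R -> R) : continuous f ->
  exists F : R -> R, forall x : R, -1 < x -> is_derive x 1 F (f x).
Proof.
move=> cf; exists (fun x => \int[mu]_(t in `[-1, x]) f t) => x x1.
have xu : x < x + 1 by rewrite ltrDl.
have If : mu.-integrable `[-1, (x + 1)] (EFin \o f).
  apply: continuous_compact_integrable; first exact: segment_compact.
  exact: continuous_subspaceT.
have [D E] := continuous_FTC1_closed xu If x1 (cf x).
by split => //; rewrite -derive1E.
Qed.

(** The integral of the difference quotient is a difference of two means of f,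
over intervals of length dl starting at 0 and at b; monotonicity bounds them
by end values. *)
Lemma int_quotient_le (f : R -> R) (b dl : R) : 0 < b -> 0 < dl -> continuous f ->
  {homo f : x y /~ x <= y} ->
  (\int[mu]_(t in `]0%R, b[) (dl^-1 * (f t - f (t + dl)))%:E <= (f 0 - f (b + dl))%:E)%E.
Proof.
move=> b0 d0 cf hf; have [F dF] := continuous_primitive cf.
have dFs : forall t : R, -1 < t -> is_derive t 1 (fun t => F (t + dl)) (f (t + dl)).
  move=> t t1; have t1' : -1 < t + dl by lra.
  have -> : (fun t => F (t + dl)) = F \o (fun t => t + dl) by [].
  have := @is_derive1_comp R F (shift dl) t _ _ (dF _ t1') (@is_derive_shift R t 1 dl).
  by rewrite mulr1.
pose B (t : R) := dl^-1 * (F t - F (t + dl)).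
have dB : forall t : R, -1 < t -> is_derive t 1 B (dl^-1 * (f t - f (t + dl))).
  move=> t t1; have := dF _ t1; have := dFs _ t1 => H1 H2.
  by apply: is_deriveZ.
have cB (t : R) : -1 < t -> {for t, continuous B}.
  move=> t1; apply: differentiable_continuous; apply/derivable1_diffP.
  by case: (dB _ t1).
have cq : continuous (fun t : R => dl^-1 * (f t - f (t + dl))).
  apply: (contM (contC _) (contB cf _)).
  exact: (cont_comp cf (contD cont_id (contC dl))).
rewrite -(@integral_itv_bndoo _ _ _ _ true false); last first.
  by apply/measurable_EFinP; apply: measurable_funTS; exact: continuous_measurable_fun.
rewrite (@continuous_FTC2 _ _ B)//; last 3 first.
- exact: continuous_subspaceT.
- split; first by move=> x; rewrite in_itv/= => /andP[x0 _]; case: (dB x) => //; lra.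
  + by apply: cvg_at_right_filter; apply: cB; lra.
  + by apply: cvg_at_left_filter; apply: cB; lra.
- move=> x; rewrite in_itv/= => /andP[x0 _]; rewrite derive1E.
  by case: (dB x) => //; lra.
rewrite -EFinB lee_fin /B add0r.
have mvt t : 0 <= t -> exists2 c, t < c < t + dl & F (t + dl) - F t = f c * dl.
  move=> t0; have td : t < t + dl by rewrite ltrDl.
  have [||c] := @MVT R F f t (t + dl) td.
  - by move=> x; rewrite in_itv/= => /andP[tx _]; apply: dF; lra.
  - apply: derivable_within_continuous => x; rewrite in_itv/= => /andP[tx _].
    by case: (dF x) => //; lra.
  - by rewrite in_itv/= => cI ->; exists c => //; congr (_ * _); ring.
have [c /andP[c1 c2] Ec] := mvt b (ltW b0).
have [e /andP[e1 e2]] := mvt 0 (lexx _); rewrite add0r => Ee.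
have -> : dl^-1 * (F b - F (b + dl)) - dl^-1 * (F 0 - F dl) =
   dl^-1 * ((F dl - F 0) - (F (b + dl) - F b)) by ring.
rewrite Ec Ee -mulrBl mulrC mulfK ?gt_eqF//.
have := hf _ _ (ltW e1); have := hf _ _ (ltW c2); lra.
Qed.

(** E is nonincreasing, so its difference quotients are nonnegative and Fatou's
lemma applies; this replaces the fundamental theorem of calculus, which would
ask for continuity of E'. *)
Lemma int_derivative_le (E : R -> R) (b : R) (h : R -> \bar R) : 0 < b ->
  {within `[0, b]%classic, continuous E} ->
  (forall t : R, t \in `[0, b] -> (0 <= h t)%E) ->
  (forall t : R, t \in `]0, b[ -> derivable E t 1 /\ (h t <= (- derive1 E t)%:E)%E) ->
  (\int[mu]_(t in `[0%R, b]) h t <= (E 0 - E b)%:E)%E.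
Proof.
move=> b0 cE h0 hE.
have b00 : 0 <= b by exact: ltW.
have hb (t : R) : t \in `]0, b[ -> t \in `[0, b] by exact: subset_itv_oo_cc.
have E'0 (t : R) : t \in `]0, b[ -> derive1 E t <= 0.
  move=> tb; have [_ ht] := hE t tb; rewrite -oppr_ge0 -lee_fin.
  exact: le_trans (h0 _ (hb _ tb)) ht.
have mono : {in `[0, b] &, {homo E : x y /~ x <= y}}.
  by apply: ler0_derive1_le_cc => // t tb; case: (hE t tb).
(* constant extension of E to the whole line *)
pose cl (t : R) := Num.max 0 (Num.min t b).
have clI t : cl t \in `[0, b].
  by rewrite in_itv/= /cl le_max lexx/= ge_max b00 ge_min lexx orbT.
have clE (t : R) : t \in `[0, b] -> cl t = t.
  rewrite in_itv/= => /andP[t0 tb]; rewrite /cl.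
  by rewrite (min_idPl tb) (max_idPr t0).
pose f t := E (cl t).
have cf : continuous f.
  have ccl : continuous cl.
    move=> t; apply: (@continuous_max _ _ (fun=> 0) (fun t => Num.min t b)).
      exact: cvg_cst.
    by apply: (@continuous_min _ _ id (fun=> b)); [exact: cvg_id|exact: cvg_cst].
  move=> t; have := (subspace_continuousP _ _).1 cE _ (clI t); apply: cvg_comp.
  move=> B /= HB; have := ccl t _ HB.
  by rewrite !nbhs_simpl/=; apply: filterS => y; apply; exact: clI.
have hf : {homo f : x y /~ x <= y}.
  move=> x y xy; apply: mono; [exact: clI|exact: clI|].
  by rewrite /cl; apply: le_max2 => //; apply: le_min2.
pose G n (t : R) : R := (n.+1%:R^-1)^-1 * (f t - f (t + n.+1%:R^-1)).
have G0 n (t : R) : 0 <= G n t.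
  by rewrite /G invrK mulr_ge0// subr_ge0 hf// lerDl.
have mG n : measurable_fun `]0, b[ (fun t => (G n t)%:E).
  apply/measurable_EFinP; apply: measurable_funTS; apply: continuous_measurable_fun.
  apply: (contM (contC _) (contB cf _)).
  exact: (cont_comp cf (contD cont_id (contC _))).
have GE (t : R) : t \in `]0, b[ -> (G n t)%:E @[n --> \oo] --> (- derive1 E t)%:E.
  move=> tb; have [Dt _] := hE t tb.
  apply: cvg_EFin; first by apply: nearW.
  have qE : (fun d : R => d^-1 *: (f (d *: 1 + t) - f t)) d @[d --> 0^'] --> derive1 E t.
    rewrite derive1E; have : {near t, E =1 f}.
      near=> s; rewrite /f clE//; apply: hb; near: s; exact: near_in_itvoo.
    move=> nE; have := near_eq_derivable nE Dt; rewrite (near_eq_derive _ nE).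
    exact.
  have dn : (n.+1%:R^-1 : R) @[n --> \oo] --> (0 : R)^'.
    move=> B HB; have H : \forall n \near \oo, (@harmonic R n != 0 -> B (harmonic n)).
      exact: (@cvg_harmonic R _ HB).
    suff : \forall n \near \oo, B (@harmonic R n) by [].
    apply: filterS H => n Hn; apply: Hn; by rewrite /harmonic/= invr_eq0 pnatr_eq0.
  have := cvg_comp _ _ dn qE => /cvgN; apply: cvg_trans; apply: near_eq_cvg.
  apply: nearW => n /=.
  rewrite -[LHS]/(- (n.+1%:R^-1^-1 * (f (n.+1%:R^-1 * 1 + t) - f t))).
  by rewrite /G mulr1 -mulrN opprB (addrC t).
pose h' (t : R) : \bar R := if t \in `]0, b[ then (- derive1 E t)%:E else +oo%E.
have h'E : {in `]0, b[%classic, h' =1 fun t => (- derive1 E t)%:E}.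
  by move=> t; rewrite inE/= /h' => ->.
have mE : measurable_fun `]0, b[ (fun t => (- derive1 E t)%:E).
  by apply: (emeasurable_fun_cvg (fun n t => (G n t)%:E)) => // t; exact: GE.
have mh' : measurable_fun `]0, b[ h'.
  by apply: eq_measurable_fun mE => t tb; rewrite h'E.
apply: (@le_trans _ _ (\int[mu]_(t in `[0%R, b]) h' t)%E).
  apply: ge0_le_integral_nomeas; first by move=> t; exact: h0.
  move=> t tb; rewrite /h'; case: ifPn => [tb'|_]; last exact: leey.
  by have [] := hE t tb'.
rewrite [leLHS](_ : _ = \int[mu]_(t in `]0%R, b[) limn_einf (fun n => (G n t)%:E))%E; last first.
  rewrite integral_itv_bndoo//; apply: eq_integral => t tb; rewrite (h'E t tb).
  by move: tb; rewrite inE/= => tb; have [->] := cvg_limn_einf_sup (GE t tb).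
apply: (le_trans (fatou _ _ _ _)) => //=; first by move=> n t _; rewrite lee_fin.
rewrite limn_einf_lim; apply: lime_le; first exact: is_cvg_einfs.
apply: nearW => n; apply: (@le_trans _ _ (\int[mu]_(t in `]0%R, b[) (G n t)%:E)%E).
  apply: ereal_inf_lbound; exists n => //=.
apply: le_trans (int_quotient_le b0 _ cf hf) _; first by rewrite invr_gt0.
rewrite lee_fin /f clE; last by rewrite in_itv/= lexx.
suff -> : cl (b + n.+1%:R^-1) = b by [].
by rewrite /cl (min_idPr _) ?(max_idPr _)// lerDl.
Unshelve. all: by end_near. Qed.

End MonotoneDerivative.

(** * The energy as a function of time *)

Section NodalBasis.
Variables (R : realType) (k : nat).

(** All coordinates lie strictly between 0 and 1/2, so that the whole grid of
nodes lies inside the open reference triangle. *)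
Definition node (i : nat) : R := i.+1%:R / (2 * k.+2%:R).
Definition pnode (l : 'I_k.+1 * 'I_k.+1) : R * R := (node l.1, node l.2).
(** Products of Lagrange polynomials in each variable; they interpolate all
polynomials of degree at most k in each variable, and in particular those of
total degree at most k. *)
Definition nodal (l : 'I_k.+1 * 'I_k.+1) (p : R * R) : R :=
  (tnth (qpoly.lagrange k.+1 node) l.1).[p.1] * (tnth (qpoly.lagrange k.+1 node) l.2).[p.2].

Lemma node_inj : injective node.
Proof.
move=> i j /(mulIf _); rewrite invr_eq0 mulf_neq0 ?pnatr_eq0// => /(_ isT).
by move/eqP; rewrite eqr_nat => /eqP [].
Qed.

Lemma pnode_ref l : ref_tri (pnode l).
Proof.
have n0 i : 0 < node i by rewrite divr_gt0// mulr_gt0.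
have n1 (i : 'I_k.+1) : node i < 2^-1.
  rewrite /node invfM mulrCA gtr_pMr// ltr_pdivrMr// mul1r ltr_nat ltnS.
  exact: ltn_ord.
by split => //=; have := n1 l.1; have := n1 l.2; lra.
Qed.

Lemma continuous_nodal l : continuous (nodal l).
Proof.
apply: contM; apply: cont_comp; first exact: continuous_horner.
- exact: continuous_fst.
- exact: continuous_horner.
- exact: continuous_snd.
Qed.

(** Lagrange interpolation, first in x and then in y. *)
Lemma nodal_poly (c : nat -> nat -> R)
    (Q := fun p : R * R => \sum_(i < k.+1) \sum_(j < (k - i).+1) c i j * p.1 ^+ i * p.2 ^+ j) p :
  Q p = \sum_l Q (pnode l) * nodal l p.
Proof.
have interp (f : {poly R}) x : (size f <= k.+1)%N ->
    f.[x] = \sum_(i < k.+1) f.[node i] * (tnth (qpoly.lagrange k.+1 node) i).[x].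
  move=> sf; rewrite {1}(lagrange_gen (ltn0Sn k) node_inj sf) horner_sum.
  by apply: eq_bigr => i _; rewrite hornerM hornerC.
pose A y : {poly R} := \poly_(i < k.+1) (\sum_(j < (k - i).+1) c i j * y ^+ j).
have AE x y : (A y).[x] = Q (x, y).
  rewrite /A horner_poly; apply: eq_bigr => i _; rewrite mulr_suml.
  by apply: eq_bigr => j _ /=; ring.
pose B x : {poly R} := \sum_(i < k.+1) \sum_(j < (k - i).+1) (c i j * x ^+ i) *: 'X^j.
have BE x y : (B x).[y] = Q (x, y).
  rewrite /B horner_sum; apply: eq_bigr => i _; rewrite horner_sum.
  by apply: eq_bigr => j _; rewrite hornerZ hornerXn.
have sB x : (size (B x) <= k.+1)%N.
  apply: (leq_trans (size_sum _ _ _)); apply/bigmax_leqP => i _.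
  apply: (leq_trans (size_sum _ _ _)); apply/bigmax_leqP => j _.
  apply: (leq_trans (size_scale_leq _ _)); rewrite size_polyXn.
  by apply: leq_trans (ltn_ord j) _; rewrite ltnS leq_subr.
case: p => x y; rewrite -AE interp; last exact: size_poly.
rewrite -(pair_bigA _ (fun i j => Q (pnode (i, j)) * nodal (i, j) (x, y)))/=.
apply: eq_bigr => i _; rewrite AE -BE interp// mulr_suml; apply: eq_bigr => j _.
by rewrite BE /nodal/=; ring.
Qed.

Lemma is_poly_nodal (T : mesh R) (K : tria T) v : is_poly k K v ->
  forall p, ref_tri p -> v (tpt K p) = \sum_l v (tpt K (pnode l)) * nodal l p.
Proof.
move=> [c cE] p rp; rewrite cE// nodal_poly; apply: eq_bigr => l _.
by rewrite cE//; exact: pnode_ref.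
Qed.

Definition mass l l' : R := \int[@lebesgue2 R]_(p in @ref_tri R) (nodal l p * nodal l' p).

Lemma Rintegral_ref_sum (I : Type) (s : seq I) (f : I -> R * R -> R) :
  (forall i, continuous (f i)) ->
  \int[@lebesgue2 R]_(p in @ref_tri R) (\sum_(i <- s) f i p) =
  \sum_(i <- s) \int[@lebesgue2 R]_(p in @ref_tri R) f i p.
Proof.
move=> cf; elim: s => [|i s IH].
  rewrite big_nil -[RHS](mul0r (\int[@lebesgue2 R]_(p in @ref_tri R) (0 : R))) -Rintegral_refZ.
    by apply: eq_Rintegral => p _; rewrite big_nil mulr0.
  exact: contC.
rewrite big_cons -IH -Rintegral_refD//; first by apply: eq_Rintegral => p _; rewrite big_cons.
exact: cont_sum.
Qed.

Lemma mass_form (A B : 'I_k.+1 * 'I_k.+1 -> R) :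
  \int[@lebesgue2 R]_(p in @ref_tri R)
    ((\sum_l A l * nodal l p) * (\sum_l B l * nodal l p)) =
  \sum_l \sum_l' A l * B l' * mass l l'.
Proof.
transitivity (\int[@lebesgue2 R]_(p in @ref_tri R)
    (\sum_l \sum_l' (A l * B l') * (nodal l p * nodal l' p))).
  apply: eq_Rintegral => p _; rewrite mulr_suml; apply: eq_bigr => l _.
  by rewrite mulr_sumr; apply: eq_bigr => l' _; ring.
have c l l' : continuous (fun p => nodal l p * nodal l' p).
  by apply: contM; exact: continuous_nodal.
rewrite Rintegral_ref_sum; last first.
  by move=> l; apply: cont_sum => l'; apply: contM => //; exact: contC.
apply: eq_bigr => l _; rewrite Rintegral_ref_sum; last first.
  by move=> l'; apply: contM => //; exact: contC.
by apply: eq_bigr => l' _; rewrite Rintegral_refZ.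
Qed.

End NodalBasis.

Section EnergyInTime.
Variables (R : realType) (T : mesh R) (k : nat) (tf : R).
Variable u : R -> 'rV[R]_3 -> R.
Hypothesis hu : forall t, t \in `[0, tf] -> Sh T k (u t).
Hypothesis cu : forall (K : tria T) x, itri K x ->
  {within `[0, tf]%classic, continuous (fun t => u t x)}.
Hypothesis du : forall (K : tria T) x, itri K x ->
  {in `]0, tf[, forall t, derivable (u^~ x) t 1}.
Implicit Types (t : R) (K : tria T).

Local Notation idx := ('I_k.+1 * 'I_k.+1)%type.

Let U K (l : idx) t : R := u t (tpt K (pnode R l)).

Definition energy t : R := \sum_(K : tria T) tint K (fun x => u t x ^+ 2).

Let inode K l : itri K (tpt K (pnode R (k := k) l)).
Proof. by exists (pnode R l) => //; exact: pnode_ref. Qed.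

Let quad t : R := \sum_(K : tria T) area2 K *
  \sum_(l : idx) \sum_(l' : idx) U K l t * U K l' t * mass R l l'.

Let energy_quad t : t \in `[0, tf] -> energy t = quad t.
Proof.
move=> t0; apply: eq_bigr => K _; rewrite -mass_form /tint; congr (_ * _).
apply: eq_Rintegral => p; rewrite inE => rp; rewrite expr2.
by have [_ /(_ K) pu] := hu t0; rewrite (is_poly_nodal pu rp).
Qed.

Lemma energy_continuous : {within `[0, tf]%classic, continuous energy}.
Proof.
suff cq : continuous (quad : subspace `[0, tf]%classic -> R).
  apply: (subspace_eq_continuous _ cq) => t; rewrite inE => /= t0.
  by rewrite /from_subspace energy_quad.
have cU K l : continuous (U K l : subspace `[0, tf]%classic -> R).
  exact: (cu (inode K l)).
apply: (@cont_sum R (subspace `[0, tf]%classic)) => K.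
apply: (contM (contC _)).
apply: (@cont_sum R (subspace `[0, tf]%classic)) => l.
apply: (@cont_sum R (subspace `[0, tf]%classic)) => l'.
exact: (contM (contM (@cU K l) (@cU K l')) (contC _)).
Qed.

Lemma is_derive_bigsum (I : Type) (s : seq I) (f : I -> R -> R) (df : I -> R) t :
  (forall i, is_derive t 1 (f i) (df i)) ->
  is_derive t 1 (fun t => \sum_(i <- s) f i t) (\sum_(i <- s) df i).
Proof.
move=> H; elim: s => [|i s IH].
  rewrite big_nil (_ : (fun _ => _) = cst 0); first exact: is_derive_cst.
  by apply/funext => x; rewrite big_nil.
rewrite big_cons (_ : (fun _ => _) = f i + (fun t => \sum_(i <- s) f i t)).
  exact: is_deriveD.
by apply/funext => x; rewrite big_cons.
Qed.

(** The nodal values are differentiable in time, and differentiating under the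
integral sign amounts to differentiating a finite sum.  The factor 2 comes from
the symmetry of the mass matrix. *)
Lemma energy_derive t : t \in `]0, tf[ -> is_derive t 1 energy
  (2 * \sum_(K : tria T) tint K (fun x => derive1 (u^~ x) t * u t x)).
Proof.
move=> t0.
have tn : \forall s \near t, s \in `[0, tf].
  by near=> s; apply: subset_itv_oo_cc; near: s; exact: near_in_itvoo.
have t0' : t \in `[0, tf] by exact: subset_itv_oo_cc.
have dU : forall K l, is_derive t 1 (U K l) (derive1 (U K l) t).
  move=> K l; rewrite derive1E; apply: derivableP; exact: (du (inode K l)).
have dut K p : ref_tri p -> derive1 (u^~ (tpt K p)) t =
    \sum_l derive1 (U K l) t * nodal l p.
  move=> rp; rewrite derive1E.
  have E : \forall s \near t, \sum_l U K l s * nodal l p = u s (tpt K p).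
    apply: filterS tn => s s0; have [_ /(_ K) pu] := hu s0.
    by rewrite (is_poly_nodal pu rp).
  rewrite -(@near_eq_derive _ _ _ _ _ t 1 E).
  have [_ ->] // : is_derive t 1 (fun s => \sum_l U K l s * nodal l p)
     (\sum_l derive1 (U K l) t * nodal l p).
  apply: is_derive_bigsum => l.
  have := dU K l => ?; rewrite (_ : (fun _ => _) = U K l * cst (nodal l p))//.
  by apply: is_derive_eq; rewrite /cst /GRing.scale/=; ring.
have tutE K : tint K (fun x => derive1 (u^~ x) t * u t x) = area2 K *
    \sum_(l : idx) \sum_(l' : idx) derive1 (U K l) t * U K l' t * mass R l l'.
  rewrite -mass_form /tint; congr (_ * _).
  apply: eq_Rintegral => p; rewrite inE => rp; rewrite dut//; congr (_ * _).
  by have [_ /(_ K) pu] := hu t0'; rewrite (is_poly_nodal pu rp).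
apply: (@near_eq_is_derive _ _ _ quad).
  by apply: filterS tn => s s0; rewrite energy_quad.
have dq : is_derive t 1 quad (\sum_(K : tria T) area2 K *
    \sum_(l : idx) \sum_(l' : idx)
      (derive1 (U K l) t * U K l' t + U K l t * derive1 (U K l') t) * mass R l l').
  apply: is_derive_bigsum => K; apply: is_deriveZ.
  apply: is_derive_bigsum => l; apply: is_derive_bigsum => l'.
  have := dU K l => ?; have := dU K l' => ?.
  rewrite (_ : (fun _ => _) = (U K l * U K l') * cst (mass R l l'))//.
  by apply: is_derive_eq; rewrite !fctE /cst /GRing.scale/=; ring.
apply: is_derive_eq dq _; rewrite mulr_sumr; apply: eq_bigr => K _.
rewrite tutE mulrCA; congr (_ * _).
under eq_bigr do under eq_bigr do rewrite mulrDl.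
under eq_bigr do rewrite big_split/=.
rewrite big_split/= mulr_natl mulr2n; congr (_ + _).
rewrite exchange_big/=; apply: eq_bigr => l _; apply: eq_bigr => l' _.
rewrite mulrC [in RHS]mulrC (mulrC (U K l' t)); congr (_ * _).
by apply: eq_Rintegral => p _; rewrite mulrC.
Unshelve. all: by end_near. Qed.

End EnergyInTime.

(** * The closest point map is a homeomorphism *)

Section CompactLimits.

Lemma nbhsS (X : topologicalType) (x : X) (A B : set X) :
  A `<=` B -> nbhs x A -> nbhs x B.
Proof. exact: filterS. Qed.

Lemma near_cvg (X Y : topologicalType) (f g : X -> Y) (x : X) (A : set X) (l : Y) :
  nbhs x A -> (forall z, A z -> f z = g z) -> g @ x --> l -> f @ x --> l.
Proof.
move=> nA fg gl; apply: cvg_trans gl; apply: near_eq_cvg.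
by apply: filterS nA => z /fg.
Qed.

(** In a compact set a map converges as soon as it has at most one limit along
finer filters. *)
Lemma compact_unique_cvg (X : Type) (Y : topologicalType) (F : set_system X)
    (f : X -> Y) (B : set Y) (y0 : Y) : Filter F -> compact B -> F (f @^-1` B) ->
  (forall G : set_system X, ProperFilter G -> F `<=` G ->
     forall y, B y -> f @ G --> y -> y = y0) ->
  f @ F --> y0.
Proof.
move=> FF cB FB H V nV; apply: contrapT => nFV.
pose F' := within (~` (f @^-1` V)) F.
have PF' : ProperFilter F'.
  apply: Build_ProperFilter_ex => P FP; apply: contrapT => nP; apply: nFV.
  suff : F (f @^-1` V) by [].
  have : F [set x | ~ V (f x) -> P x] by exact: FP.
  apply: filterS => x /= Px; apply: contrapT => nVx; apply: nP.
  by exists x; exact: Px.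
have [G [UG sG]] := ultraFilterLemma PF'.
have sFG : F `<=` G.
  move=> A FA; apply: sG; suff : F [set x | ~ V (f x) -> A x] by [].
  by apply: filterS FA => x ? ?.
have [y [By cy]] := cB (f @ G) _ (sFG _ FB).
have fy : f @ G --> y.
  move=> W nW; have [//|GnW] := in_ultra_setVsetC (f @^-1` W) UG.
  have [z [nz Wz]] := cy (~` W) W GnW nW.
  by [].
have yE := H G (@ultra_proper _ _ UG) sFG y By fy.
have GV : G (f @^-1` V) by apply: fy; rewrite yE.
have GnV : G (~` (f @^-1` V)).
  apply: sG; suff : F [set x | ~ V (f x) -> ~ V (f x)] by [].
  by apply: (filterS _ FB) => x _ /=.
have [x [/= h1 h2]] := filter_ex (filterI GV GnV).
exact: (h2 h1).
Qed.

End CompactLimits.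

Section Euclid.
Variable R : realType.
Local Notation R3 := ('rV[R]_3).
Implicit Types x y z : R3.

(** Cauchy-Schwarz, in the form of the nonnegativity of the Gram determinant. *)
Lemma enormD x y : enorm (x + y) <= enorm x + enorm y.
Proof.
have h0 (v : R3) : 0 <= enorm v by exact: sqrtr_ge0.
rewrite -(ler_pXn2r (ltn0Sn 1)) ?nnegrE ?addr_ge0//.
rewrite sqrrD !sqr_enorm !dotL (dotC y x).
have : dot x y <= enorm x * enorm y.
  apply: (le_trans (ler_norm _)).
  rewrite -(ler_pXn2r (ltn0Sn 1)) ?nnegrE ?normr_ge0 ?mulr_ge0//.
  by rewrite real_normK ?num_real// exprMn !sqr_enorm -subr_ge0 gram_ge0.
lra.
Qed.

Lemma enormN x : enorm (- x) = enorm x.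
Proof. by rewrite /enorm dotNl dotNr opprK. Qed.

Lemma enorm0 : enorm (0 : R3) = 0.
Proof. by rewrite /enorm dot0l sqrtr0. Qed.

Lemma continuous_enormB y : continuous (fun x => enorm (x - y)).
Proof.
apply: (cont_comp (@sqrt_continuous R)).
rewrite (_ : (fun _ => _) = fun x => \sum_j (x 0 j - y 0 j) * (x 0 j - y 0 j)).
  apply: cont_sum => j.
  exact: (contM (contB (@cont_coordinate R j) (contC _)) (contB (@cont_coordinate R j) (contC _))).
by apply/funext => x; rewrite dotE; apply: eq_bigr => j _; rewrite !mxE.
Qed.

Variable G : surface R.
Hypothesis cG : compact (pts G).
Hypothesis oI : open (inside G).
Hypothesis bI : pts G = closure (inside G) `\` inside G.
Hypothesis nG : pts G !=set0.

Let D x := [set enorm (x - y) | y in pts G].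

Let hasinf x : has_inf (D x).
Proof.
split; first by have [y Gy] := nG; exists (enorm (x - y)); exists y.
by exists 0 => _ [y _ <-]; exact: sqrtr_ge0.
Qed.

Let dist_ge0 x : 0 <= inf (D x).
Proof. by apply: lb_le_inf; [case: (hasinf x)|move=> _ [y _ <-]; exact: sqrtr_ge0]. Qed.

Let dist_lip x z : inf (D x) <= inf (D z) + enorm (x - z).
Proof.
rewrite -lerBlDr; apply: lb_le_inf; first by case: (hasinf z).
move=> _ [y Gy <-]; rewrite lerBlDr.
apply: (@le_trans _ _ (enorm (x - y))).
  by apply: inf_lbound; [case: (hasinf x)|exists y].
rewrite (_ : x - y = (z - y) + (x - z)); first exact: enormD.
by rewrite [RHS]addrC addrA subrK.
Qed.

Let dist_cont : continuous (fun x => inf (D x)).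
Proof.
move=> x; apply/(@cvgrPdist_lt _ _ _ (nbhs x) (nbhs_filter x)) => e e0.
have := @continuous_enormB x x; rewrite /continuous_at => /(@cvgrPdist_lt _ _ _ (nbhs x) (nbhs_filter x)) /(_ _ e0).
apply: nbhsS => z /=; rewrite subrr enorm0 sub0r normrN ger0_norm ?sqrtr_ge0// => ze.
have := dist_lip x z; have := dist_lip z x.
rewrite -(enormN (x - z)) opprB => h1 h2; rewrite ltr_norml; apply/andP; split; lra.
Qed.

Let sdistE x : sdist G x = if `[< inside G x >] then - inf (D x) else inf (D x).
Proof. by []. Qed.

(** The distance to the surface is 1-Lipschitz.  Its sign is locally constant off
the surface, and on the surface the distance vanishes. *)
Lemma continuous_sdist : continuous (sdist G).
Proof.
move=> x; have [Ix|nIx] := pselect (inside G x).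
  have sx : sdist G x = - inf (D x) by rewrite sdistE ifT//; exact/asboolP.
  rewrite /continuous_at sx.
  apply: (near_cvg (open_nbhs_nbhs (conj oI Ix)) _ (cvgN (@dist_cont x))) => z Iz.
  by rewrite sdistE ifT//; exact/asboolP.
have sx : sdist G x = inf (D x) by rewrite sdistE ifF//; exact/asboolPn.
rewrite /continuous_at sx.
have [cIx|ncIx] := pselect (closure (inside G) x); last first.
  have oC : open (~` closure (inside G)) by apply: closed_openC; exact: closed_closure.
  apply: (near_cvg (open_nbhs_nbhs (conj oC ncIx)) _ (@dist_cont x)) => z nz.
  rewrite sdistE ifF//; apply/asboolPn => Iz.
  by apply: nz; exact: subset_closure.
have d0 : inf (D x) = 0.
  apply/eqP; rewrite eq_le dist_ge0 andbT; apply: inf_lbound; first by case: (hasinf x).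
  by exists x; [rewrite bI|rewrite subrr enorm0].
apply/(@cvgrPdist_lt _ _ _ (nbhs x) (nbhs_filter x)) => e e0; have := @dist_cont x; rewrite /continuous_at => /(@cvgrPdist_lt _ _ _ (nbhs x) (nbhs_filter x)) /(_ _ e0).
apply: nbhsS => z; rewrite d0 !sub0r !normrN sdistE.
by case: ifP => _; rewrite ?normrN.
Qed.

End Euclid.

Section SurfaceHomeo.
Variables (R : realType) (m : nat) (G : surface R) (Nb : set 'rV[R]_3) (T : mesh R).
Local Notation R3 := ('rV[R]_3).
Hypothesis hG : closed_oriented_surface m G.
Hypothesis hNb : tubular_nbhd G Nb.
Hypothesis hGh : Gh T `<=` Nb.
Hypothesis hbij : set_bij (Gh T) (pts G) (zeta G).
Implicit Types x y : R3.

Lemma compact_pts : compact (pts G).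
Proof. by case: hG => -[]. Qed.

Lemma closed_pts : closed (pts G).
Proof. exact: compact_closed (@norm_hausdorff _ _) compact_pts. Qed.

Lemma compact_ctri (K : tria T) : compact (ctri K).
Proof.
rewrite /ctri; apply: continuous_compact; first exact/continuous_subspaceT/continuous_tpt.
apply: (@subclosed_compact _ _ (`[0 : R, 1]%classic `*` `[0 : R, 1]%classic)).
- have -> : @cref_tri R = [set p | 0 <= p.1] `&` [set p | 0 <= p.2] `&`
    [set p | p.1 + p.2 <= 1].
    by apply/seteqP; split => [p [? ? ?]|p [[? ?] ?]].
  apply: closedI; [apply: closedI|].
  + by apply: (@closed_comp _ _ fst [set x : R | 0 <= x]); [move=> p _; exact: cvg_fst|exact: closed_ge].
  + by apply: (@closed_comp _ _ snd [set x : R | 0 <= x]); [move=> p _; exact: cvg_snd|exact: closed_ge].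
  + apply: (@closed_comp _ _ (fun p : R * R => p.1 + p.2) [set x : R | x <= 1]); last exact: closed_le.
    by move=> p _; exact: (contD (@continuous_fst R) (@continuous_snd R)).
- by apply: compact_setX; exact: segment_compact.
- by move=> [x y] [/= *]; split; rewrite /= in_itv/=; apply/andP; split; lra.
Qed.

Lemma compact_Gh : compact (Gh T).
Proof.
have -> : Gh T = \big[setU/set0]_(K <- enum (tria T)) ctri K.
  rewrite -bigcup_seq; apply/seteqP; split => x [K _ Kx]; exists K => //=.
  by rewrite mem_enum.
by apply: bigsetU_compact => K _; exact: compact_ctri.
Qed.

Lemma closed_Gh : closed (Gh T).
Proof. exact: compact_closed (@norm_hausdorff _ _) compact_Gh. Qed.

Lemma zeta_foot x : Gh T x -> foot G x (zeta G x).
Proof.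
move=> /hGh Nx; have [_ _ /(_ _ Nx)[y [fy _]]] := hNb.
exact: (xgetPex 0 (ex_intro _ y fy : exists y, [set y | foot G x y] y)).
Qed.

Lemma foot_unique x y : Gh T x -> foot G x y -> y = zeta G x.
Proof.
move=> Gx fy; have [_ _ /(_ _ (hGh Gx))[y' [_ U]]] := hNb.
by rewrite -(U _ fy) -(U _ (zeta_foot Gx)).
Qed.

Lemma zeta_pts x : Gh T x -> pts G (zeta G x).
Proof. by move=> /zeta_foot[]. Qed.

Lemma unliftP y : pts G y -> Gh T (unlift_pt G T y) /\ zeta G (unlift_pt G T y) = y.
Proof.
move=> Gy; have [_ _ /(_ y Gy)[x Gx xy]] := hbij.
exact: (xgetPex 0 (ex_intro _ x (conj Gx xy) :
  exists x, [set x | Gh T x /\ zeta G x = y] x)).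
Qed.

Lemma zetaK x : Gh T x -> unlift_pt G T (zeta G x) = x.
Proof.
move=> Gx; have [Gx' E] := unliftP (zeta_pts Gx); have [_ inj _] := hbij.
by apply: inj => //; rewrite inE.
Qed.

(** The graph of the closest point map is closed, because the signed distance
and the normal are continuous. *)
Lemma continuous_zeta x : Gh T x -> zeta G @ within (Gh T) (nbhs x) --> zeta G x.
Proof.
move=> Gx; have [[cG nG] [oI bI] _ _ [cn _]] := hG.
have win : within (Gh T) (nbhs x) (Gh T) by exact: withinT.
apply: (compact_unique_cvg _ compact_pts).
  by apply: filterS win => z; exact: zeta_pts.
move=> F PF sF y Gy zy; apply: foot_unique => //; split => //.
have FGh : F (Gh T) := sF _ win.
have Fx : id @ F --> x.
  by move=> V nV; apply: sF; apply: filterS nV.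
have Fs : sdist G @ F --> sdist G x.
  exact: (cvg_comp id _ Fx (@continuous_sdist R G oI bI nG x)).
have Fn : (normal G \o zeta G) @ F --> normal G y.
  apply: (cvg_comp (zeta G) (normal G) _ ((subspace_continuousP _ _).1 cn y Gy)).
  move=> V /zy; rewrite !nbhs_simpl/= => FV.
  apply: filterS (filterI FGh FV) => z /= [Gz]; apply; exact: zeta_pts.
have lim : (fun z => zeta G z + sdist G z *: normal G (zeta G z)) @ F -->
   y + sdist G x *: normal G y.
  by apply: cvgD => //; exact: cvgZ.
have E : (fun z => zeta G z + sdist G z *: normal G (zeta G z)) @ F --> x.
  apply: cvg_trans Fx; apply: near_eq_cvg; apply: filterS FGh => z Gz.
  by have [_ {1}->] := zeta_foot Gz.
exact: (cvg_unique (@norm_hausdorff _ _) E lim).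
Qed.

(** A limit of preimages has, by continuity of the closest point map, the
expected image, and that map is one-to-one. *)
Lemma continuous_unlift y : pts G y ->
  unlift_pt G T @ within (pts G) (nbhs y) --> unlift_pt G T y.
Proof.
move=> Gy; have win : within (pts G) (nbhs y) (pts G) by exact: withinT.
apply: (compact_unique_cvg _ compact_Gh).
  by apply: filterS win => z /unliftP[].
move=> F PF sF x Gx ux; have FG : F (pts G) := sF _ win.
have Fy : id @ F --> y.
  by move=> V nV; apply: sF; apply: filterS nV.
have zu : (zeta G \o unlift_pt G T) @ F --> zeta G x.
  apply: (cvg_comp (unlift_pt G T) (zeta G) _ (continuous_zeta Gx)).
  move=> V /ux; rewrite !nbhs_simpl/= => FV.
  by apply: filterS (filterI FG FV) => z /= [/unliftP[Gz _]]; apply.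
have zu' : (zeta G \o unlift_pt G T) @ F --> y.
  apply: cvg_trans Fy; apply: near_eq_cvg; apply: filterS FG => z /unliftP[_ /= ->].
  by [].
by rewrite -(cvg_unique (@norm_hausdorff _ _) zu zu') zetaK.
Qed.

End SurfaceHomeo.

(** * Integrals over the smooth surface *)

Section IntegralTransfer.
Local Open Scope ereal_scope.
Context d1 d2 (X : measurableType d1) (Y : measurableType d2) (R : realType).
Variables (I : finType) (c : I -> R) (nu : {measure set X -> \bar R}).
Variables (D : I -> set X) (phi : I -> X -> Y) (dens : I -> X -> R).
Variable mu : {measure set Y -> \bar R}.
Hypothesis c0 : forall i, (0 <= c i)%R.
Hypothesis mD : forall i, measurable (D i).
Hypothesis mphi : forall i, measurable_fun (D i) (phi i).
Hypothesis mdens : forall i, measurable_fun (D i) (dens i).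
Hypothesis dens0 : forall i x, D i x -> (0 <= dens i x)%R.
Hypothesis muE : forall B, measurable B ->
  mu B = \sum_i (c i)%:E * \int[nu]_(x in D i) (dens i x * \1_B (phi i x))%:E.
Import HBNNSimple.

Let mindic i B : measurable B ->
  measurable_fun (D i) (fun x => (dens i x * \1_B (phi i x))%:E).
Proof.
move=> mB; apply/measurable_EFinP; apply: measurable_funM => //.
apply: (measurableT_comp (f := (\1_B : Y -> R))) => //; exact: measurable_indic.
Qed.

(** The description of mu on measurable sets extends to nonnegative measurable
functions, by approximation with simple functions. *)
Lemma ge0_integral_transfer (f : Y -> \bar R) :
  measurable_fun setT f -> (forall y, 0 <= f y) ->
  \int[mu]_y f y = \sum_i (c i)%:E * \int[nu]_(x in D i) ((dens i x)%:E * f (phi i x)).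
Proof.
move=> mf f0.
pose f_ := nnsfun_approx measurableT mf.
have step n : \int[mu]_y (f_ n y)%:E =
    \sum_i (c i)%:E * \int[nu]_(x in D i) (dens i x * f_ n (phi i x))%:E.
  transitivity (\sum_(r \in range (f_ n)) r%:E * mu (f_ n @^-1` [set r])).
    by rewrite integralT_nnsfun sintegralE.
  transitivity (\sum_(r \in range (f_ n)) \sum_i (c i)%:E *
      \int[nu]_(x in D i) (r * (dens i x * \1_(f_ n @^-1` [set r]) (phi i x)))%:E).
    apply: eq_fsbigr => r; rewrite inE => -[y _ yr].
    have r0 : (0 <= r)%R by rewrite -yr.
    rewrite muE// ge0_sume_distrr; last first.
      move=> i _; apply: mule_ge0; first by rewrite lee_fin.
      by apply: integral_ge0 => x Dx; rewrite lee_fin mulr_ge0// dens0.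
    apply: eq_bigr => i _; rewrite muleCA; congr (_ * _).
    rewrite -ge0_integralZl//; last 2 first.
    - exact: mindic.
    - by move=> x Dx; rewrite lee_fin mulr_ge0// dens0.
  rewrite fsbig_finite//= exchange_big/=; apply: eq_bigr => i _.
  rewrite -ge0_sume_distrr; last first.
    move=> r _; apply: integral_ge0 => x Dx; rewrite lee_fin mulrCA mulr_ge0 ?dens0//.
    exact: nnfun_muleindic_ge0.
  congr (_ * _); rewrite -fsbig_finite// -ge0_integral_fsum//.
  - apply: eq_integral => x _; rewrite fsumEFin//; congr EFin.
    under eq_fsbigr do rewrite mulrCA.
    rewrite [in RHS]fimfunE fsbig_finite//= [in RHS]fsbig_finite//= mulr_sumr.
    by [].
  - move=> r; rewrite (_ : (fun _ => _) =
      fun x => r%:E * (dens i x * \1_(f_ n @^-1` [set r]) (phi i x))%:E).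
      by apply: measurable_funeM; exact: mindic.
    by apply/funext => x; rewrite -EFinM.
  - move=> r x Dx; rewrite lee_fin mulrCA mulr_ge0 ?dens0//.
    exact: nnfun_muleindic_ge0.
have cvgL : \int[mu]_y (f_ n y)%:E @[n --> \oo] --> \int[mu]_y f y.
  rewrite (_ : \int[mu]_y f y = \int[mu]_y limn (fun n => (f_ n y)%:E)); last first.
    by apply: eq_integral => y _; apply/esym/cvg_lim => //; exact: cvg_nnsfun_approx.
  apply: cvg_monotone_convergence => //.
  - by move=> n; exact/measurable_EFinP/measurable_funP.
  - by move=> n y _; rewrite lee_fin.
  - by move=> y _ k l kl; rewrite lee_fin; exact/lefP/nd_nnsfun_approx.
have cvgR i : \int[nu]_(x in D i) (dens i x * f_ n (phi i x))%:E @[n --> \oo] -->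
    \int[nu]_(x in D i) ((dens i x)%:E * f (phi i x)).
  rewrite (_ : \int[nu]_(x in D i) ((dens i x)%:E * f (phi i x)) =
     \int[nu]_(x in D i) limn (fun n => (dens i x * f_ n (phi i x))%:E)); last first.
    apply: eq_integral => x _; apply/esym/cvg_lim => //.
    under eq_fun do rewrite EFinM.
    by apply: cvgeZl => //; exact: cvg_nnsfun_approx.
  apply: cvg_monotone_convergence => //.
  - move=> n; apply/measurable_EFinP; apply: measurable_funM => //.
    by apply: (measurableT_comp (f := f_ n)) => //; exact: measurable_funP.
  - by move=> n x Dx; rewrite lee_fin mulr_ge0// dens0.
  - move=> x Dx k l kl; rewrite lee_fin ler_wpM2l// ?dens0//.
    exact/lefP/nd_nnsfun_approx.
have cvgR' : \sum_i (c i)%:E * \int[nu]_(x in D i) (dens i x * f_ n (phi i x))%:E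
    @[n --> \oo] --> \sum_i (c i)%:E * \int[nu]_(x in D i) ((dens i x)%:E * f (phi i x)).
  apply: cvg_nnesum => [i _|i _]; first apply: nearW => n.
    apply: mule_ge0; first by rewrite lee_fin.
    by apply: integral_ge0 => x Dx; rewrite lee_fin mulr_ge0// dens0.
  by apply: cvgeZl => //; exact: cvgR.
have stepE := funext step.
rewrite stepE in cvgL; exact: (cvg_unique (@ereal_hausdorff R) cvgL cvgR').
Qed.

End IntegralTransfer.

Section RelativeContinuity.

Lemma within_comp (X Y Z : topologicalType) (f : X -> Y) (g : Y -> Z) (A : set X) (B : set Y) :
  {within A, continuous f} -> (forall x, A x -> B (f x)) ->
  (forall y, B y -> g @ within B (nbhs y) --> g y) ->
  {within A, continuous (g \o f)}.
Proof.
move=> cf AB cg; apply/subspace_continuousP => x Ax.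
apply: (cvg_comp f g _ (cg _ (AB _ Ax))).
move=> V nV; have := (subspace_continuousP _ _).1 cf x Ax _ nV.
rewrite !nbhs_simpl/= => H; suff : nbhs x [set z | A z -> V (f z)] by [].
by apply: nbhsS H => z Hz Az; exact: (Hz Az (AB _ Az)).
Qed.

Lemma within_open (X Y : topologicalType) (f : X -> Y) (A : set X) (W : set Y) :
  {within A, continuous f} -> open W -> exists2 V, open V & A `&` f @^-1` W = A `&` V.
Proof.
move=> /continuousP cf oW; have /open_subspaceP[V oV VE] := cf _ oW.
by exists V => //; rewrite setIC -VE setIC.
Qed.

End RelativeContinuity.

Section BorelSpace.
Variable R : realType.
Local Notation R3 := ('rV[R]_3).
Local Notation B3 := (borel3 R).
Local Notation RR := (measurableTypeR R * measurableTypeR R)%type.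

Lemma measurable_inv_pos d (X : measurableType d) (D : set X) (f : X -> R) :
  measurable_fun D f -> (forall x, D x -> 0 < f x) ->
  measurable_fun D (fun x => (f x)^-1).
Proof.
move=> mf f0; apply: (@measurable_comp _ _ _ _ _ _ [set x : R | x != 0] (@GRing.inv R) D f) => //.
- by apply: open_measurable; exact: open_neq.
- by move=> _ [x Dx <-] /=; rewrite gt_eqF// f0.
- apply: open_continuous_measurable_fun; first exact: open_neq.
  by move=> x; rewrite inE/= => x0; exact: inv_continuous.
Qed.

Lemma open_borel (W : set R3) : open W -> measurable (W : set B3).
Proof. by move=> oW; exact: sub_sigma_algebra. Qed.

Lemma closed_borel (W : set R3) : closed W -> measurable (W : set B3).
Proof.
by move=> cW; rewrite -(setCK W); apply: measurableC; apply: open_borel; exact: closed_openC.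
Qed.

(** Open sets generate the Borel sigma-algebra. *)
Lemma measurable_borel d (X : measurableType d) (D : set X) (f : X -> B3) :
  (forall W : set R3, open W -> measurable (D `&` f @^-1` W)) -> measurable_fun D f.
Proof.
move=> H; apply: (@measurability _ _ X (borel3 R) D f (@open R3) erefl).
by move=> _ [W oW <-]; exact: H.
Qed.

Lemma within_borel (D : set R3) (f : R3 -> R3) : measurable (D : set B3) ->
  {within D, continuous f} -> measurable_fun (D : set B3) (f : B3 -> B3).
Proof.
move=> mD cf; apply: measurable_borel => W oW.
by have [V oV ->] := within_open cf oW; apply: measurableI => //; exact: open_borel.
Qed.

Lemma itv_open (a b : R) : open `]a, b[%classic.
Proof. exact: interval_open. Qed.

Lemma within_borelR (D : set R3) (f : R3 -> R) : measurable (D : set B3) ->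
  {within D, continuous f} -> measurable_fun (D : set B3) (f : B3 -> R).
Proof.
move=> mD cf; apply: (measurability _ (measurable_realfun.RGenOpens.measurableE R)).
move=> _ [_ [a [b ->] <-]]; have [V oV ->] := within_open cf (@itv_open a b).
by apply: measurableI => //; exact: open_borel.
Qed.

Lemma within_borel2 (D : set (R * R)) (f : R * R -> R3) : measurable (D : set RR) ->
  {within D, continuous f} -> measurable_fun (D : set RR) (f : RR -> B3).
Proof.
move=> mD cf; apply: measurable_borel => W oW.
by have [V oV ->] := within_open cf oW; apply: measurableI => //; exact: open_measurable2.
Qed.

Lemma within_borel1 (D : set R) (f : R -> R3) : measurable (D : set (measurableTypeR R)) ->
  {within D, continuous f} ->
  measurable_fun (D : set (measurableTypeR R)) (f : measurableTypeR R -> B3).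
Proof.
move=> mD cf; apply: measurable_borel => W oW.
by have [V oV ->] := within_open cf oW; apply: measurableI => //; exact: open_measurable.
Qed.

End BorelSpace.

Section LiftedIntegrals.
Variables (R : realType) (m : nat) (G : surface R) (Nb : set 'rV[R]_3) (T : mesh R).
Local Notation R3 := ('rV[R]_3).
Local Notation B3 := (borel3 R).
Local Notation mu := (@lebesgue_measure R).
Hypothesis hG : closed_oriented_surface m G.
Hypothesis hNb : tubular_nbhd G Nb.
Hypothesis hT : admissible T.
Hypothesis hGh : Gh T `<=` Nb.
Hypothesis hbij : set_bij (Gh T) (pts G) (zeta G).
Implicit Types (K : tria T) (e : edge T) (s : bool).

Let zc := continuous_zeta hG hNb hGh.
Let uc := continuous_unlift hG hNb hGh hbij.
Let zP := zeta_pts hNb hGh.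
Let uP := unliftP hbij.
Let zK := zetaK hNb hGh hbij.

Lemma measurable_pts : measurable (pts G : set B3).
Proof. by apply: closed_borel; exact: (closed_pts hG). Qed.

Lemma measurable_Gh : measurable (Gh T : set B3).
Proof. by apply: closed_borel; exact: closed_Gh. Qed.

Lemma within_unlift : {within pts G, continuous (unlift_pt G T)}.
Proof. by apply/subspace_continuousP => y; exact: uc. Qed.

Lemma within_zeta : {within Gh T, continuous (zeta G)}.
Proof. by apply/subspace_continuousP => x; exact: zc. Qed.

Lemma tpt_Gh K p : ref_tri p -> Gh T (tpt K p).
Proof. by move=> rp; exists K => //; apply: itri_ctri; exists p. Qed.

Lemma ept_Gh e r : r \in `[0, 1] -> Gh T (ept e r).
Proof. by move=> r01; exists (adj e true).1 => //; exact: ept_ctri. Qed.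

(** The weight 1 / delta cancels the density delta of the surface measure. *)
Lemma ge0_surface_integral (dA : {measure set B3 -> \bar R}) (delta F : R3 -> R) :
  surface_quotient G T dA delta ->
  measurable_fun (Gh T : set B3) (F : B3 -> R) -> (forall x, 0 <= F x) ->
  (\int[dA]_(y in pts G) ((glift G T delta y)^-1 * glift G T F y)%:E =
   \sum_(K : tria T) tinte K (fun x => (F x)%:E))%E.
Proof.
move=> [md dpos dE] mF F0; rewrite integral_mkcond.
set f := _ \_ _.
have mlift (H : R3 -> R) : measurable_fun (Gh T : set B3) (H : B3 -> R) ->
    measurable_fun (pts G : set B3) (glift G T H : B3 -> R).
  move=> mH; apply: (measurable_comp measurable_Gh _ mH).
    by move=> _ [y Gy <-]; case: (uP Gy).
  exact: (within_borel measurable_pts within_unlift).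
have mf : measurable_fun setT f.
  apply/(measurable_restrictT _ measurable_pts)/measurable_EFinP.
  apply: measurable_funM; last exact: mlift.
  by apply: measurable_inv_pos; [exact: mlift|move=> y /uP[? _]; exact: dpos].
have f0 y : (0 <= f y)%E.
  rewrite /f patchE; case: ifPn => // yG; rewrite lee_fin; apply: mulr_ge0; last exact: F0.
  by rewrite inE in yG; rewrite invr_ge0; apply/ltW/dpos; case: (uP yG).
have mt K : measurable_fun (@ref_tri R : set (measurableTypeR R * measurableTypeR R)%type)
    (tpt K : (measurableTypeR R * measurableTypeR R)%type -> B3).
  apply: within_borel2; first exact: measurable_ref_tri.
  exact/continuous_subspaceT/continuous_tpt.
rewrite (@ge0_integral_transfer _ _ _ (borel3 R) R (tria T) (fun K => area2 K) (@lebesgue2 R)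
  (fun=> @ref_tri R) (fun K p => zeta G (tpt K p)) (fun K p => delta (tpt K p)) dA)//.
- apply: eq_bigr => K _; rewrite /tinte; congr (_ * _)%E; apply: eq_integral => p.
  rewrite inE => rp; have Gp := tpt_Gh K rp.
  rewrite /f patchE ifT; last by rewrite inE; exact: zP.
  by rewrite -EFinM /glift zK// mulrA divff ?mul1r// gt_eqF// dpos.
- by move=> K; exact: area_elt_ge0.
- by move=> K; exact: measurable_ref_tri.
- move=> K; apply: within_borel2; first exact: measurable_ref_tri.
  apply: (within_comp (B := Gh T) _ _ zc); last by move=> p rp; exact: tpt_Gh.
  exact/continuous_subspaceT/continuous_tpt.
- move=> K; apply: (measurable_comp measurable_Gh _ md (mt K)).
  by move=> _ [p rp <-]; exact: tpt_Gh.
- by move=> K p rp; apply/ltW/dpos/tpt_Gh.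
Qed.

(** The inverse of the closest point map is continuous, and the image of D
accumulates at the image of x, so the limits defining the two traces agree. *)
Lemma trace_lift (D : set R3) (v w : R3 -> R) x : D `<=` Gh T -> closure D x -> Gh T x ->
  {in D, v =1 w} -> {for x, continuous w} ->
  trace (zeta G @` D) (glift G T v) (zeta G x) = w x.
Proof.
move=> DG cD Gx vw cw.
have cD' : closure (zeta G @` D) (zeta G x).
  move=> V nV; have := zc Gx nV; rewrite nbhs_simpl/= => H.
  have {}H : nbhs x [set z | Gh T z -> V (zeta G z)] by [].
  have [z [Dz Hz]] := cD _ H.
  by exists (zeta G z); split; [exists z|apply: Hz; exact: DG].
have P : ProperFilter (within (zeta G @` D) (nbhs (zeta G x))) by exact: within_nbhs_proper.
apply: cvg_lim; first exact: Rhausdorff.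
have Gy := zP Gx.
have cu : (w \o unlift_pt G T) @ within (pts G) (nbhs (zeta G x)) --> w x.
  apply: (cvg_comp (unlift_pt G T) w (uc Gy)); rewrite zK//; exact: cw.
move=> V nV; have := cu _ nV; rewrite !nbhs_simpl/= => H.
suff : nbhs (zeta G x) [set y | (zeta G @` D) y -> V (glift G T v y)] by [].
apply: nbhsS H => y /= Hy [z Dz zy]; have Gz := DG _ Dz.
have := Hy; rewrite -zy /glift zK// vw ?inE//; apply; exact: zP.
Qed.

Section OneTime.
Variables (k : nat) (u : R3 -> R) (P : tria T -> R * R -> R).
Hypothesis cP : forall K, continuous (P K).
Hypothesis uPE : forall K p, ref_tri p -> u (tpt K p) = P K p.

Lemma jumpl_param e r : r \in `[0, 1] ->
  jumpl G e (glift G T u) (zeta G (ept e r)) =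
  P (adj e true).1 (ecoord e true r) - P (adj e false).1 (ecoord e false r).
Proof.
move=> r01.
have H s : trace (zeta G @` itri (adj e s).1) (glift G T u) (zeta G (ept e r)) =
    P (adj e s).1 (ecoord e s r).
  apply: (@trace_lift _ u (fun x => P (adj e s).1 (coord (adj e s).1 x))).
  - by move=> _ [p rp <-]; exact: tpt_Gh.
  - exact/closure_itri/ept_ctri.
  - exact: ept_Gh.
  - move=> x; rewrite inE => ix; have [rx xE] := itri_coord (area2_neq0 hT _) ix.
    by rewrite -{1}xE uPE.
  - exact: (cont_comp (@cP _) (@continuous_coord _ _ _)).
by rewrite /jumpl !H.
Qed.

Lemma within_jumpl e : {within elift G e, continuous (jumpl G e (glift G T u))}.
Proof.
pose w s x := P (adj e s).1 (coord (adj e s).1 x).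
have cw s : continuous (w s) by exact: (cont_comp (@cP _) (@continuous_coord _ _ _)).
have c : {within elift G e, continuous ((fun x => w true x - w false x) \o unlift_pt G T)}.
  apply: (within_comp (B := setT)) => //.
    apply: (@continuous_subspaceW _ _ _ (pts G)) within_unlift.
    by move=> _ [_ [r r01 <-] <-]; apply: zP; exact: ept_Gh.
  move=> y _; apply: cvg_within_filter; exact: (contB (cw true) (cw false)).
apply: (subspace_eq_continuous _ c) => y; rewrite inE => -[_ [r r01 <-] <-].
by rewrite /from_subspace jumpl_param//= zK//; exact: ept_Gh.
Qed.

End OneTime.

End LiftedIntegrals.

Section LineIntegral.
Variables (R : realType) (m : nat) (G : surface R) (Nb : set 'rV[R]_3) (T : mesh R).
Local Notation R3 := ('rV[R]_3).
Local Notation B3 := (borel3 R).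
Local Notation mu := (@lebesgue_measure R).
Hypothesis hG : closed_oriented_surface m G.
Hypothesis hNb : tubular_nbhd G Nb.
Hypothesis hT : admissible T.
Hypothesis hGh : Gh T `<=` Nb.
Hypothesis hbij : set_bij (Gh T) (pts G) (zeta G).
Variables (k : nat) (u : R3 -> R) (P : tria T -> R * R -> R).
Hypothesis cP : forall K, continuous (P K).
Hypothesis uPE : forall K p, ref_tri p -> u (tpt K p) = P K p.

Let elift_pts (e : edge T) : elift G e `<=` pts G.
Proof.
by move=> _ [_ [r r01 <-] <-]; apply: (zeta_pts hNb hGh); exact: (ept_Gh hT).
Qed.

Let within_zeta_ept e : {within `[0, 1]%classic, continuous (zeta G \o ept (T := T) e)}.
Proof.
apply: (within_comp (B := Gh T) _ _ (continuous_zeta hG hNb hGh)).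
  exact/continuous_subspaceT/continuous_ept.
by move=> r r01; exact: (ept_Gh hT).
Qed.

Lemma measurable_elift e : measurable (elift (T := T) G e : set B3).
Proof.
apply: closed_borel; apply: compact_closed; first exact: norm_hausdorff.
have -> : elift (T := T) G e = (zeta G \o ept e) @` `[0, 1]%classic.
  by rewrite /elift /eset image_comp.
by apply: continuous_compact; [exact: within_zeta_ept|exact: segment_compact].
Qed.

(** The line measure of a lifted edge is handled as the surface measure, and the
jump of a lift is the lift of the jump. *)
Lemma ge0_line_integral (e : edge T) (ds : {measure set B3 -> \bar R}) (delta : R3 -> R) (c : R) :
  0 <= c -> line_quotient G e ds delta ->
  (\int[ds]_(y in elift G e) ((glift G T delta y)^-1 * c *
      jumpl G e (glift G T u) y ^+ 2)%:E =
   (eint e (fun x => c * jump e u x ^+ 2))%:E)%E.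
Proof.
move=> c0 [md dpos dE]; rewrite integral_mkcond; set f := _ \_ _.
have zK := zetaK hNb hGh hbij.
have lift_e y : elift G e y -> eset e (unlift_pt G T y).
  by move=> [_ [r r01 <-] <-]; rewrite zK; [exists r|exact: (ept_Gh hT)].
have mE : measurable (eset e : set B3).
  apply: closed_borel; apply: compact_closed; first exact: norm_hausdorff.
  apply: continuous_compact; last exact: segment_compact.
  exact/continuous_subspaceT/continuous_ept.
have mdl : measurable_fun (elift (T := T) G e : set B3) (glift G T delta : B3 -> R).
  apply: (measurable_comp mE _ md); first by move=> _ [y ey <-]; exact: lift_e.
  apply: within_borel; first exact: measurable_elift.
  apply: (@continuous_subspaceW _ _ _ (pts G)) (within_unlift hG hNb hGh hbij).
  exact: elift_pts.
have mj : measurable_fun (elift (T := T) G e : set B3) (jumpl G e (glift G T u) : B3 -> R).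
  apply: within_borelR; first exact: measurable_elift.
  exact: (within_jumpl hG hNb hT hGh hbij cP uPE).
have mf : measurable_fun setT f.
  apply/(measurable_restrictT _ (@measurable_elift e))/measurable_EFinP.
  apply: measurable_funM; last exact: measurable_funX.
  apply: measurable_funM => //.
  by apply: measurable_inv_pos => // y /lift_e; exact: dpos.
have f0 y : (0 <= f y)%E.
  rewrite /f patchE; case: ifPn => // yG; rewrite lee_fin; apply: mulr_ge0; last exact: sqr_ge0.
  by apply: mulr_ge0 => //; rewrite inE in yG; rewrite invr_ge0; apply/ltW/dpos/lift_e.
have mI : measurable (`[0, 1]%classic : set (measurableTypeR R)) by exact: measurable_itv.
have me : measurable_fun (`[0, 1]%classic : set (measurableTypeR R))
    (ept e : measurableTypeR R -> B3).
  by apply: within_borel1 => //; exact/continuous_subspaceT/continuous_ept.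
rewrite (@ge0_integral_transfer _ _ _ (borel3 R) R 'I_1 (fun=> elen e) (@lebesgue_measure R)
  (fun=> `[0, 1]%classic) (fun _ r => zeta G (ept e r)) (fun _ r => delta (ept e r)) ds)//.
- rewrite big_ord1 /eint EFinM; congr (_ * _)%E.
  pose j r := P (adj e true).1 (ecoord e true r) - P (adj e false).1 (ecoord e false r).
  have cj : continuous (fun r => c * (j r * j r)).
    have c' s : continuous (fun r => P (adj e s).1 (ecoord e s r)).
      exact: (cont_comp (@cP _) (@continuous_ecoord _ _ e s)).
    have cj : continuous j by exact: (contB (@c' true) (@c' false)).
    exact: (contM (contC c) (contM cj cj)).
  transitivity (\int[mu]_(r in `[0%R, 1%R]) (c * (j r * j r))%:E)%E.
    apply: eq_integral => r; rewrite inE => r01.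
    have er : elift (T := T) G e (zeta G (ept e r)) by exists (ept e r) => //; exists r.
    rewrite /f patchE ifT; last by rewrite inE.
    rewrite (jumpl_param hG hNb hT hGh hbij cP uPE)// -/(j r) -EFinM /glift zK; last exact: (ept_Gh hT).
    have d0 : delta (ept e r) != 0 by rewrite gt_eqF// dpos//; exists r.
    by congr EFin; field.
  rewrite -[LHS]fineK; last by apply: integrable_fin_num => //; exact: continuous_int01.
  congr EFin; apply: eq_Rintegral => r; rewrite inE => r01.
  have et s : etrace e s u (ept e r) = P (adj e s).1 (ecoord e s r).
    by apply: (etrace_ept hT (@Rhausdorff R) (@cP _) _ r01) => p; exact: uPE.
  by rewrite /jump !et expr2.
- by move=> _; exact/ltW/elen_gt0.
- by move=> _; exact: (within_borel1 mI (@within_zeta_ept e)).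
- move=> _; apply: (measurable_comp mE _ md me).
  by move=> _ [r r01 <-]; exists r.
- by move=> _ r r01; apply/ltW/dpos; exists r.
- by move=> B mB; rewrite big_ord1 dE.
Qed.

End LineIntegral.

(** * The initial energy *)

Section DiscreteIntegrals.
Variables (R : realType) (T : mesh R).
Local Notation R3 := ('rV[R]_3).
Local Notation B3 := (borel3 R).
Implicit Types (K : tria T).

Lemma tinte_tint K (f : R3 -> R) (h : R * R -> R) : continuous h ->
  (forall p, ref_tri p -> f (tpt K p) = h p) ->
  tinte K (fun x => (f x)%:E) = (tint K f)%:E.
Proof.
move=> ch fh; rewrite /tinte /tint EFinM; congr (_ * _)%E.
rewrite fineK//; apply: integrable_fin_num; first exact: measurable_ref_tri.
apply: eq_integrable (continuous_integrable_ref ch); first exact: measurable_ref_tri.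
by move=> p; rewrite inE => rp /=; rewrite fh.
Qed.

Lemma Sh_rep k (u : R3 -> R) : Sh T k u ->
  exists P, forall K : tria T, continuous (P K) /\ forall p, ref_tri p -> u (tpt K p) = P K p.
Proof.
move=> [_ hu].
have /choice[P HP] : forall K : tria T, exists P : R * R -> R,
    continuous P /\ forall p, ref_tri p -> u (tpt K p) = P p.
  move=> K; have [P [d1 [d2 [CP E]]]] := is_poly_C1 (hu K).
  by exists P; split => //; exact: C1_continuous CP.
by exists P.
Qed.

(** Testing the projection with itself, |uh|^2 = (u0, uh) <= |u0|^2/2 + |uh|^2/2. *)
Lemma L2_projection_le (m : nat) (G : surface R) (Nb : set R3) k (u0 uh : R3 -> R) :
  admissible T -> closed_oriented_surface m G -> tubular_nbhd G Nb -> Gh T `<=` Nb ->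
  is_L2_projection G T k u0 uh ->
  ((\sum_(K : tria T) tint K (fun x => uh x ^+ 2))%:E <=
   \sum_(K : tria T) tinte K (fun x => (u0 (zeta G x) ^+ 2)%:E))%E.
Proof.
move=> hT hG hNb hGh [mu0 fin hS hp].
have [P HP] := Sh_rep hS.
have A0 K : 0 < area2 K.
  by rewrite lt_neqAle area_elt_ge0 eq_sym area2_neq0.
pose v K (p : R * R) : R := u0 (zeta G (tpt K p)).
have mv K : measurable_fun (@ref_tri R : set (measurableTypeR R * measurableTypeR R)%type)
    (v K : (measurableTypeR R * measurableTypeR R)%type -> R).
  apply: (measurable_comp (measurable_pts hG) _ mu0).
    by move=> _ [p rp <-]; apply: (zeta_pts hNb hGh); exact: tpt_Gh.
  apply: within_borel2; first exact: measurable_ref_tri.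
  apply: (within_comp (B := Gh T) _ _ (continuous_zeta hG hNb hGh)); last first.
    by move=> p rp; exact: tpt_Gh.
  exact/continuous_subspaceT/continuous_tpt.
have mref := @measurable_ref_tri R.
have finK K : (\int[@lebesgue2 R]_(p in @ref_tri R) (v K p ^+ 2)%:E < +oo)%E.
  rewrite ltNge leye_eq; apply/negP => /eqP E; move: fin; rewrite ltNge => /negP; apply.
  rewrite (bigD1 K)//= {1}/tinte -/(v K) E gt0_muley ?lte_fin//.
  apply: leeDl; apply: sume_ge0 => K' _; apply: mule_ge0; first by rewrite lee_fin ltW.
  by apply: integral_ge0 => p _; rewrite lee_fin sqr_ge0.
have Iv K : (@lebesgue2 R).-integrable (@ref_tri R) (EFin \o (fun p => v K p ^+ 2)).
  apply/integrableP; split; first by apply/measurable_EFinP; exact: measurable_funX.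
  apply: le_lt_trans (finK K); rewrite le_eqVlt; apply/orP; left; apply/eqP.
  by apply: eq_integral => p _ /=; rewrite ger0_norm ?sqr_ge0.
have cPK K : continuous (P K) by case: (HP K).
have IP K : (@lebesgue2 R).-integrable (@ref_tri R) (EFin \o (fun p => P K p ^+ 2)).
  rewrite (_ : (fun _ => _) = (fun p => P K p * P K p)); last first.
    by apply/funext => p; rewrite expr2.
  by apply: continuous_integrable_ref; exact: contM.
have IvP K : (@lebesgue2 R).-integrable (@ref_tri R) (EFin \o (fun p => v K p ^+ 2 + P K p ^+ 2)).
  have := integrableD mref (Iv K) (IP K); by apply: eq_integrable => // p _.
have Ix K : (@lebesgue2 R).-integrable (@ref_tri R) (EFin \o (fun p => v K p * P K p)).
  apply: (le_integrable mref _ _ (IvP K)).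
    apply/measurable_EFinP; apply: measurable_funM; first exact: mv.
    by apply: measurable_funTS; exact: continuous_measurable2.
  move=> p _ /=; rewrite lee_fin (ger0_norm (addr_ge0 (sqr_ge0 _) (sqr_ge0 _))).
  rewrite ler_norml; apply/andP; split; nra.
have tv K : tinte K (fun x => (u0 (zeta G x) ^+ 2)%:E) =
    (area2 K * \int[@lebesgue2 R]_(p in @ref_tri R) (v K p ^+ 2))%:E.
  rewrite /tinte EFinM; congr (_ * _)%E; rewrite fineK//.
  by apply: integrable_fin_num => //; exact: Iv.
rewrite (eq_bigr _ (fun K _ => tv K)) sumEFin lee_fin.
have tP K : tint K (fun x => uh x ^+ 2) =
    area2 K * \int[@lebesgue2 R]_(p in @ref_tri R) (P K p ^+ 2).
  by apply: tint_ref => p rp; have [_ ->] := HP K.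
have tvP K : tint K (fun x => u0 (zeta G x) * uh x) =
    area2 K * \int[@lebesgue2 R]_(p in @ref_tri R) (v K p * P K p).
  by apply: tint_ref => p rp; have [_ ->] := HP K.
have leK K : tint K (fun x => u0 (zeta G x) * uh x) <=
    2^-1 * (area2 K * \int[@lebesgue2 R]_(p in @ref_tri R) (v K p ^+ 2)) +
    2^-1 * tint K (fun x => uh x ^+ 2).
  rewrite tvP tP -mulrDr -mulrDr mulrCA ler_pM2l//.
  rewrite -RintegralD// -RintegralZl//; apply: le_Rintegral => //.
    exact: (integrableZl mref 2^-1 (IvP K)).
  move=> p _ /=; move: (v K p) (P K p) => x y; have := sqr_ge0 (x - y); nra.
have hpu := hp _ hS.
have : \sum_(K : tria T) tint K (fun x => uh x ^+ 2) <=
    \sum_(K : tria T) (2^-1 * (area2 K * \int[@lebesgue2 R]_(p in @ref_tri R) (v K p ^+ 2)) +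
    2^-1 * tint K (fun x => uh x ^+ 2)).
  apply: (@le_trans _ _ (\sum_(K : tria T) tint K (fun x => u0 (zeta G x) * uh x))).
    by rewrite -hpu le_eqVlt eqxx.
  by apply: ler_sum => K _; exact: leK.
have half_le (x y : R) : x <= 2^-1 * y + 2^-1 * x -> x <= y by clear; lra.
by rewrite big_split/= -!mulr_sumr; exact: half_le.
Qed.

End DiscreteIntegrals.

(** * The estimate *)

Section EnergyEstimate.
Variables (R : realType) (T : mesh R).
Local Notation R3 := ('rV[R]_3).
Local Notation B3 := (borel3 R).

(** A supremum which does not exist is 0 by convention. *)
Lemma alpha_ge0 (wh : R3 -> R3) (e : edge T) : 0 <= alpha wh e.
Proof.
rewrite /alpha; set A := [set _ | _ in _].
have [hs|hs] := pselect (has_sup A); last by rewrite sup_out.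
have [x Ax] := hs.1; apply: (@le_trans _ _ x).
  by case: Ax => y _ <-; exact: normr_ge0.
by apply: ub_le_sup => //; exact: hs.2.
Qed.

Lemma dissipation_ge0 (wh : R3 -> R3) (e : edge T) : 0 <= C11 e + alpha wh e / 2.
Proof.
by rewrite addr_ge0// ?divr_ge0 ?alpha_ge0// invr_ge0; exact: sqrtr_ge0.
Qed.

Lemma measurable_dot (D : set B3) (q : R3 -> R3) :
  (forall i, measurable_fun D ((fun x => q x 0 i) : B3 -> R)) ->
  measurable_fun D ((fun x => dot (q x) (q x)) : B3 -> R).
Proof.
move=> mq; rewrite (_ : (fun _ => _) = (fun x : B3 => \sum_i q x 0 i * q x 0 i)).
  by apply: measurable_sum => i; exact: measurable_funM.
by apply/funext => x; rewrite dotE.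
Qed.

Lemma Sigmah_rep k (q : R3 -> R3) : Sigmah T k q ->
  exists Q : tria T -> R * R -> R, forall K, continuous (Q K) /\
    forall p, ref_tri p -> dot (q (tpt K p)) (q (tpt K p)) = Q K p.
Proof.
move=> hq; suff /choice[Q HQ] : forall K : tria T, exists Q : R * R -> R, continuous Q /\
    forall p, ref_tri p -> dot (q (tpt K p)) (q (tpt K p)) = Q p by exists Q.
move=> K; have qj j : is_poly k K (fun x => q x 0 j) by case: (hq j).
have [F [d1 [d2 [CF E]]]] := is_poly_C1v qj.
exists (fun p => \sum_j F p 0 j * F p 0 j); split.
  by apply: cont_sum => j; apply: contM; exact: C1_continuous (CF j).
by move=> p rp; rewrite E// dotE.
Qed.

End EnergyEstimate.

Theorem proposition1 (R : realType)
  (* surface, tubular neighbourhood, triangulation *)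
  (m : nat) (hm : (0 < m)%N)
  (G : surface R) (hG : closed_oriented_surface m G)
  (Nb : set 'rV[R]_3) (hNb : tubular_nbhd G Nb)
  (T : mesh R) (hT : admissible T)
  (hvtx : forall K i, pts G (vtx (m := T) K i))
  (hGh : Gh T `<=` Nb)
  (hbij : set_bij (Gh T) (pts G) (zeta G))
  (N : tria T -> int) (hN : injective N)
  (* measures and their quotients *)
  (dA : {measure set (borel3 R) -> \bar R})
  (hdA : is_surface_measure m (pts G) dA)
  (ds : edge T -> {measure set (borel3 R) -> \bar R})
  (hds : forall e, is_line_measure (elift G e) (ds e))
  (deltah : 'rV[R]_3 -> R) (hdeltah : surface_quotient G T dA deltah)
  (deltae : edge T -> 'rV[R]_3 -> R)
  (hdeltae : forall e, line_quotient G e (ds e) (deltae e))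
  (* data *)
  (a g : R -> R) (ha : forall z, 0 < a z) (hac : continuous a)
  (hg : forall z : R, is_derive z 1 g (Num.sqrt (a z)))
  (w : 'rV[R]_3 -> 'rV[R]_3) (hw : tangent_field G w)
  (r : nat) (Ih : ('rV[R]_3 -> 'rV[R]_3) -> 'rV[R]_3 -> 'rV[R]_3)
  (hIh : RT_interpolation T G r Ih)
  (* semi-discrete solution *)
  (k : nat) (tf : R) (htf : 0 < tf)
  (u : R -> 'rV[R]_3 -> R) (q : R -> 'rV[R]_3 -> 'rV[R]_3)
  (hsol : LDG_solution a g (Ih w) N k tf u q)
  (u0 : 'rV[R]_3 -> R) (hu0 : is_L2_projection G T k u0 (u 0)) :
  let ul := fun t => glift G T (u t) in
  let ql := fun t => glift G T (q t) in
  ((2^-1)%:E * \int[dA]_(y in pts G) ((glift G T deltah y)^-1 * ul tf y ^+ 2)%:E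
   + \int[@lebesgue_measure R]_(t in `[0%R, tf]%classic)
       \int[dA]_(y in pts G)
         ((glift G T deltah y)^-1 * dot (ql t y) (ql t y))%:E
   + Theta G (Ih w) ds deltae tf ul
   <= (2^-1)%:E * \int[dA]_(y in pts G) ((glift G T deltah y)^-1 * u0 y ^+ 2)%:E)%E.
Proof.
cbv zeta; pose ul t := glift G T (u t); pose ql t := glift G T (q t).
have [hS cu du equ eqq] := hsol.
have hwh : RTh T r (Ih w) := hIh.1 w hw.
have hu t : t \in `[0, tf] -> Sh T k (u t) by move=> /hS[].
have t_0 : 0 \in `[0, tf] by rewrite in_itv/= lexx ltW.
have t_f : tf \in `[0, tf] by rewrite in_itv/= lexx ltW.
pose En := energy T u.
have EnE t : t \in `[0, tf] ->
    (\int[dA]_(y in pts G) ((glift G T deltah y)^-1 * ul t y ^+ 2)%:E = (En t)%:E)%E.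
  move=> tI; have [mu _] := hu t tI; have [P HP] := Sh_rep (hu t tI).
  rewrite (ge0_surface_integral hG hNb hGh hbij (F := fun x => u t x ^+ 2) hdeltah).
  - rewrite -sumEFin; apply: eq_bigr => K _.
    apply: (tinte_tint (h := fun p => P K p * P K p)).
      by apply: contM; case: (HP K).
    by move=> p rp; have [_ ->] := HP K; rewrite // expr2.
  - exact: measurable_funX.
  - by move=> x; exact: sqr_ge0.
pose Qn t : R := \sum_(K : tria T) tint K (fun x => dot (q t x) (q t x)).
have QnE t : t \in `[0, tf] -> (\int[dA]_(y in pts G)
      ((glift G T deltah y)^-1 * dot (ql t y) (ql t y))%:E = (Qn t)%:E)%E.
  move=> tI; have [_ hq] := hS t tI; have [Q HQ] := Sigmah_rep hq.
  rewrite (ge0_surface_integral hG hNb hGh hbij (F := fun x => dot (q t x) (q t x)) hdeltah).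
  - rewrite -sumEFin; apply: eq_bigr => K _; have [cQ QE] := HQ K.
    exact: tinte_tint cQ QE.
  - by apply: measurable_dot => i; case: (hq i).
  - by move=> x; exact: dot_ge0.
pose c (e : edge T) : R := C11 e + alpha (Ih w) e / 2.
pose Th t : R := \sum_(e : edge T) eint e (fun x => c e * jump e (u t) x ^+ 2).
have ThE t : t \in `[0, tf] -> (\sum_(e : edge T) \int[ds e]_(y in elift G e)
      ((glift G T (deltae e) y)^-1 * c e * jumpl G e (ul t) y ^+ 2)%:E = (Th t)%:E)%E.
  move=> tI; have [P HP] := Sh_rep (hu t tI).
  rewrite -sumEFin; apply: eq_bigr => e _.
  apply: (ge0_line_integral hG hNb hT hGh hbij (P := P)) => //.
  - by move=> K; case: (HP K).
  - by move=> K; case: (HP K).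
  - exact: dissipation_ge0.
have Qn0 t : 0 <= Qn t.
  apply: sumr_ge0 => K _; apply: mulr_ge0; first exact: area_elt_ge0.
  by apply: Rintegral_ge0 => p _; exact: dot_ge0.
have Th0 t : 0 <= Th t.
  apply: sumr_ge0 => e _; apply: mulr_ge0; first exact: sqrtr_ge0.
  by apply: Rintegral_ge0 => s _; rewrite mulr_ge0 ?dissipation_ge0 ?sqr_ge0.
have dissipated : (\int[@lebesgue_measure R]_(t in `[0%R, tf]%classic) (Qn t)%:E +
    \int[@lebesgue_measure R]_(t in `[0%R, tf]%classic) (Th t)%:E <=
    (2^-1 * En 0 - 2^-1 * En tf)%:E)%E.
  apply: (@le_trans _ _ (\int[@lebesgue_measure R]_(t in `[0%R, tf]%classic)
    ((Qn t)%:E + (Th t)%:E))%E).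
    by apply: ge0_integral_superadditive => t _; rewrite lee_fin.
  apply: (@int_derivative_le R (fun t => 2^-1 * En t)) => //.
  - have cE := energy_continuous hu cu.
    exact: (contM (contC 2^-1) cE).
  - by move=> t _; rewrite -EFinD lee_fin addr_ge0.
  - move=> t tI; have tI' : t \in `[0, tf] by exact: subset_itv_oo_cc.
    have dE := energy_derive hu du tI.
    have dE2 : is_derive t 1 (fun t => 2^-1 * En t)
        (\sum_(K : tria T) tint K (fun x => derive1 (u^~ x) t * u t x)).
      apply: (is_derive_eq (is_deriveZ 2^-1 dE)).
      by rewrite /GRing.scale/= mulrA mulVf ?mul1r.
    have [D Dv] := dE2; split => //; rewrite derive1E Dv -EFinD lee_fin.
    have [_ hq] := hS t tI'.
    have := energy_balance hT hac hg hwh (hu t tI') hq (equ t tI _ (hu t tI')) (eqq t tI _ hq).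
    rewrite -/(Qn t) -/(Th t); move: (\sum_(K : tria T) tint K _) (Qn t) (Th t) => x y z.
    by clear; lra.
have init_le : ((En 0)%:E <= \int[dA]_(y in pts G) ((glift G T deltah y)^-1 * u0 y ^+ 2)%:E)%E.
  apply: (le_trans (L2_projection_le hT hG hNb hGh hu0)).
  rewrite -(ge0_surface_integral hG hNb hGh hbij (F := fun x => u0 (zeta G x) ^+ 2) hdeltah).
  - rewrite le_eqVlt; apply/orP; left; apply/eqP; apply: eq_integral => y.
    by rewrite inE /glift => /(unliftP hbij)[_ ->].
  - have [mu0 _ _ _] := hu0; apply: measurable_funX.
    apply: (measurable_comp (measurable_pts hG) _ mu0).
      by move=> _ [x Gx <-]; exact: (zeta_pts hNb hGh).
    by apply: within_borel; [exact: measurable_Gh|exact: (within_zeta hG hNb hGh)].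
  - by move=> x; exact: sqr_ge0.
rewrite EnE// /Theta.
rewrite [X in (_ + X + _)%E](_ : _ =
  \int[@lebesgue_measure R]_(t in `[0%R, tf]%classic) (Qn t)%:E)%E; last first.
  by apply: eq_integral => t; rewrite inE => tI; exact: QnE.
rewrite [X in (_ + _ + X)%E](_ : _ =
  \int[@lebesgue_measure R]_(t in `[0%R, tf]%classic) (Th t)%:E)%E; last first.
  by apply: eq_integral => t; rewrite inE => tI; exact: ThE.
apply: (@le_trans _ _ ((2^-1)%:E * (En 0)%:E)%E); last first.
  by apply: lee_wpmul2l => //; rewrite lee_fin.
rewrite -addeA -!EFinM; apply: (le_trans (leeD2l _ dissipated)).
by rewrite -EFinD lee_fin addrC subrK.
Qed.
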